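(* Let $w\in S_\infty$. The set $\mathsf{Decr}_n(w)$ has a normal $\sqrt{\mathfrak{gl}_n}$-crystal structure with weight map $\mathrm{wt}(a)=(\ell(a^1),\dots,\ell(a^n))$ such that $a\in\mathsf{Decr}_n(w)$ is a highest weight element if and only if $\mathsf{tab}(a)$ is an increasing tableau.
   Context: $S_\infty$ is the group of finitely supported permutations of $\mathbb{Z}_{>0}$, $s_i=(i,i+1)$. The Demazure product $\circ$ is the unique associative operation on $S_\infty$ with $s_i\circ s_i=s_i$ and $w\circ s_i=ws_i$ whenever $w(i)<w(i+1)$. A Hecke word for $w$ is a sequence $i_1\cdots i_k$ of positive integers with $w=s_{i_1}\circ\cdots\circ s_{i_k}$. For a fixed positive integer $n$, a decreasing Hecke factorization of $w$ is an $n$-tuple $a=(a^1,\dots,a^n)$ of strictly decreasing (possibly empty) words of positive integers whose concatenation $a^1a^2\cdots a^n$ is a Hecke word for $w$; $\mathsf{Decr}_n(w)$ is the set of these, and $\ell(a^i)$ is the length of $a^i$. $\mathsf{tab}(a)$ is the left-justified tableau whose row $i$ is the reversal of $a^i$. An increasing tableau is a filling of the Young diagram $\{(i,j):1\le j\le\lambda_i\}$ of a partition $\lambda$ by positive integers with strictly increasing rows and columns. Crystal notions: $[n]=\{1,\dots,n\}$, $\mathbf{e}_k$ standard basis of $\mathbb{Z}^n$. A $\sqrt{\mathfrak{gl}_n}$-crystal is a set $\mathcal{B}$ with $\mathrm{wt}:\mathcal{B}\to\mathbb{Z}^n$ and $e_i,f_i:\mathcal{B}\to\mathcal{B}\sqcup\{0\}$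 ($i\in[n-1]$, $e_i(0)=f_i(0)=0$) such that, with $\varepsilon_i(b)=\sup\{k:e_i^k(b)\ne0\}$, $\varphi_i(b)=\sup\{k:f_i^k(b)\neq0\}$: (a) these are finite and $\frac{\varphi_i(b)-\varepsilon_i(b)}{2}=\mathrm{wt}(b)_i-\mathrm{wt}(b)_{i+1}$; (b) $e_i(b)=c$ iff $f_i(c)=b$, and then $\mathrm{wt}(c)-\mathrm{wt}(b)$ is $\mathbf{e}_i$ if $\varepsilon_i(b)$ is even and $-\mathbf{e}_{i+1}$ if odd. Highest weight means $e_i(b)=0$ for all $i$; full subcrystals are weakly connected components of the graph with edges $b\to f_i(b)$; isomorphisms preserve weights and operators. Tensor product: $\mathrm{wt}(b\otimes c)=\mathrm{wt}(b)+\mathrm{wt}(c)$, $e_i(b\otimes c)=b\otimes e_i(c)$ if $\varepsilon_i(b)\le\varphi_i(c)$ else $e_i(b)\otimes c$; $f_i(b\otimes c)=b\otimes f_i(c)$ if $\varepsilon_i(b)<\varphi_i(c)$ else $f_i(b)\otimes c$; $b\otimes 0=0\otimes c=0$. $\mathbb{1}_n$ is a single element of weight $0$ with zero operators. $\mathsf{SS}_n$ is the set of nonempty $S\subseteq[n]$, $\mathrm{wt}(S)=\sum_{j\in S}\mathbf{e}_j$, $e_i(S)=S\cup\{i\}$ if $S\cap\{i,i+1\}=\{i+1\}$, $S\setminus\{i+1\}$ if $S\cap\{i,i+1\}=\{i,i+1\}$, else $0$; $f_i(S)=S\cup\{i+1\}$ if $S\cap\{i,i+1\}=\{i\}$, $S\setminus\{i\}$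 if $S\cap\{i,i+1\}=\{i,i+1\}$, else $0$. A $\sqrt{\mathfrak{gl}_n}$-crystal is normal if every full subcrystal is isomorphic to a full subcrystal of $\mathsf{SS}_n^{\otimes m}$ for some $m\ge0$ ($\mathsf{SS}_n^{\otimes 0}=\mathbb{1}_n$). *)

(* Defs.v *)
From HB Require Import structures.
From Stdlib Require Import Relation_Operators.
From mathcomp Require Import all_boot all_order all_algebra finmap zify.
From mathcomp Require Import boolp classical_sets functions.

Set Implicit Arguments.
Unset Strict Implicit.
Unset Printing Implicit Defensive.

Import Order.TTheory GRing.Theory.

(* A permutation of the positive integers is encoded as a permutation of nat
   fixing 0; a finitely supported injection is automatically bijective. *)
Record Sinf := MkSinf {
  sfun :> {fsfun nat -> nat of x => x};
  sfunP : fsinjectiveb sfun && (sfun 0 == 0)%N }.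

HB.instance Definition _ := [isSub for sfun].
HB.instance Definition _ := [Choice of Sinf by <:].

Section SinfGroup.

Local Open Scope group_scope.

Implicit Types (u v w : Sinf) (i j x y : nat).

Lemma sinf_inj w : injective w.
Proof. by case/andP: (sfunP w) => /fsinjectiveP. Qed.

Lemma sinf0 w : w 0 = 0.
Proof. by case/andP: (sfunP w) => _ /eqP. Qed.

Lemma sinfP u v : u =1 v -> u = v.
Proof. by move=> uv; apply/val_inj/fsfunP. Qed.

Lemma sinf_surj w y : exists x, w x == y.
Proof.
case: (finsuppP w y) => [y_out|y_in].
  by exists y; rewrite fsfun_dflt.
case/andP: (sfunP w) => /imfset_eq_fsinjectiveP im_w _.
by move: y_in; rewrite -{1}im_w => /imfsetP[x _ ->]; exists x.
Qed.

Lemma sinf_mul_subproof u v :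
  fsinjectiveb (fsfun_comp u v) && ((fsfun_comp u v) 0 == 0)%N.
Proof.
apply/andP; split; last by rewrite fscompE /= !sinf0.
by apply/fsinjectiveP/fscomp_inj; apply: sinf_inj.
Qed.
(* (u * v) x = u (v x) *)
Definition sinf_mul u v := MkSinf (sinf_mul_subproof u v).

Lemma sinf_one_subproof :
  fsinjectiveb ([fsfun] : {fsfun nat -> nat of x => x})
  && (([fsfun] : {fsfun nat -> nat of x => x}) 0 == 0)%N.
Proof.
apply/andP; split; last by rewrite fsfun0E.
by apply/fsinjectiveP => x y; rewrite !fsfun0E.
Qed.
Definition sinf_one := MkSinf sinf_one_subproof.

Definition sinf_inv_fun w : {fsfun nat -> nat of x => x} :=
  [fsfun y in finsupp w => xchoose (sinf_surj w y)].

Lemma sinf_inv_funK w : cancel (sinf_inv_fun w) w.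
Proof.
move=> y; rewrite fsfunE; case: ifPn => [_|]; last exact: fsfun_dflt.
exact/eqP/(xchooseP (sinf_surj w y)).
Qed.

Lemma sinf_inv_subproof w :
  fsinjectiveb (sinf_inv_fun w) && (sinf_inv_fun w 0 == 0)%N.
Proof.
apply/andP; split; first exact/fsinjectiveP/(can_inj (@sinf_inv_funK w)).
by apply/eqP/(@sinf_inj w); rewrite sinf_inv_funK sinf0.
Qed.
Definition sinf_inv w := MkSinf (sinf_inv_subproof w).

Lemma sinf_mulA : associative sinf_mul.
Proof. by move=> u v w; apply/val_inj/fscompA. Qed.

Lemma sinf_mul1 : left_id sinf_one sinf_mul.
Proof. by move=> u; apply: sinfP => x; rewrite /= fscompE /= fsfun0E. Qed.

Lemma sinf_mulr1 : right_id sinf_one sinf_mul.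
Proof. by move=> u; apply: sinfP => x; rewrite /= fscompE /= fsfun0E. Qed.

Lemma sinf_mulrV : right_inverse sinf_one sinf_inv sinf_mul.
Proof.
by move=> u; apply: sinfP => x; rewrite /= fscompE /= fsfun0E sinf_inv_funK.
Qed.

Lemma sinf_mulVr : left_inverse sinf_one sinf_inv sinf_mul.
Proof.
move=> u; apply: sinfP => x; apply: (@sinf_inj u).
by rewrite /= fscompE /= fsfun0E sinf_inv_funK.
Qed.

HB.instance Definition _ :=
  isGroup.Build Sinf sinf_mulA sinf_mul1 sinf_mulr1 sinf_mulVr sinf_mulrV.

Lemma sinfM u v x : (u * v) x = u (v x).
Proof. exact: fscompE. Qed.

Lemma sinf1 x : (1 : Sinf) x = x.
Proof. exact: fsfun0E. Qed.

End SinfGroup.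

(* The transposition (i, i+1); for i = 0, which is not a generator, the junk
   value is the identity. *)
Definition simple_fun i : {fsfun nat -> nat of x => x} :=
  [fsfun x in [fset i; i.+1]%fset =>
    if (i == 0)%N then x else if x == i then i.+1 else i].

Section Demazure.

Local Open Scope group_scope.

Implicit Types (u v w : Sinf) (i j x y : nat) (s : seq nat).

Lemma simple_funE i x :
  simple_fun i x = if (i == 0)%N then x else
                   if x == i then i.+1 else if x == i.+1 then i else x.
Proof.
rewrite fsfunE !inE; case: (x == i) => //=.
by case: (x == i.+1); case: (i == 0)%N.
Qed.

Lemma simple_subproof i :
  fsinjectiveb (simple_fun i) && (simple_fun i 0 == 0)%N.
Proof.
apply/andP; split; last by rewrite simple_funE; case: i.
apply/fsinjectiveP => x y; rewrite !simple_funE.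
by do ![case: eqP => //]; lia.
Qed.
Definition simple i := MkSinf (simple_subproof i).

(* The product of S_infty is composition of functions, so w * simple i swaps
   the values of w at i and i.+1. *)
Definition is_demazure (op : Sinf -> Sinf -> Sinf) : Prop :=
  [/\ associative op,
      forall i, (0 < i)%N -> op (simple i) (simple i) = simple i &
      forall w i, (0 < i)%N -> (w i < w i.+1)%N ->
        op w (simple i) = w * simple i].

Let step w i := if (w i < w i.+1)%N then w * simple i else w.
Let lstep i w := (step w^-1 i)^-1.

Let simpleE i x : (0 < i)%N ->
  simple i x = if x == i then i.+1 else if x == i.+1 then i else x.
Proof. by rewrite /= simple_funE; case: eqP => //; lia. Qed.

Let simple0 : simple 0 = 1.
Proof. by apply: sinfP => x; rewrite sinf1 /= simple_funE. Qed.

Let simpleK i : simple i * simple i = 1.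
Proof.
case: (posnP i) => [->|i0]; first by rewrite simple0 mulg1.
apply: sinfP => x; rewrite sinfM sinf1 !simpleE //.
by do ![case: eqP => //]; lia.
Qed.

Let simpleV i : (simple i)^-1 = simple i.
Proof. by apply: (mulgI (simple i)); rewrite mulgV simpleK. Qed.

Let simple_lt i x y : (0 < i)%N -> x <> y ->
  ~ (x = i /\ y = i.+1) -> ~ (x = i.+1 /\ y = i) ->
  (simple i x < simple i y)%N = (x < y)%N.
Proof. by move=> i0; rewrite !simpleE //; do ![case: eqP => //]; lia. Qed.

Let step0 w : step w 0 = w.
Proof. by rewrite /step simple0 mulg1 if_same. Qed.

Let step_lstep i j w : lstep i (step w j) = step (lstep i w) j.
Proof.
case: (posnP i) => [->|i0]; first by rewrite /lstep !step0 !invgK.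
case: (posnP j) => [->|j0]; first by rewrite !step0.
have lstepE u : lstep i u =
    if (u^-1 i < u^-1 i.+1)%N then simple i * u else u.
  by rewrite /lstep /step; case: ifP; rewrite ?invgM ?invgK ?simpleV.
set p := w^-1 i; set q := w^-1 i.+1.
have wp : w p = i by rewrite /p -sinfM mulgV sinf1.
have wq : w q = i.+1 by rewrite /q -sinfM mulgV sinf1.
have pE x : w x = i -> x = p by move=> wx; apply: (@sinf_inj w); rewrite wx.
have qE x : w x = i.+1 -> x = q by move=> wx; apply: (@sinf_inj w); rewrite wx.
have A' : ((w * simple j)%g^-1 i < (w * simple j)%g^-1 i.+1)%N
          = (simple j p < simple j q)%N by rewrite invgM simpleV !sinfM.
have B' : ((simple i * w)%g j < (simple i * w)%g j.+1)%N
          = (simple i (w j) < simple i (w j.+1))%N by rewrite !sinfM.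
have [/andP[/eqP pj /eqP qj]|n1] := boolP ((p == j) && (q == j.+1)).
  rewrite pj in wp; rewrite qj in wq.
  have -> : step w j = w * simple j by rewrite /step wp wq ltnSn.
  have -> : lstep i w = simple i * w by rewrite lstepE -/p -/q pj qj ltnSn.
  rewrite lstepE A' pj qj /step B' wp wq !simpleE // !eqxx.
  have -> : (j.+1 == j) = false by lia.
  have -> : (i.+1 == i) = false by lia.
  rewrite ltnNge leqnSn /= ltnNge leqnSn /=.
  apply: sinfP => x; rewrite !sinfM !simpleE //.
  case: (x =P j) => [->|xj]; first by rewrite wp wq eqxx.
  case: (x =P j.+1) => [->|xj']; first by rewrite wp wq eqxx; case: eqP; lia.
  case: eqP => [/pE|_]; first lia.
  by case: eqP => [/qE|_]; first lia.
have [/andP[/eqP pj /eqP qj]|n2] := boolP ((p == j.+1) && (q == j)).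
  rewrite pj in wp; rewrite qj in wq.
  have -> : step w j = w by rewrite /step wp wq ltnNge leqnSn.
  have -> : lstep i w = w by rewrite lstepE -/p -/q pj qj ltnNge leqnSn.
  by rewrite /step wp wq ltnNge leqnSn.
have pq : p <> q by move=> e; move: wq; rewrite -e wp; lia.
have A : (simple j p < simple j q)%N = (p < q)%N by apply: simple_lt => //; lia.
have wjj : w j <> w j.+1 by move=> /(@sinf_inj w); lia.
have B : (simple i (w j) < simple i (w j.+1))%N = (w j < w j.+1)%N.
  apply: simple_lt => // -[h1 h2].
    by move: n1; rewrite -(pE _ h1) -(qE _ h2) !eqxx.
  by move: n2; rewrite -(pE _ h2) -(qE _ h1) !eqxx.
rewrite !lstepE -/p -/q /step.
by case wj: (w j < w j.+1)%N; case plq: (p < q)%N;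
  rewrite ?A' ?A ?plq ?B' ?B ?wj ?mulgA.
Qed.

Let sinf_bound w : exists N, forall x, (N <= x)%N -> w x = x.
Proof.
exists (\sum_(y <- finsupp w) y.+1)%N => x xN.
apply: fsfun_dflt; apply/negP => xw.
by move: xN; rewrite (big_rem x xw) /=; lia.
Qed.

Let sinf_no_descent w : (forall i, (0 < i)%N -> (w i <= w i.+1)%N) -> w = 1.
Proof.
move=> nd; have {}nd i : (w i < w i.+1)%N.
  have ne : w i <> w i.+1 by move=> /(@sinf_inj w); lia.
  case: (posnP i) => [i0|/nd]; last by lia.
  by move: ne; rewrite i0 sinf0; lia.
have [N wN] := sinf_bound w.
have ge x : (x <= w x)%N by elim: x => // x IHx; exact: leq_ltn_trans IHx (nd x).
have le x k : (w x + k <= w (x + k))%N.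
  by elim: k => [|k IHk]; rewrite ?addn0 // !addnS; apply: leq_ltn_trans IHk (nd _).
apply: sinfP => x; rewrite sinf1; have := ge x; have := le x N.
by rewrite (wN (x + N)%N) ?leq_addl // leq_add2r => h1 h2; apply/eqP; rewrite eqn_leq h1.
Qed.

Let sinf_word w : exists s, foldl step 1 s == w.
Proof.
have [N wN] := sinf_bound w.
pose M v := (\sum_(x < N) x * v x)%N.
have bnd v x : (forall x, (N <= x)%N -> v x = x) -> (x < N)%N -> (v x < N)%N.
  move=> vN xN; rewrite ltnNge; apply/negP => Nv; have := @sinf_inj v _ _ (vN _ Nv); lia.
have Mle v : (forall x, (N <= x)%N -> v x = x) -> (M v <= N * (N * N))%N.
  move=> vN; rewrite -[X in (X * _)%N]card_ord -sum_nat_const.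
  by apply: leq_sum => x _; apply: leq_mul; apply: ltnW; rewrite ?bnd ?ltn_ord.
have [k] := ubnP (N * (N * N) - M w)%N.
elim: k w wN => // k IH w wN lek.
have [[i [i0 wi]]|nd] := pselect (exists i, (0 < i)%N /\ (w i.+1 < w i)%N); last first.
  exists [::]; rewrite (@sinf_no_descent w) // => i i0.
  by rewrite leqNgt; apply/negP => wi; apply: nd; exists i.
have iN : (i.+1 < N)%N.
  rewrite ltnNge; apply/negP => Ni; have wi1 := wN _ Ni.
  case: (ltnP i N) => [/(bnd _ _ wN)|/wN]; lia.
pose v := w * simple i.
have vE x : v x = w (simple i x) by rewrite sinfM.
have vN x : (N <= x)%N -> v x = x.
  move=> Nx; rewrite vE simpleE //.
  by do ![case: eqP => //]; try lia; rewrite wN.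
have wE : w = step v i.
  have si : simple i i = i.+1 by rewrite simpleE // eqxx.
  have si1 : simple i i.+1 = i by rewrite simpleE // eqxx; case: eqP => //; lia.
  by rewrite /step !vE si si1 wi /v -mulgA simpleK mulg1.
have lt_M : (M w < M v)%N.
  pose a := Ordinal (ltnW iN); pose b := Ordinal iN.
  have ba : b != a by rewrite -val_eqE /=; lia.
  rewrite /M (bigD1 a) // [X in (_ < X)%N](bigD1 a) //=.
  rewrite (bigD1 b) //= [X in (_ < _ + X)%N](bigD1 b) //=.
  have -> : (\sum_(x < N | (x != a) && (x != b)) x * v x =
             \sum_(x < N | (x != a) && (x != b)) x * w x)%N.
    apply: eq_bigr => x /andP[]; rewrite -!val_eqE /= => xa xb.
    by rewrite vE simpleE // (negbTE xa) (negbTE xb).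
  rewrite !vE !simpleE // !eqxx.
  have -> : (i.+1 == i) = false by lia.
  move: (\sum_(x < N | _) _)%N => T.
  by move: (w i) (w i.+1) wi => c d; rewrite !mulSn; nia.
have [s /eqP sv] : exists s, foldl step 1 s == v.
  by apply: IH => //; have := Mle v vN; lia.
by exists (rcons s i); rewrite -cats1 foldl_cat /= sv -wE.
Qed.

Let word w := xchoose (sinf_word w).
Let wordK w : foldl step 1 (word w) = w.
Proof. exact/eqP/(xchooseP (sinf_word w)). Qed.

Let foldl_step u a b :
  foldl step 1 a = foldl step 1 b -> foldl step u a = foldl step u b.
Proof.
have foldl_lstep i w c : foldl step (lstep i w) c = lstep i (foldl step w c).
  by elim: c w => //= x c IH w; rewrite -step_lstep IH.
have [c ->] : exists c, u = foldr lstep 1 c.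
  exists (rev (word u^-1)); rewrite -[LHS]invgK -[in LHS](wordK u^-1).
  elim/last_ind: (word u^-1) => [|c i IH] /=; first by rewrite invg1.
  by rewrite rev_rcons /= -IH -cats1 foldl_cat /= /lstep invgK.
move=> ab; elim: c => //= i c IH.
by rewrite !foldl_lstep IH.
Qed.

Lemma demazure_exists_unique : exists! op, is_demazure op.
Proof.
pose op u v := foldl step u (word v).
have op_simple u i : (0 < i)%N -> op u (simple i) = step u i.
  move=> i0; rewrite /op (@foldl_step u _ [:: i]) //= wordK /step !sinf1 ltnSn.
  by rewrite mul1g.
exists op; split; first split.
- move=> u v w; rewrite /op -foldl_cat; apply: foldl_step.
  by rewrite foldl_cat !wordK.
- move=> i i0; rewrite op_simple // /step !simpleE // !eqxx.
  by case: ifP => //; case: eqP; lia.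
- by move=> w i i0 wi; rewrite op_simple // /step wi.
move=> op' [op'A op'ss op's].
have op'_simple u i : (0 < i)%N -> op' u (simple i) = step u i.
  move=> i0; rewrite /step; case: ifP => [|nu]; first exact: op's.
  have ne : u i <> u i.+1 by move=> /(@sinf_inj u); lia.
  pose v := u * simple i.
  have uE : u = op' v (simple i).
    rewrite op's // ?mulgA -?[RHS]mulgA ?simpleK ?mulg1 //.
    rewrite !sinfM !simpleE // !eqxx.
    by case: eqP; lia.
  by rewrite [in LHS]uE -op'A op'ss // -uE.
have op'1 u : op' u 1 = u.
  set x := op' u 1.
  have [N1 xN] := sinf_bound x; have [N2 uN] := sinf_bound u.
  pose j := (maxn N1 N2).+1.
  have xj : op' x (simple j) = op' u (simple j).
    by rewrite -op'A op'_simple // /step !sinf1 ltnSn mul1g.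
  move: xj; rewrite !op's ?xN ?uN //; try by rewrite /j; lia.
  exact: mulIg.
apply/funext => u; apply/funext => v; rewrite -[in RHS](wordK v) /op.
elim/last_ind: (word v) => [|s i IH] /=; first by rewrite op'1.
rewrite -cats1 !foldl_cat /= IH.
case: (posnP i) => [->|i0]; first by rewrite !step0.
by rewrite -!op'_simple // op'A.
Qed.

Definition demazure : Sinf -> Sinf -> Sinf :=
  sval (cid demazure_exists_unique).

Lemma demazureP : is_demazure demazure.
Proof. by rewrite /demazure; case: cid => op []. Qed.

End Demazure.

Definition hecke_word (w : Sinf) (s : seq nat) : bool :=
  all (fun i => 0 < i)%N s && (\big[demazure/1%g]_(i <- s) simple i == w).

Definition decr_factorization (n : nat) (w : Sinf) (a : n.-tuple (seq nat)) :=
  all (sorted gtn) a && hecke_word w (flatten a).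

Definition Decr (n : nat) (w : Sinf) : Type :=
  {a : n.-tuple (seq nat) | decr_factorization w a}.

(* A tableau is the list of its rows; empty rows at the bottom correspond to
   zero parts of the shape. *)
Definition tab (n : nat) (w : Sinf) (a : Decr n w) : seq (seq nat) :=
  [seq rev r | r <- val a].

Definition increasing_tableau (t : seq (seq nat)) : Prop :=
  [/\ sorted geq (shape t),
      all (all (fun x => 0 < x)%N) t,
      all (sorted ltn) t &
      forall i1 i2 j, (i1 < i2)%N -> (j < size (nth [::] t i2))%N ->
        (nth 0 (nth [::] t i1) j < nth 0 (nth [::] t i2) j)%N].

Local Open Scope ring_scope.

(* Indices are shifted down by one: 'I_n encodes [n], 'I_n.-1 encodes [n-1],
   and ilo i, ihi i are the elements i and i+1 of [n]. *)
Lemma ihi_subproof n (i : 'I_n.-1) : (i.+1 < n)%N.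
Proof. by rewrite -ltn_predRL. Qed.
Definition ilo n (i : 'I_n.-1) : 'I_n := widen_ord (leq_pred n) i.
Definition ihi n (i : 'I_n.-1) : 'I_n := Ordinal (ihi_subproof i).

(* The value None plays the role of 0. *)
Record crystal_data (n : nat) := CrystalData {
  elt :> Type;
  wt : elt -> 'rV[int]_n;
  cre : 'I_n.-1 -> elt -> option elt;
  crf : 'I_n.-1 -> elt -> option elt }.

Definition steps (T : Type) (g : T -> option T) (b : T) : set nat :=
  [set k | iter k (obind g) (Some b) <> None]%classic.

(* supremum returns 0 on an unbounded set; is_crystal requires boundedness. *)
Definition eps n (B : crystal_data n) (i : 'I_n.-1) (b : B) : nat :=
  supremum 0%N (steps (cre i) b).

Definition phi n (B : crystal_data n) (i : 'I_n.-1) (b : B) : nat :=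
  supremum 0%N (steps (crf i) b).

Definition is_crystal n (B : crystal_data n) : Prop :=
  [/\ forall i (b : B),
        has_ubound (steps (cre i) b) /\ has_ubound (steps (crf i) b),
      forall i (b : B), ((phi i b)%:Q - (eps i b)%:Q) / 2%:Q =
        (wt b 0 (ilo i) - wt b 0 (ihi i))%:Q,
      forall i (b c : B), cre i b = Some c <-> crf i c = Some b &
      forall i (b c : B), cre i b = Some c ->
        wt c - wt b = if odd (eps i b) then - delta_mx 0 (ihi i)
                      else delta_mx 0 (ilo i)].

Definition highest_weight n (B : crystal_data n) (b : B) : Prop :=
  forall i, cre i b = None.

Definition full_subcrystal n (B : crystal_data n) (X : set B) : Prop :=
  exists b : B, X = [set c | clos_refl_sym_trans B
    (fun x y => exists i, crf i x = Some y) b c]%classic.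

(* The sets X and Y are meant to be full subcrystals, which are stable under
   the operators. *)
Definition subcrystal_iso n (B C : crystal_data n) (X : set B) (Y : set C) :=
  exists2 h : B -> C, set_bij X Y h &
    forall b, X b -> wt (h b) = wt b /\
      forall i, cre i (h b) = omap h (cre i b) /\
                crf i (h b) = omap h (crf i b).

Definition tensor n (B C : crystal_data n) : crystal_data n :=
  @CrystalData n (B * C)%type
    (fun x => wt x.1 + wt x.2)
    (fun i x => if (eps i x.1 <= phi i x.2)%N
                then omap (pair x.1) (cre i x.2)
                else omap (pair^~ x.2) (cre i x.1))
    (fun i x => if (eps i x.1 < phi i x.2)%N
                then omap (pair x.1) (crf i x.2)
                else omap (pair^~ x.2) (crf i x.1)).

Definition crystal_one n : crystal_data n :=
  @CrystalData n unit (fun _ => 0) (fun _ _ => None) (fun _ _ => None).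

Definition SS_elt n : Type := {S : {set 'I_n} | S != finset.set0}.

(* The sets produced below are nonempty, so insub never fails. *)
Definition SS_e n (i : 'I_n.-1) (S : SS_elt n) : option (SS_elt n) :=
  let J := val S :&: [set ilo i; ihi i] in
  if J == [set ihi i] then (insub (ilo i |: val S) : option {S | S != _})
  else if J == [set ilo i; ihi i]
  then (insub (val S :\ ihi i) : option {S | S != _})
  else None.

Definition SS_f n (i : 'I_n.-1) (S : SS_elt n) : option (SS_elt n) :=
  let J := val S :&: [set ilo i; ihi i] in
  if J == [set ilo i] then (insub (ihi i |: val S) : option {S | S != _})
  else if J == [set ilo i; ihi i]
  then (insub (val S :\ ilo i) : option {S | S != _})
  else None.

Definition SS n : crystal_data n :=
  @CrystalData n (SS_elt n) (fun S => \sum_(j in val S) delta_mx 0 j)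
    (@SS_e n) (@SS_f n).

Fixpoint SS_pow n (m : nat) : crystal_data n :=
  if m is m'.+1 then tensor (SS_pow n m') (SS n) else crystal_one n.

Definition is_normal n (B : crystal_data n) : Prop :=
  forall X : set B, full_subcrystal X ->
    exists m (Y : set (SS_pow n m)),
      full_subcrystal Y /\ subcrystal_iso X Y.

Definition decr_wt n w (a : Decr n w) : 'rV[int]_n :=
  \row_i (size (tnth (val a) i))%:Z.

(* Main.v *)
Require Import Defs.
From HB Require Import structures.
From Stdlib Require Import Relation_Operators.
From mathcomp Require Import all_boot all_order all_algebra finmap zify ring lra.
From mathcomp Require Import fingroup perm mpoly.
From mathcomp Require monalg boolp classical_sets functions.

(* The operators can be transported from any normal crystal that has as many
   elements of each weight, highest weight or not, as [Decr n w].  Such a crystal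
   is the disjoint union, over the factorizations [a] for which [tab a] is
   increasing, of the set-valued tableaux of shape [tab a]: their column reading
   words span a subcrystal of a tensor power of [SS n], with a single highest
   weight element, whose weight is the shape.

   To compare the two generating functions [F], let
     [J g = \sum_s sgn(s) s(g \prod_r x_r^(n-1-r) (1+x_r)^r)]
   be the numerator of the bialternant formula for Grothendieck polynomials.  On
   either side [F] is symmetric, whence [F * J 1 = J F], and the elements that
   are not of highest weight (respectively, whose tableau is not increasing)
   split into classes whose generating functions become symmetric in [x_i] and
   [x_(i+1)] once multiplied by [x_i (1+x_(i+1))], so that [J] kills them.  For
   words these classes are the string interiors below a defect.  For
   factorizations they are given by the first violation of the tableau
   condition, and the symmetry follows from the commutation of the products
   [A(x) = (1 + x s_N) ... (1 + x s_1)] in the 0-Hecke algebra, a consequence of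
   the Yang-Baxter equation.  Hence both sides satisfy
   [F * J 1 = \sum_a J(x^(wt a))] over the [a] with [tab a] increasing, and
   [J 1] is nonzero. *)

Set Implicit Arguments.
Unset Strict Implicit.
Unset Printing Implicit Defensive.

Import Order.TTheory GRing.Theory Num.Theory.

(** * Commuting products in the 0-Hecke algebra *)

(** Only the existence of operators is claimed, so none has to be written down on factorizations: a
    bijection that keeps weights and highest weight status suffices, and it exists as soon as both
    kinds of elements are equinumerous in each weight. The product inside [J] is dictated by the
    shape of the strings. Going down an [i]-string alternately adds [i+1] and removes [i], so the
    elements below the top pair off, and their sum is [1 + x_i] times the sum over even [eps], which
    in turn is [x_(i+1)] times a symmetric function. Multiplication by [x_i (1 + x_(i+1))] repairs
    exactly this asymmetry, and the exponents [n-1-r] and [r] make that factor the only part of the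
    product not symmetric in [x_i] and [x_(i+1)]. Yang-Baxter naturally involves division by
    [1 + y]; denominators are cleared, and [1 + y] is only assumed to act injectively. Finiteness
    comes from a bound [N] on the letters of the Hecke words of [w]. *)

Section YangBaxter.

Local Open Scope ring_scope.

Variables (K : comNzRingType) (H : algType K) (t u : H).
Hypotheses (tt : t * t = t) (uu : u * u = u) (utu : u * t * u = t * u * t).

(** Coordinates on the span of the six words of the 0-Hecke algebra of type A2. Right multiplication
    by [t] and [u] acts on them, so identities in [H] reduce to polynomial identities between
    coefficients. *)
Definition braid_comb (c0 c1 c2 c3 c4 c5 : K) : H :=
  c0 *: 1 + c1 *: t + c2 *: u + c3 *: (t * u) + c4 *: (u * t)
    + c5 *: (t * u * t).

Lemma braid_combD c0 c1 c2 c3 c4 c5 d0 d1 d2 d3 d4 d5 :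
  braid_comb c0 c1 c2 c3 c4 c5 + braid_comb d0 d1 d2 d3 d4 d5 =
  braid_comb (c0 + d0) (c1 + d1) (c2 + d2) (c3 + d3) (c4 + d4) (c5 + d5).
Proof.
rewrite /braid_comb; do 5![rewrite addrACA; congr (_ + _); last by rewrite scalerDl].
by rewrite scalerDl.
Qed.

Lemma braid_combZ z c0 c1 c2 c3 c4 c5 :
  z *: braid_comb c0 c1 c2 c3 c4 c5 =
  braid_comb (z * c0) (z * c1) (z * c2) (z * c3) (z * c4) (z * c5).
Proof. by rewrite /braid_comb !scalerDr !scalerA. Qed.

Lemma braid_comb_u c0 c1 c2 c3 c4 c5 :
  braid_comb c0 c1 c2 c3 c4 c5 * u = braid_comb 0 0 (c0 + c2) (c1 + c3) 0 (c4 + c5).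
Proof.
have tutu : t * u * t * u = t * u * t by rewrite -!mulrA (mulrA u) utu !mulrA tt.
rewrite /braid_comb !mulrDl -!scalerAl mul1r uu utu tutu -(mulrA t u u) uu.
rewrite !scale0r !add0r addr0 !scalerDl !addrA.
by congr (_ + _ + _); rewrite -!addrA; congr (_ + _); rewrite addrCA addrA addrC.
Qed.

Lemma braid_comb_t c0 c1 c2 c3 c4 c5 :
  braid_comb c0 c1 c2 c3 c4 c5 * t = braid_comb 0 (c0 + c1) 0 0 (c2 + c4) (c3 + c5).
Proof.
rewrite /braid_comb !mulrDl -!scalerAl mul1r tt -!(mulrA _ t t) tt.
rewrite !scale0r !add0r !addr0 !scalerDl !addrA.
congr (_ + _); rewrite -!addrA; congr (_ + (_ + (_ + _))); exact: addrC.
Qed.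

(** As [(1 + x t)(1 + y t) = 1 + (x + y + xy) t], the difference of [x] and [y] for this group law
    is [(x - y)/(1 + y)], the spectral parameter of the first factor once [1 + y] is cleared. The
    usual equation has been multiplied on the right by [1 + y *: u], which merges its last factor
    into [1 + x *: u]. *)
Lemma yang_baxter x y :
  ((1 + y) *: 1 + (x - y) *: t) * (1 + x *: u) * (1 + y *: t) * (1 + y *: u) =
  (1 + y) *: ((1 + y *: u) * (1 + x *: t) * (1 + x *: u)).
Proof.
have -> : (1 + y) *: 1 + (x - y) *: t = braid_comb (1 + y) (x - y) 0 0 0 0.
  by rewrite /braid_comb !scale0r !addr0.
have -> : 1 + y *: u = braid_comb 1 0 y 0 0 0.
  by rewrite /braid_comb !scale0r !addr0 scale1r.
have mulu z c0 c1 c2 c3 c4 c5 :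
    braid_comb c0 c1 c2 c3 c4 c5 * (1 + z *: u) =
    braid_comb c0 c1 c2 c3 c4 c5 + z *: (braid_comb c0 c1 c2 c3 c4 c5 * u).
  by rewrite mulrDr mulr1 scalerAr.
have mult z c0 c1 c2 c3 c4 c5 :
    braid_comb c0 c1 c2 c3 c4 c5 * (1 + z *: t) =
    braid_comb c0 c1 c2 c3 c4 c5 + z *: (braid_comb c0 c1 c2 c3 c4 c5 * t).
  by rewrite mulrDr mulr1 scalerAr.
have -> : braid_comb 1 0 y 0 0 0 = 1 + y *: u.
  by rewrite /braid_comb !scale0r !addr0 scale1r.
have one : 1 + y *: u = braid_comb 1 0 y 0 0 0.
  by rewrite /braid_comb !scale0r !addr0 scale1r.
(* The second occurrence heads the right-hand side. Only the head of each product is put in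
   coordinates; the remaining factors act on it from the right. *)
rewrite {2}one !(mulu, mult, braid_comb_u, braid_comb_t, braid_combZ, braid_combD).
congr braid_comb; ring.
Qed.

(* If [a] and [b] commute, then [(1 + y)^-1 * (1 + y - y t)] inverts [1 + y t],
   so that [(1 + y) a d] is a right multiple of [b c]. *)
Lemma commute_factor_step x y (c d : H) :
  (forall h : H, (1 + y) *: h = 0 -> h = 0) -> c * u = u * c -> d * u = u * d ->
  let a := c * (1 + x *: t) in let b := d * (1 + y *: t) in
  a * b = b * a ->
  a * (1 + x *: u) * (b * (1 + y *: u)) = b * (1 + y *: u) * (a * (1 + x *: u)).
Proof.
move=> reg cu du a b.
have aE : a = c * (1 + x *: t) by []. have bE : b = d * (1 + y *: t) by [].
clearbody a b; move=> ab.
have comm1 z e : e * u = u * e -> (1 + z *: u) * e = e * (1 + z *: u).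
  by move=> eu; rewrite mulrDl mulrDr mul1r mulr1 -scalerAl -scalerAr eu.
have oneE z : 1 + z *: t = 1 *: 1 + z *: t by rewrite scale1r.
have mulM z e0 e1 : (e0 *: 1 + e1 *: t) * ((1 + y) *: 1 - z *: t) =
    ((1 + y) * e0) *: 1 + ((1 + y) * e1 - z * (e0 + e1)) *: t.
  have -> : e0 *: 1 + e1 *: t = braid_comb e0 e1 0 0 0 0.
    by rewrite /braid_comb !scale0r !addr0.
  rewrite -scaleNr mulrDr -!scalerAr mulr1 braid_comb_t !braid_combZ braid_combD.
  rewrite /braid_comb !(addr0, mulr0, scale0r); congr (_ *: _ + _ *: _); ring.
pose M : H := (1 + y) *: 1 - y *: t.
have bM : b * M = (1 + y) *: d.
  rewrite bE -mulrA oneE mulM.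
  transitivity (d * ((1 + y) *: 1)); last by rewrite -scalerAr mulr1.
  congr (_ * _); rewrite mulr1 [X in X *: t](_ : _ = 0) ?scale0r ?addr0 //; ring.
have ad : (1 + y) *: (a * d) = b * c * ((1 + y) *: 1 + (x - y) *: t).
  rewrite scalerAr -bM mulrA ab [in X in b * X * M]aE -!mulrA oneE mulM.
  by congr (_ * (_ * (_ *: _ + _ *: _))); ring.
apply/subr0_eq/reg; rewrite scalerBr; apply/eqP; rewrite subr_eq0; apply/eqP.
transitivity (b * c * (((1 + y) *: 1 + (x - y) *: t) * (1 + x *: u) * (1 + y *: t) * (1 + y *: u))).
  rewrite !mulrA -ad -!scalerAl; congr (_ *: _).
  by rewrite bE !mulrA -(mulrA a _ d) comm1 // mulrA.
rewrite yang_baxter -scalerAr; congr (_ *: _).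
by rewrite aE -!mulrA (mulrA (1 + _) c) (comm1 y c) // !mulrA.
Qed.

End YangBaxter.

Section CommutingProducts.

Local Open Scope ring_scope.

Variables (K : comNzRingType) (H : algType K) (U : nat -> H).
Hypotheses (UU : forall i, U i * U i = U i)
  (braid : forall i, U i.+1 * U i * U i.+1 = U i * U i.+1 * U i)
  (far : forall i j, (i.+1 < j)%N -> U i * U j = U j * U i).

Definition cauchy_prod k (x : K) : H := \prod_(i < k) (1 + x *: U i).

Lemma cauchy_prodS k x : cauchy_prod k.+1 x = cauchy_prod k x * (1 + x *: U k).
Proof. by rewrite /cauchy_prod big_ord_recr. Qed.

Lemma cauchy_prod_far k j x : (k < j)%N -> cauchy_prod k x * U j = U j * cauchy_prod k x.
Proof.
elim: k => [|k IH] kj; first by rewrite /cauchy_prod big_ord0 mulr1 mul1r.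
rewrite cauchy_prodS -mulrA mulrDl mul1r -scalerAl far // scalerAr.
by rewrite -[X in X + _]mulr1 -mulrDr !mulrA IH // ltnW.
Qed.

(** Induction on [k]: [commute_factor_step] adds the factor in [U k.+1] to products ending with a
    factor in [U k], whose earlier factors commute with [U k.+1] by [far]. *)
Lemma cauchy_prod_comm k x y : (forall h : H, (1 + y) *: h = 0 -> h = 0) ->
  cauchy_prod k x * cauchy_prod k y = cauchy_prod k y * cauchy_prod k x.
Proof.
move=> reg; elim: k => [|[|k] IH].
- by rewrite /cauchy_prod !big_ord0.
- rewrite /cauchy_prod !big_ord1; suff c : GRing.comm (x *: U 0) (y *: U 0).
    by apply: commrD; [exact: commr1|apply/commr_sym/commrD; [exact: commr1|]].
  by rewrite /GRing.comm -!scalerAl -!scalerAr !scalerA mulrC.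
rewrite !(cauchy_prodS k.+1); rewrite !(cauchy_prodS k) in IH *.
by apply: (commute_factor_step (UU k) (UU k.+1)) => //; apply: cauchy_prod_far.
Qed.

(** By [(1 + z U_k) U_k = (1 + z) U_k], the scalar outside pays for the factor missing from the
    shorter product; the two products of [k.+1] factors then commute. *)
Lemma cauchy_prod_swap k x y :
  (forall h : H, (1 + y) *: h = 0 -> h = 0) ->
  (1 + y) *: (cauchy_prod k.+1 x * cauchy_prod k y * U k) =
  (1 + x) *: (cauchy_prod k.+1 y * cauchy_prod k x * U k).
Proof.
move=> reg; have abs z : (1 + z *: U k) * U k = (1 + z) *: U k.
  by rewrite mulrDl mul1r -scalerAl UU scalerDl scale1r.
rewrite !scalerAr -!abs -!mulrA !(mulrA (cauchy_prod k _) _ (U k)) -!cauchy_prodS.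
by rewrite !mulrA cauchy_prod_comm.
Qed.

End CommutingProducts.

(** * Words read off sets of indices, and their generating functions *)

Section SetWords.

Local Open Scope ring_scope.

Variables (K : comNzRingType) (H : algType K) (U : nat -> H) (N : nat).
Implicit Types (X Y : {set 'I_N}).

Definition set_word X : H := \prod_(j | j \in X) U j.

Lemma sum_set_word k x : (k <= N)%N ->
  \sum_(X : {set 'I_N} | X \subset [set j : 'I_N | (j < k)%N]) x ^+ #|X| *: set_word X
  = cauchy_prod U k x.
Proof.
move=> kN; rewrite /cauchy_prod (big_ord_widen N (fun i => 1 + x *: U i) kN).
(* Each factor is written as a sum with summand [1], the other summand being [0] from index [k] on:
   in the expansion over all subsets of ['I_N], those not below [k] vanish. *)
transitivity (\prod_(i < N) ((if (i < k)%N then x *: U i else 0) + 1)); last first.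
  rewrite [RHS]big_mkcond; apply: eq_bigr => i _.
  by case: ifP => _; rewrite ?add0r // addrC.
rewrite bigA_distr [RHS](bigID (fun X : {set 'I_N} => X \subset [set j : 'I_N | (j < k)%N])) /=.
rewrite [X in _ + X]big1 ?addr0; last first.
  move=> X /subsetPn[j jX]; rewrite inE => jk.
  (* The product is not commutative, so the zero factor at [j] is isolated by cutting the
     enumeration there. *)
  suff -> : index_enum 'I_N = take j (index_enum 'I_N) ++ j :: drop j.+1 (index_enum 'I_N).
    by rewrite big_cat big_cons /= jX (negbTE jk) mul0r mulr0.
  have -> : index_enum 'I_N = enum 'I_N by rewrite -deprecated_filter_index_enum filter_predT.
  rewrite -{1}(cat_take_drop j (enum 'I_N)) (drop_nth j (n := j)) ?size_enum_ord //.
  by rewrite nth_ord_enum.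
apply: eq_bigr => X /subsetP XK.
rewrite /set_word -prodr_const -scaler_prod big_mkcond; apply: eq_bigr => j _.
by case: ifP => // /XK; rewrite inE => ->.
Qed.

Lemma set_word_nat X : set_word X = \prod_(0 <= j < N | j \in [seq val i | i in X]) U j.
Proof.
rewrite big_mkord /set_word; apply: eq_bigl => j.
by rewrite (mem_image val_inj).
Qed.

Lemma set_word_split k X : (k <= N)%N ->
  set_word X = set_word (X :&: [set j : 'I_N | (j < k)%N])
             * set_word (X :&: [set j : 'I_N | (k <= j)%N]).
Proof.
move=> kN; rewrite !set_word_nat (big_cat_nat (leq0n k) kN) /=.
have E (Y Z : {set 'I_N}) a b : (b <= N)%N ->
    (forall j : 'I_N, (a <= j < b)%N -> (j \in Y) = (j \in Z)) ->
    \prod_(a <= j < b | j \in [seq val i | i in Y]) U j =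
    \prod_(a <= j < b | j \in [seq val i | i in Z]) U j.
  move=> bN YZ; rewrite big_nat_cond [RHS]big_nat_cond; apply: eq_bigl => j.
  case jab: (a <= j < b)%N => //=; have jN : (j < N)%N by move: jab bN; lia.
  by rewrite -[j]/(val (Ordinal jN)) !(mem_image val_inj) YZ.
have V (Y : {set 'I_N}) a b : (b <= N)%N ->
    (forall j : 'I_N, (a <= j < b)%N -> (j \in Y) = false) ->
    \prod_(a <= j < b | j \in [seq val i | i in Y]) U j = 1.
  move=> bN Y0; rewrite (@E Y set0 _ _ bN); last by move=> j /Y0->; rewrite in_set0.
  by apply: big_pred0 => j; apply/negbTE/imageP => -[i]; rewrite in_set0.
set Xl := X :&: _; set Xr := X :&: _.
have l1 : \prod_(k <= j < N | j \in [seq val i | i in Xl]) U j = 1.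
  by apply: V => // j; rewrite !inE; lia.
have r1 : \prod_(0 <= j < k | j \in [seq val i | i in Xr]) U j = 1.
  by apply: V => // j; rewrite !inE; lia.
rewrite [X in _ = X * _](big_cat_nat (leq0n k) kN) [X in _ = _ * X](big_cat_nat (leq0n k) kN) /=.
rewrite l1 r1 mulr1 mul1r.
by congr (_ * _); apply: E => // j; rewrite !inE; lia.
Qed.

Lemma set_wordU1 k X : (forall j, j \in X -> (j < k)%N) -> forall kN : (k < N)%N,
  set_word (Ordinal kN |: X) = set_word X * U k.
Proof.
move=> Xk kN; rewrite (@set_word_split k) 1?ltnW //; congr (_ * _).
  congr set_word; apply/setP => j; rewrite !inE -val_eqE /=.
  by case: (boolP (j \in X)) => [/Xk|]; lia.
rewrite /set_word (big_pred1 (Ordinal kN)) // => j; rewrite !inE -val_eqE /=.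
by case: (boolP (j \in X)) => [/Xk|]; lia.
Qed.

Lemma set_word_comm k X Y : (forall i j, (i.+1 < j)%N -> U i * U j = U j * U i) ->
  (forall j, j \in X -> (k.+1 < j)%N) -> (forall j, j \in Y -> (j <= k)%N) ->
  set_word X * set_word Y = set_word Y * set_word X.
Proof.
move=> far Xk Yk; apply/commr_prod => j jY; apply/commr_sym/commr_prod => i iX.
by apply: far; have := Xk _ iX; have := Yk _ jY; lia.
Qed.

End SetWords.

Lemma ilo_neq_ihi n (i : 'I_n.-1) : ilo i != ihi i.
Proof. by rewrite -val_eqE /=; lia. Qed.

(** Products over rows do not commute; two adjacent rows can only be treated together as consecutive
    entries of the enumeration. *)
Lemma index_enum_adjacent n (i : 'I_n.-1) : exists l1 l2,
  index_enum 'I_n = l1 ++ ilo i :: ihi i :: l2 /\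
  forall r, r \in l1 ++ l2 -> r != ilo i /\ r != ihi i.
Proof.
have e : index_enum 'I_n = enum 'I_n.
  by rewrite -deprecated_filter_index_enum filter_predT.
have un : uniq (enum 'I_n) := enum_uniq _.
exists (take i (enum 'I_n)), (drop i.+2 (enum 'I_n)).
have s : enum 'I_n = take i (enum 'I_n) ++ ilo i :: ihi i :: drop i.+2 (enum 'I_n).
  rewrite -{1}(cat_take_drop i (enum 'I_n)) (drop_nth (ilo i) (n := i)).
    rewrite (drop_nth (ihi i) (n := i.+1)); last by rewrite size_enum_ord (ltn_ord (ihi i)).
    by rewrite (nth_ord_enum _ (ilo i)) (nth_ord_enum _ (ihi i)).
  by rewrite size_enum_ord (ltn_ord (ilo i)).
split; first by rewrite e.
move=> r rl.
have {}un : uniq (ilo i :: ihi i :: (take i (enum 'I_n) ++ drop i.+2 (enum 'I_n))).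
  by move: un; rewrite {1}s -[_ :: _ :: drop _ _]/([:: ilo i; ihi i] ++ drop _ _) uniq_catCA.
move: un; rewrite /= inE negb_or -andbA => /and4P[_ a b _].
by split; apply: contraTneq rl => ->.
Qed.

(** * Violations of the tableau condition *)

Section Violations.

Local Open Scope ring_scope.

Variables (n N : nat).
Implicit Types (R : {ffun 'I_n -> {set 'I_N}}) (i : 'I_n.-1) (k : 'I_N) (X Y : {set 'I_N}).

Definition count_above X k := #|X :&: [set j : 'I_N | (k < j)%N]|.

(* An index [k] in a row stands for the letter [N - k], so [count_above] counts
   smaller letters: [k] violates when the entry above it is missing or too large. *)
Definition violation R i k :=
  (k \in R (ihi i)) && (count_above (R (ilo i)) k <= count_above (R (ihi i)) k)%N.

Definition tableau_rows R := [forall i, [forall k, ~~ violation R i k]].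

(* The violation with the smallest letter and, for that letter, the lowest row. *)
Definition first_violation i k R :=
  [&& violation R i k, [forall k' : 'I_N, (k < k')%N ==> [forall i', ~~ violation R i' k']]
    & [forall i' : 'I_n.-1, (i < i')%N ==> ~~ violation R i' k]].

Lemma count_above_mono X k k' : (k <= k')%N -> (count_above X k' <= count_above X k)%N.
Proof. by move=> kk; apply/subset_leq_card/subsetP => j; rewrite !inE; lia. Qed.

Lemma count_above_gap X k k' : (k < k')%N -> k' \in X ->
  (forall j, j \in X -> (k < j)%N -> (k' <= j)%N) ->
  count_above X k = (count_above X k').+1.
Proof.
move=> kk' k'X gap; rewrite /count_above (cardsD1 k') !inE k'X kk' add1n; congr _.+1.
apply: eq_card => j; rewrite !inE -val_eqE /=.
by case: (boolP (j \in X)) => [/gap|]; lia.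
Qed.

(** The least element of [Y] above [k] works: passing to it lowers the count of [Y] by exactly one
    and cannot raise that of [X]. *)
Lemma count_above_lt X Y k : (count_above X k < count_above Y k)%N ->
  exists2 k' : 'I_N, (k < k')%N & (k' \in Y) && (count_above X k' <= count_above Y k')%N.
Proof.
move=> lt; have /card_gt0P[j] : (0 < count_above Y k)%N by lia.
rewrite !inE => /andP[jY kj].
case: (@arg_minnP _ j (fun j => (j \in Y) && (k < j)%N) val).
  by rewrite jY.
move=> k' /andP[k'Y kk'] mink'; exists k' => //; rewrite k'Y /=.
have := count_above_mono X (ltnW kk').
rewrite (@count_above_gap Y k k') // in lt; first by move: lt; lia.
by move=> l lY kl; apply: mink'; rewrite lY.
Qed.

Lemma first_violation_count i k R : first_violation i k R ->
  count_above (R (ilo i)) k = count_above (R (ihi i)) k.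
Proof.
case/and3P => /andP[kR le] /forallP above _; apply/eqP; rewrite eqn_leq le /= leqNgt.
apply/negP => /count_above_lt[k' kk' v].
by have /implyP/(_ kk')/forallP/(_ i) := above k'; rewrite /violation v.
Qed.

(** If [k+1] were in the upper row, the equality of the counts at [k] would force a violation at
    [k+1] itself, when the lower row contains it too, or beyond it by [count_above_lt] otherwise. *)
Lemma first_violation_gap i k R j : first_violation i k R ->
  j \in R (ilo i) -> (k < j)%N -> (k.+1 < j)%N.
Proof.
move=> fv jR kj; rewrite ltn_neqAle kj andbT; apply/negP => /eqP jE.
have cE := first_violation_count fv.
case/and3P: fv => _ /forallP above _.
have noviol k' : (k < k')%N -> ~~ violation R i k'.
  by move=> kk'; have /implyP/(_ kk')/forallP/(_ i) := above k'.
have cj X : count_above X k = ((j \in X) + count_above X j)%N.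
  rewrite /count_above (cardsD1 j) !inE kj andbT; congr (_ + _)%N.
  by apply: eq_card => l; rewrite !inE -val_eqE /=; case: (l \in X); lia.
move: cE; rewrite !cj jR; case: (boolP (j \in R (ihi i))) => [jR'|_] cE.
  by have := noviol _ kj; rewrite /violation jR' /=; lia.
have [|k' jk' v] := @count_above_lt (R (ilo i)) (R (ihi i)) j; first by lia.
by have := noviol k' (ltn_trans kj jk'); rewrite /violation v.
Qed.

(** Counts are strict, so indices below [k] never matter; and a violation of [k] between rows [i']
    and [i'+1] with [i' >= i] looks for [k] only in row [i'+1], never in row [i]. This is the
    freedom that [glue] exploits. *)
Lemma first_violation_congr i k R R' :
  (forall r (j : 'I_N), (k < j)%N -> (j \in R r) = (j \in R' r)) ->
  (forall r, r != ilo i -> (k \in R r) = (k \in R' r)) ->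
  first_violation i k R = first_violation i k R'.
Proof.
move=> above at_k.
have cE r k' : (k <= k')%N -> count_above (R r) k' = count_above (R' r) k'.
  move=> kk'; apply: eq_card => j; rewrite !inE; case kj: (k' < j)%N; rewrite ?andbF //.
  by rewrite above //; lia.
have vE i' : (i <= i')%N -> violation R i' k = violation R' i' k.
  by move=> ii'; rewrite /violation !cE // at_k // -val_eqE /=; lia.
rewrite /first_violation vE //; congr [&& _, _ & _].
  apply: eq_forallb => k'; case kk': (k < k')%N => //=; apply: eq_forallb => i'.
  by rewrite /violation !cE ?above // ltnW.
by apply: eq_forallb => i'; case ii': (i < i')%N => //=; rewrite vE // ltnW.
Qed.

Lemma first_violation_exists R : ~~ tableau_rows R ->
  exists p, forall q, first_violation q.1 q.2 R = (q == p).
Proof.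
rewrite negb_forall => /existsP[i0]; rewrite negb_forall => /existsP[k0].
rewrite negbK => v0.
pose hasv k := [exists i, violation R i k].
have hasv0 : hasv k0 by apply/existsP; exists i0.
case: (@arg_maxnP _ k0 hasv val hasv0) => k /existsP[i1 v1] maxk.
case: (@arg_maxnP _ i1 (fun i => violation R i k) val v1) => i v maxi.
have fv : first_violation i k R.
  apply/and3P; split => //.
    apply/forallP => k'; apply/implyP => kk'; apply/forallP => i'; apply/negP => v'.
    have /maxk /= : hasv k' by apply/existsP; exists i'.
    by lia.
  by apply/forallP => i'; apply/implyP => ii'; apply/negP => /maxi /=; lia.
exists (i, k) => -[i' k'] /=; apply/idP/eqP => [fv'|[-> ->]//].
case/and3P: fv' => v' /forallP above' /forallP last'.
case/and3P: fv => _ /forallP above /forallP last.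
have kE : k' = k.
  case: (ltngtP k' k) => [lt|lt|/val_inj//].
    by have /implyP/(_ lt)/forallP/(_ i) := above' k; rewrite v.
  by have /implyP/(_ lt)/forallP/(_ i') := above k'; rewrite v'.
rewrite {}kE in v' last' *.
case: (ltngtP i' i) => [lt|lt|/val_inj->//].
  by have /implyP/(_ lt) := last' i; rewrite v.
by have /implyP/(_ lt) := last i'; rewrite v'.
Qed.

Lemma sum_first_violation (V : nmodType) (G : {ffun 'I_n -> {set 'I_N}} -> V) :
  \sum_R G R = \sum_(R | tableau_rows R) G R
    + \sum_(i < n.-1) \sum_(k < N) \sum_(R | first_violation i k R) G R.
Proof.
rewrite (bigID tableau_rows) /=; congr (_ + _).
rewrite pair_big /= (exchange_big_dep (fun R => ~~ tableau_rows R)) /=.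
  apply: eq_bigr => R /first_violation_exists[p pE].
  by rewrite (big_pred1 p).
move=> [i k] R _ /and3P[v _ _]; rewrite negb_forall; apply/existsP; exists i.
by rewrite negb_forall; apply/existsP; exists k; rewrite negbK.
Qed.

End Violations.

(** * Generating functions of the families with a given first violation *)

Section Classes.

Local Open Scope ring_scope.

Variables (n N : nat) (i : 'I_n.-1) (k : 'I_N).
Implicit Types (B C X Y : {set 'I_N}).

Local Notation rows := {ffun 'I_n -> {set 'I_N}}.
Local Notation data := (rows * ({set 'I_N} * {set 'I_N}))%type.
Local Notation below m := [set j : 'I_N | (j < m)%N].
Local Notation above := [set j : 'I_N | (k < j)%N].

(* The rows whose first violation is [(i, k)] are obtained from a core, made of
   the smaller letters, by adding arbitrary larger letters (and possibly [k]
   itself) to row [i], and [k] with arbitrary larger letters to row [i+1]. *)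
Definition glue (d : data) : rows :=
  [ffun r => if r == ilo i then d.2.1 :|: d.1 r
             else if r == ihi i then (k |: d.2.2) :|: d.1 r else d.1 r].

Definition cut (R : rows) : data :=
  ([ffun r => if (r == ilo i) || (r == ihi i) then R r :&: above else R r],
   (R (ilo i) :&: below k.+1, R (ihi i) :&: below k)).

Definition core (S : rows) :=
  [&& S (ilo i) \subset above, S (ihi i) \subset above
    & first_violation i k (glue (S, (set0, set0)))].

Lemma glueE d : (glue d (ilo i) = d.2.1 :|: d.1 (ilo i)) *
  (glue d (ihi i) = (k |: d.2.2) :|: d.1 (ihi i)).
Proof. by rewrite !ffunE eqxx eq_sym (negbTE (ilo_neq_ihi i)) eqxx. Qed.

Lemma glue_out d r : r != ilo i -> r != ihi i -> glue d r = d.1 r.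
Proof. by rewrite !ffunE => /negbTE-> /negbTE->. Qed.

Lemma cutK R : first_violation i k R -> glue (cut R) = R.
Proof.
case/and3P => /andP[kR _] _ _; apply/ffunP => r; have [->|rlo] := eqVneq r (ilo i).
  by rewrite glueE /= ffunE eqxx /=; apply/setP => j; rewrite !inE; case: (_ \in _); lia.
have [->|rhi] := eqVneq r (ihi i); last first.
  by rewrite glue_out //= ffunE (negbTE rlo) (negbTE rhi).
rewrite glueE /= ffunE eqxx orbT /=; apply/setP => j; rewrite !inE.
by have [->|] := eqVneq j k; rewrite ?kR // -val_eqE /=; case: (_ \in _); lia.
Qed.

(** The left side is the index set produced by reindexing along [glue] and [cut]. It turns out to be
    a product of three independent conditions, so the sum over a class factors. *)
Lemma glueK d : (first_violation i k (glue d) && (cut (glue d) == d)) =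
  core d.1 && ((d.2.1 \subset below k.+1) && (d.2.2 \subset below k)).
Proof.
case: d => S [B C] /=.
pose shape := [&& S (ilo i) \subset above, S (ihi i) \subset above,
  B \subset below k.+1 & C \subset below k].
have -> : (cut (glue (S, (B, C))) == (S, (B, C))) = shape.
  apply/eqP/and4P => [[/ffunP eS eB eC]|[sl sh sB sC]].
    have := eS (ilo i); have := eS (ihi i); rewrite !ffunE !eqxx orbT /= => <- <-.
    by rewrite -eB -eC !subsetIr.
  have hl j : j \in S (ilo i) -> (k < j)%N by move/(subsetP sl); rewrite inE.
  have hh j : j \in S (ihi i) -> (k < j)%N by move/(subsetP sh); rewrite inE.
  have hB j : j \in B -> (j <= k)%N by move/(subsetP sB); rewrite inE.
  have hC j : j \in C -> (j < k)%N by move/(subsetP sC); rewrite inE.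
  have lo_eq (b s : bool) j m : (b -> j <= m)%N -> (s -> m < j)%N ->
      ((b || s) && (m < j)%N = s) * ((b || s) && (j < m.+1)%N = b).
    by move: b s => [] [] /= h1 h2; try (have := h1 isT); try (have := h2 isT); split; lia.
  rewrite /cut !glueE /=; congr (_, (_, _)); last 2 first.
  - by apply/setP => j; rewrite !inE (lo_eq _ _ _ _ (hB j) (hl j)).
  - apply/setP => j; rewrite !inE -val_eqE /=; move: (hh j) (hC j).
    by move: (_ \in _) (_ \in _) => [] [] /= h1 h2; try (have := h1 isT); try (have := h2 isT); lia.
  apply/ffunP => r; rewrite ffunE; have [->|rlo] := eqVneq r (ilo i).
    by rewrite glueE /=; apply/setP => j; rewrite !inE (lo_eq _ _ _ _ (hB j) (hl j)).
  have [->|rhi] := eqVneq r (ihi i); last by rewrite /= glue_out.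
  rewrite glueE /=; apply/setP => j; rewrite !inE -val_eqE /=; move: (hh j) (hC j).
  by move: (_ \in _) (_ \in _) => [] [] /= h1 h2; try (have := h1 isT); try (have := h2 isT); lia.
rewrite /core andbC /shape.
case sl: (S (ilo i) \subset _) => //=; case sh: (S (ihi i) \subset _) => //=.
case sB: (B \subset _); rewrite ?andbF //=; case sC: (C \subset _); rewrite ?andbF //= andbT.
have := subsetP sB; have := subsetP sC => hC hB.
apply: first_violation_congr => r.
  move=> j kj; rewrite !ffunE /=; case: ifP => _; [|case: ifP => _ //]; rewrite !inE -?val_eqE /=.
    by have := hB j; rewrite !inE; case: (_ \in B) => // /(_ isT); clear -kj; lia.
  by have := hC j; rewrite !inE; case: (_ \in C) => // /(_ isT); clear -kj; lia.
by move=> rlo; rewrite !ffunE (negbTE rlo); case: ifP => _ //; rewrite !inE eqxx.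
Qed.

(** All indices in these two rows exceed [k], so the counts compared by [first_violation_count] are
    full cardinalities. Hence the weight of a core is symmetric in the two variables. *)
Lemma core_count S : core S -> #|S (ilo i)| = #|S (ihi i)|.
Proof.
case/and3P => sl sh /first_violation_count; rewrite !glueE /= setU0 set0U /count_above.
move=> e; rewrite -(setIidPl sl) -(setIidPl sh) e.
by apply: eq_card => j; rewrite !inE -val_eqE /=; case: (_ \in _); lia.
Qed.

Lemma core_gap S j : core S -> j \in S (ilo i) -> (k.+1 < j)%N.
Proof.
case/and3P => sl _ fv jS; apply: (first_violation_gap fv); first by rewrite glueE inE jS orbT.
by have := subsetP sl j jS; rewrite inE.
Qed.

Variables (K : comNzRingType) (H : algType K) (U : nat -> H).
Hypotheses (UU : forall i, U i * U i = U i)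
  (braid : forall i, U i.+1 * U i * U i.+1 = U i * U i.+1 * U i)
  (far : forall i j, (i.+1 < j)%N -> U i * U j = U j * U i).

Definition row_word (R : rows) : H := \prod_(r < n) set_word U (R r).
Definition row_wt (x : 'I_n -> K) (R : rows) : K := \prod_(r < n) x r ^+ #|R r|.

Lemma sum_rows x : \sum_R row_wt x R *: row_word R = \prod_(r < n) cauchy_prod U N (x r).
Proof.
rewrite -[RHS](eq_bigr _ (fun r _ => sum_set_word U (x r) (leqnn N))).
have sT (X : {set 'I_N}) : X \subset below N by apply/subsetP => j _; rewrite inE.
rewrite [RHS](eq_bigr (fun r => \sum_(X : {set 'I_N}) x r ^+ #|X| *: set_word U X)); last first.
  by move=> r _; apply: eq_bigl => X; rewrite sT.
by rewrite bigA_distr_bigA; apply: eq_bigr => R _; rewrite scaler_prod.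
Qed.

Lemma row_wt_split x R : row_wt x R =
  x (ilo i) ^+ #|R (ilo i)| * x (ihi i) ^+ #|R (ihi i)|
    * \prod_(r | (r != ilo i) && (r != ihi i)) x r ^+ #|R r|.
Proof.
rewrite /row_wt (bigD1 (ilo i)) //= (bigD1 (ihi i)) ?mulrA //=.
by rewrite eq_sym ilo_neq_ihi.
Qed.

Lemma row_wt_glue x S (B C : {set 'I_N}) : core S -> B \subset below k.+1 -> C \subset below k ->
  row_wt x (glue (S, (B, C))) =
  x (ihi i) * row_wt x S * (x (ilo i) ^+ #|B| * x (ihi i) ^+ #|C|).
Proof.
move=> cS /subsetP sB /subsetP sC; case/and3P: (cS) => /subsetP sl /subsetP sh _.
rewrite !row_wt_split !glueE /=.
rewrite cardsU (_ : B :&: S (ilo i) = set0) ?cards0 ?subn0; last first.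
  apply/setP => j; rewrite !inE; apply/negbTE/negP => /andP[/sB + /sl].
  by rewrite !inE; lia.
rewrite cardsU (_ : (k |: C) :&: S (ihi i) = set0) ?cards0 ?subn0; last first.
  apply/setP => j; rewrite !inE; apply/negbTE/negP => /andP[/orP[/eqP->|/sC +] /sh].
    by rewrite !inE; lia.
  by rewrite !inE; lia.
have -> : \prod_(r | (r != ilo i) && (r != ihi i)) x r ^+ #|glue (S, (B, C)) r| =
          \prod_(r | (r != ilo i) && (r != ihi i)) x r ^+ #|S r|.
  by apply: eq_bigr => r /andP[rlo rhi]; rewrite glue_out.
rewrite cardsU1 (_ : k \in C = false) ?add1n; last by apply/negP => /sC; rewrite inE ltnn.
by rewrite exprD addSn exprS exprD; ring.
Qed.

(* In the core, row [i] does not contain [k+1] (first_violation_gap), so its word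
   commutes with the part of row [i+1] that has been added. *)
Lemma class_sum : exists pre post : rows -> H, forall x,
  \sum_(R | first_violation i k R) row_wt x R *: row_word R =
  \sum_(S | core S) (x (ihi i) * row_wt x S) *:
    (pre S * (cauchy_prod U k.+1 (x (ilo i)) * cauchy_prod U k (x (ihi i)) * U k) * post S).
Proof.
have [l1 [l2 [enumE out]]] := index_enum_adjacent i.
exists (fun S => \prod_(r <- l1) set_word U (S r)).
exists (fun S => set_word U (S (ilo i)) * (set_word U (S (ihi i)) * \prod_(r <- l2) set_word U (S r))).
move=> x; rewrite (reindex_onto glue cut); last exact: cutK.
rewrite (eq_bigl _ _ glueK) -(pair_big core
  (fun BC : {set 'I_N} * {set 'I_N} => (BC.1 \subset below k.+1) && (BC.2 \subset below k))
  (fun S BC => row_wt x (glue (S, BC)) *: row_word (glue (S, BC)))) /=.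
apply: eq_bigr => S cS.
rewrite -(pair_big (fun B : {set 'I_N} => B \subset below k.+1) (fun C : {set 'I_N} => C \subset below k)
  (fun B C => row_wt x (glue (S, (B, C))) *: row_word (glue (S, (B, C))))) /=.
rewrite -(sum_set_word U _ (ltn_ord k)) -(sum_set_word U _ (ltnW (ltn_ord k))).
rewrite big_distrlr /= !(mulr_suml, mulr_sumr) scaler_sumr; apply: eq_bigr => B sB.
rewrite !(mulr_suml, mulr_sumr) scaler_sumr; apply: eq_bigr => C sC.
rewrite row_wt_glue // -scalerA; congr (_ *: _).
rewrite -!scalerAl -!scalerAr -!scalerAl -!scalerAr -!scalerAl scalerA; congr (_ *: _).
rewrite /row_word enumE big_cat !big_cons /= -!mulrA; congr (_ * _).
  by apply: eq_big_seq => r rl1; rewrite glue_out //; case: (out r); rewrite // mem_cat rl1.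
have -> : \prod_(r <- l2) set_word U (glue (S, (B, C)) r) = \prod_(r <- l2) set_word U (S r).
  by apply: eq_big_seq => r rl; rewrite glue_out //; case: (out r); rewrite // mem_cat rl orbT.
have hB j : j \in B -> (j <= k)%N by move/(subsetP sB); rewrite inE.
have hC j : j \in C -> (j < k)%N by move/(subsetP sC); rewrite inE.
case/and3P: (cS) => /subsetP sl /subsetP sh _.
have split X Y : (forall j, j \in X -> (j <= k)%N) -> (forall j, j \in Y -> (k < j)%N) ->
    set_word U (X :|: Y) = set_word U X * set_word U Y.
  move=> hX hY; rewrite (set_word_split U (X :|: Y) (ltn_ord k)).
  congr (_ * _); apply: congr1; apply/setP => j; rewrite !inE.
    by move: (hX j) (hY j); move: (_ \in _) (_ \in _) => [] [] /= h1 h2; try (have := h1 isT); try (have := h2 isT); lia.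
  by move: (hX j) (hY j); move: (_ \in _) (_ \in _) => [] [] /= h1 h2; try (have := h1 isT); try (have := h2 isT); lia.
have kCk j : j \in k |: C -> (j <= k)%N by rewrite !inE => /orP[/eqP->//|/hC/ltnW].
rewrite !glueE /= (split B) //; last by move=> j /sl; rewrite inE.
rewrite (split (k |: C)) //; last by move=> j /sh; rewrite inE.
have kC : set_word U (k |: C) = set_word U C * U k.
  have kE : k = Ordinal (ltn_ord k) by apply: val_inj.
  by rewrite {1}kE set_wordU1.
rewrite -!mulrA; congr (_ * _); rewrite (mulrA (set_word U C)) -kC !mulrA; congr (_ * _ * _).
apply: (set_word_comm far (k := k)) => j; [exact: core_gap|exact: kCk].
Qed.

Definition swap_var (x : 'I_n -> K) (r : 'I_n) : K := x (tperm (ilo i) (ihi i) r).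

Lemma swap_varE x : (swap_var x (ilo i) = x (ihi i)) * (swap_var x (ihi i) = x (ilo i)).
Proof. by rewrite /swap_var tpermL tpermR. Qed.

Lemma swap_var_out x r : r != ilo i -> r != ihi i -> swap_var x r = x r.
Proof. by move=> rlo rhi; rewrite /swap_var tpermD // eq_sym. Qed.

(** The variable contributed by the letter [k] of row [i+1] and the prefactor [x (ilo i)] form a
    symmetric product, the core is symmetric by [core_count], and the rest is [cauchy_prod_swap]. *)
Lemma class_sum_swap x : (forall h : H, (1 + x (ihi i)) *: h = 0 -> h = 0) ->
  (x (ilo i) * (1 + x (ihi i))) *:
    \sum_(R | first_violation i k R) row_wt x R *: row_word R =
  (x (ihi i) * (1 + x (ilo i))) *:
    \sum_(R | first_violation i k R) row_wt (swap_var x) R *: row_word R.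
Proof.
move=> reg; have [pre [post sumE]] := class_sum.
rewrite !sumE !scaler_sumr; apply: eq_bigr => S /core_count cS.
rewrite !scalerA !swap_varE.
have -> : row_wt (swap_var x) S = row_wt x S.
  rewrite !row_wt_split !swap_varE cS; congr (_ * _); first exact: mulrC.
  by apply: eq_bigr => r /andP[rlo rhi]; rewrite swap_var_out.
have sw := cauchy_prod_swap UU braid far k (x (ilo i)) reg.
transitivity ((x (ilo i) * x (ihi i) * row_wt x S) *: (pre S * ((1 + x (ihi i)) *:
  (cauchy_prod U k.+1 (x (ilo i)) * cauchy_prod U k (x (ihi i)) * U k)) * post S)).
  by rewrite -scalerAr -scalerAl scalerA; congr (_ *: _); ring.
rewrite sw -scalerAr -scalerAl scalerA; congr (_ *: _); ring.
Qed.

Lemma sum_rows_swap x : (forall h : H, (1 + x (ihi i)) *: h = 0 -> h = 0) ->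
  \sum_R row_wt (swap_var x) R *: row_word R = \sum_R row_wt x R *: row_word R.
Proof.
move=> reg; rewrite !sum_rows.
have [l1 [l2 [-> out]]] := index_enum_adjacent i.
rewrite !big_cat !big_cons /= !swap_varE (mulrA (cauchy_prod U N (x (ihi i)))) -cauchy_prod_comm // -(mulrA (cauchy_prod U N (x (ilo i)))).
congr (_ * (_ * (_ * _))); apply: eq_big_seq => r rl; rewrite swap_var_out //;
  by case: (out r); rewrite // mem_cat rl ?orbT.
Qed.

End Classes.

(** * Alternants *)

Section Alternant.

Local Open Scope ring_scope.

Variables (n : nat) (K : comNzRingType).
Implicit Types (x y : 'I_n -> K) (g : ('I_n -> K) -> K) (s : {perm 'I_n}).

Definition alt_weight y := \prod_(r < n) (y r ^+ (n.-1 - r) * (1 + y r) ^+ r).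

Definition alternant g x :=
  \sum_(s : {perm 'I_n}) (-1) ^+ s * (alt_weight (x \o s) * g (x \o s)).

(** The cofactor [m] is the part symmetric in the two variables, given as a witness because [K] has
    no division. *)
Lemma alt_weight_swap i y : exists m : K,
  alt_weight y = m * (y (ilo i) * (1 + y (ihi i))) /\
  alt_weight (swap_var i y) = m * (y (ihi i) * (1 + y (ilo i))).
Proof.
pose F (y : 'I_n -> K) r := y r ^+ (n.-1 - r) * (1 + y r) ^+ r.
have split z : alt_weight z =
    F z (ilo i) * (F z (ihi i) * \prod_(r | (r != ilo i) && (r != ihi i)) F z r).
  rewrite /alt_weight (bigD1 (ilo i)) //= (bigD1 (ihi i)) //.
  by rewrite eq_sym ilo_neq_ihi.
have sub : (n.-1 - i = (n.-1 - i.+1).+1)%N by have := ltn_ord i; lia.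
exists ((y (ilo i) * y (ihi i)) ^+ (n.-1 - i.+1) * ((1 + y (ilo i)) * (1 + y (ihi i))) ^+ i
  * \prod_(r | (r != ilo i) && (r != ihi i)) F y r).
rewrite !split; have -> : \prod_(r | (r != ilo i) && (r != ihi i)) F (swap_var i y) r =
    \prod_(r | (r != ilo i) && (r != ihi i)) F y r.
  by apply: eq_bigr => r /andP[rlo rhi]; rewrite /F swap_var_out.
by rewrite /F !swap_varE /= sub !exprS !exprMn; split; ring.
Qed.

Lemma swap_var_comp i x s : swap_var i (x \o s) = x \o (tperm (ilo i) (ihi i) * s)%g.
Proof. by apply: boolp.funext => r; rewrite /swap_var /= permM. Qed.

(** The hypothesis makes [alt_weight] times [g] invariant under the adjacent swap, so the terms of
    [s] and of [s] preceded by the transposition cancel. Pairing even with odd permutations needs no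
    division by 2. *)
Lemma alternant0 i g x :
  (forall s, let y := x \o s in
     (y (ilo i) * (1 + y (ihi i))) * g y = (y (ihi i) * (1 + y (ilo i))) * g (swap_var i y)) ->
  alternant g x = 0.
Proof.
move=> sym; pose G s := alt_weight (x \o s) * g (x \o s).
pose t := tperm (ilo i) (ihi i).
have Gt s : G (t * s)%g = G s.
  rewrite /G -swap_var_comp; have [m [-> ->]] := alt_weight_swap i (x \o s).
  by rewrite -!mulrA !(mulrA _ (1 + _)) -sym !mulrA.
rewrite /alternant (bigID (fun s => odd_perm s)) /= addrC (reindex_inj (mulgI t)) /=.
apply/eqP; rewrite addr_eq0 -sumrN; apply/eqP; apply: eq_big => s.
  by rewrite odd_mul_tperm ilo_neq_ihi negbK.
rewrite odd_mul_tperm ilo_neq_ihi negbK => /= os.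
by rewrite -/(G s) -/(G (t * s)%g) Gt os /= expr1 mulN1r opprK mul1r.
Qed.

(** Adjacent transpositions generate: the good permutations are closed under products, and
    [tperm a b] is reached by induction on [b - a], conjugating by the adjacent transposition at
    [b]. *)
Lemma adjacent_symmetric g x :
  (forall i s, g (swap_var i (x \o s)) = g (x \o s)) -> forall s, g (x \o s) = g x.
Proof.
move=> adj.
pose P u := forall s, g (x \o (u * s)%g) = g (x \o s).
have P1 : P 1%g by move=> s; rewrite mul1g.
have PM u v : P u -> P v -> P (u * v)%g by move=> Pu Pv s; rewrite -mulgA Pu Pv.
have Padj (a b : 'I_n) : b = a.+1 :> nat -> P (tperm a b).
  move=> ab s; have ai : (a < n.-1)%N by have := ltn_ord b; lia.
  have -> : a = ilo (Ordinal ai) by apply: val_inj.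
  have -> : b = ihi (Ordinal ai) by apply: val_inj.
  by rewrite -swap_var_comp adj.
have Plt k (a b : 'I_n) : b = (a + k.+1)%N :> nat -> P (tperm a b).
  elim: k b => [|k IH] b bE; first by apply: Padj; lia.
  have cn : (a + k.+1 < n)%N by have := ltn_ord b; lia.
  have [c cE] : exists c : 'I_n, c = (a + k.+1)%N :> nat by exists (Ordinal cn).
  have -> : tperm a b = ((tperm c b)^-1 * (tperm a c * tperm c b))%g.
    rewrite -/(conjg _ _) tpermJ tpermL tpermD // -val_eqE /=; lia.
  have Pcb : P (tperm c b) by apply: Padj; lia.
  by rewrite tpermV; apply: (PM) => //; apply: PM => //; apply: IH.
have Pt (a b : 'I_n) : P (tperm a b).
  case: (ltngtP a b) => [lt|lt|/val_inj->]; last by rewrite tperm1.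
    by apply: (Plt (b - a.+1)%N); lia.
  by rewrite tpermC; apply: (Plt (a - b.+1)%N); lia.
move=> s; have [ts -> _] := prod_tpermP s.
have : P (\prod_(t <- ts) tperm t.1 t.2)%g.
  by elim: ts => [|t ts IH]; rewrite ?big_nil ?big_cons //; apply: PM.
move/(_ 1%g); rewrite mulg1 => ->; congr g.
by apply: boolp.funext => r; rewrite /= perm1.
Qed.

Lemma alternant_sym g x : (forall i s, g (swap_var i (x \o s)) = g (x \o s)) ->
  alternant g x = g x * alternant (fun=> 1) x.
Proof.
move=> /adjacent_symmetric sym; rewrite /alternant mulr_sumr; apply: eq_bigr => s _.
by rewrite sym mulr1 mulrC [RHS]mulrC mulrAC mulrC mulrA mulrC -!mulrA; congr (_ * _); rewrite mulrC.
Qed.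

Lemma alternantD g h x : alternant (fun y => g y + h y) x = alternant g x + alternant h x.
Proof. by rewrite /alternant -big_split; apply: eq_bigr => s _; rewrite /= !mulrDr. Qed.

Lemma alternant_sum (I : Type) (r : seq I) (P : pred I) (G : I -> ('I_n -> K) -> K) x :
  alternant (fun y => \sum_(j <- r | P j) G j y) x = \sum_(j <- r | P j) alternant (G j) x.
Proof.
rewrite /alternant [RHS]exchange_big; apply: eq_bigr => s _.
by rewrite /= !mulr_sumr.
Qed.

End Alternant.

Section AlternantOne.

Local Open Scope ring_scope.

(* At [x_r = 1/(r+1)] the entries [x_c^(n-1-r) (1+x_c)^r] form a Vandermonde
   matrix in [(1+x_c)/x_c = c+2], with rescaled columns. *)
Lemma alternant1_neq0 n : alternant (fun=> 1) (fun r : 'I_n => 'X_r : {mpoly rat[n]}) != 0.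
Proof.
pose v (r : 'I_n) : rat := (r.+1%:R)^-1.
suff : (alternant (fun=> 1) (fun r : 'I_n => 'X_r : {mpoly rat[n]})).@[v] != 0.
  by apply: contraNneq => ->; rewrite meval0.
have -> : (alternant (fun=> 1) (fun r : 'I_n => 'X_r : {mpoly rat[n]})).@[v] = alternant (fun=> 1) v.
  rewrite /alternant rmorph_sum; apply: eq_bigr => s _.
  rewrite !rmorphM rmorphXn rmorphN !rmorph1 !mulr1; congr (_ * _).
  rewrite rmorph_prod; apply: eq_bigr => r _.
  by rewrite rmorphM !rmorphXn rmorphD rmorph1 /= mevalXU.
pose t : 'rV[rat]_n := \row_c (c.+2%:R).
have -> : alternant (fun=> 1) v = \det (Vandermonde n t *m diag_mx (\row_c (v c ^+ n.-1))).
  rewrite /determinant; apply: eq_bigr => s _; rewrite mulr1; congr (_ * _).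
  apply: eq_bigr => r _; rewrite mul_mx_diag !mxE /=.
  have -> : 1 + v (s r) = (s r).+2%:R * v (s r).
    by rewrite -natr1 mulrDl mul1r divff ?pnatr_eq0.
  by rewrite exprMn mulrCA -exprD subnK // -ltnS prednK ?ltn_ord // (leq_ltn_trans (leq0n r)).
rewrite det_mulmx det_Vandermonde det_diag mulf_neq0 //.
  apply/prodf_neq0 => a _; apply/prodf_neq0 => b ab.
  by rewrite !mxE subr_eq0 eqr_nat; lia.
by apply/prodf_neq0 => a _; rewrite mxE expf_neq0 // invr_eq0 pnatr_eq0.
Qed.

End AlternantOne.

(** * The Demazure product *)

Section DemazureTheory.

Local Open Scope group_scope.
Implicit Types (u v w : Sinf) (i j k x : nat).

Lemma simpleE i x : (0 < i)%N ->
  simple i x = if x == i then i.+1 else if x == i.+1 then i else x.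
Proof. by rewrite /= simple_funE; case: eqP => //; lia. Qed.

Lemma simple0 : simple 0 = 1.
Proof. by apply: sinfP => x; rewrite sinf1 /= simple_funE. Qed.

Lemma simpleK i : simple i * simple i = 1.
Proof.
case: (posnP i) => [->|i0]; first by rewrite simple0 mulg1.
by apply: sinfP => x; rewrite sinfM sinf1 !simpleE //; do ![case: eqP => //]; lia.
Qed.

Lemma sinf_bounded w : exists N, forall x, (N <= x)%N -> w x = x.
Proof.
exists (\max_(y <- finsupp w) y.+1)%N => x xN; apply: fsfun_dflt; apply/negP => xw.
by move: xN; rewrite (big_rem x xw) /=; lia.
Qed.

Lemma demazureA : associative demazure.
Proof. by case: demazureP. Qed.

Lemma demazure_asc w i : (0 < i)%N -> (w i < w i.+1)%N -> demazure w (simple i) = w * simple i.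
Proof. by case: demazureP => _ _; apply. Qed.

Lemma demazure_desc w i : (0 < i)%N -> (w i.+1 < w i)%N -> demazure w (simple i) = w.
Proof.
move=> i0 wi; have [_ idem _] := demazureP.
have wE : w = demazure (w * simple i) (simple i).
  rewrite demazure_asc // -?mulgA ?simpleK ?mulg1 //.
  by rewrite !sinfM !simpleE // !eqxx; case: eqP; lia.
by rewrite {1}wE -demazureA idem // -wE.
Qed.

Lemma asc_or_desc w i : (w i < w i.+1)%N \/ (w i.+1 < w i)%N.
Proof. by case: (ltngtP (w i) (w i.+1)) => [||/sinf_inj]; auto; lia. Qed.

Lemma demazure1 w : demazure w 1 = w.
Proof.
set x := demazure w 1.
have [N1 xN] := sinf_bounded x; have [N2 wN] := sinf_bounded w.
pose j := (maxn N1 N2).+1.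
have : demazure x (simple j) = demazure w (simple j).
  by rewrite -demazureA demazure_asc // ?mul1g // !sinf1.
rewrite !demazure_asc ?xN ?wN //; try by rewrite /j; lia.
exact: mulIg.
Qed.

(** Outer induction on a bound [N] beyond which [w] is the identity; inner induction on the distance
    from the position [p] of the largest value that may move to its place. While [p] is short of it,
    [w] has a descent at [p], and removing that descent shifts the value one step right. *)
Lemma demazure_ind (P : Sinf -> Prop) :
  P 1 -> (forall w i, (0 < i)%N -> P w -> P (demazure w (simple i))) -> forall w, P w.
Proof.
move=> P1 PS w; have [N wN] := sinf_bounded w.
elim: N w wN => [|N IH] w wN.
  by have -> : w = 1 by apply: sinfP => x; rewrite sinf1 wN.
have [p /eqP wp] := sinf_surj w N.
have pN : (p <= N)%N.
  by rewrite leqNgt; apply/negP => Np; have := wN _ Np; rewrite wp; lia.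
have [k kE] := ubnP (N - p)%N.
elim: k w p wN wp pN kE => // k IHk w p wN wp pN kE.
have [pE|pNE] := eqVneq p N.
  apply: IH => x; rewrite leq_eqVlt => /orP[/eqP<-|/wN//]; by rewrite -[in LHS]pE.
have p0 : (0 < p)%N by case: p wp pNE {kE pN} => //; rewrite sinf0 => -> /eqP.
have wlt x : (x <= N)%N -> x != p -> (w x < N)%N.
  move=> xN xp; rewrite ltn_neqAle -{1}wp (inj_eq (@sinf_inj w)) xp /= leqNgt.
  by apply/negP => Nw; have /sinf_inj := wN _ Nw; lia.
have desc : (w p.+1 < w p)%N by rewrite wp wlt //; lia.
have sp : simple p p = p.+1 by rewrite simpleE // eqxx.
have sp1 : simple p p.+1 = p by rewrite simpleE // eqxx; case: eqP; lia.
have wE : w = demazure (w * simple p) (simple p).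
  by rewrite demazure_asc -?mulgA ?simpleK ?mulg1 // !sinfM sp sp1.
rewrite wE; apply: PS => //; apply: (IHk _ p.+1); rewrite ?sinfM ?sp1 //; try lia.
by move=> x xN; rewrite sinfM simpleE //; do ![case: eqP => //]; try lia; rewrite wN.
Qed.

Lemma dem1ure w : demazure 1 w = w.
Proof.
by elim/demazure_ind: w => [|w i i0 IH]; rewrite ?demazure1 // demazureA IH.
Qed.

Lemma demazure_simple_desc w i : (0 < i)%N ->
  (demazure w (simple i) i.+1 < demazure w (simple i) i)%N.
Proof.
move=> i0; case: (asc_or_desc w i) => wi; last by rewrite demazure_desc.
by rewrite demazure_asc // !sinfM !simpleE // !eqxx; case: eqP; lia.
Qed.

(** A product ending in [simple i] has a descent at [i], unlike the identity. The monomial structure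
    behind the monoid algebra asks for this property. *)
Lemma demazure_eq1 u v : demazure u v = 1 -> u = 1 /\ v = 1.
Proof.
elim/demazure_ind: v => [|v i i0 _]; first by rewrite demazure1.
rewrite demazureA => e; have := demazure_simple_desc (demazure u v) i0.
by rewrite e !sinf1; lia.
Qed.

HB.instance Definition _ := Monoid.isLaw.Build Sinf 1 demazure demazureA dem1ure demazure1.

Lemma demazure_idem i : demazure (simple i) (simple i) = simple i.
Proof.
case: (posnP i) => [->|i0]; first by rewrite simple0 demazure1.
by have [_ idem _] := demazureP; apply: idem.
Qed.

Lemma demazure_far i j : (i.+1 < j)%N ->
  demazure (simple i) (simple j) = demazure (simple j) (simple i).
Proof.
move=> ij; case: (posnP i) => [->|i0]; first by rewrite simple0 demazure1 dem1ure.
have j0 : (0 < j)%N by lia.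
rewrite !demazure_asc ?simpleE //; try by do ![case: eqP => //]; lia.
by apply: sinfP => x; rewrite !sinfM !simpleE //; do ![case: eqP => //]; lia.
Qed.

Lemma demazure_braid i : demazure (demazure (simple i) (simple i.+1)) (simple i) =
  demazure (demazure (simple i.+1) (simple i)) (simple i.+1).
Proof.
case: (posnP i) => [->|i0]; first by rewrite simple0 !demazure1 !dem1ure demazure_idem.
rewrite (demazure_asc (w := simple i)) // ?simpleE //; last by do ![case: eqP => //]; lia.
rewrite (demazure_asc (w := simple i.+1)) // ?simpleE //; last by do ![case: eqP => //]; lia.
rewrite !demazure_asc // ?sinfM ?simpleE //; try by do ![case: eqP => //]; lia.
by apply: sinfP => x; rewrite !sinfM !simpleE //; do ![case: eqP => //]; lia.
Qed.

(* [crosses w i]: [w] does not preserve [{1, ..., i}]. *)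
Definition crosses w i := exists2 x, (x <= i)%N & (i < w x)%N.

(** For [j != i] the witness [x] moves to [simple j x], still at most [i]. For [j = i], a witness
    [x < i] is untouched, and [x = i] remains one because the ascent puts the larger value [w i.+1]
    there. *)
Lemma crosses_demazure w i j : (0 < j)%N -> crosses w i -> crosses (demazure w (simple j)) i.
Proof.
move=> j0 [x xi wx]; case: (asc_or_desc w j) => wj; last by rewrite demazure_desc //; exists x.
rewrite demazure_asc //.
have [ij|ij] := eqVneq j i; last first.
  exists (simple j x); first by rewrite simpleE //; do ![case: eqP => //]; lia.
  by rewrite sinfM -(sinfM (simple j)) simpleK sinf1.
have [xE|xi'] := eqVneq x i.
  by exists i => //; rewrite sinfM simpleE // ij eqxx; move: wj wx; rewrite xE ij; lia.
by exists x => //; rewrite sinfM simpleE //; do ![case: eqP => //]; lia.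
Qed.

Lemma crosses_demazure_simple w i : (0 < i)%N -> crosses (demazure w (simple i)) i.
Proof.
move=> i0; set v := demazure _ _; have := demazure_simple_desc w i0; rewrite -/v => vi.
apply: boolp.contrapT => nc.
have le x : (x <= i)%N -> (v x <= i)%N.
  by move=> xi; rewrite leqNgt; apply/negP => ivx; apply: nc; exists x.
(* [v] would map [{0, ..., i+1}] injectively into [{0, ..., i}]. *)
have inj : injective (fun x : 'I_i.+2 => inord (v x) : 'I_i.+1).
  have lev (x : 'I_i.+2) : (v x < i.+1)%N.
    have := ltn_ord x; rewrite ltnS leq_eqVlt => /orP[/eqP[->]|]; last by rewrite !ltnS => /le.
    by have := le i (leqnn i); lia.
  by move=> x y /(congr1 val); rewrite /= !inordK // => /sinf_inj/val_inj.
by have := leq_card _ inj; rewrite !card_ord ltnn.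
Qed.

Lemma hecke_word_crosses w s i : hecke_word w s -> i \in s -> crosses w i.
Proof.
case/andP => pos /eqP <-; elim/last_ind: s pos => // s j IH.
rewrite all_rcons -cats1 big_cat big_seq1 mem_cat inE => /andP[j0 pos] /orP[/IH|/eqP->].
  by move=> /(_ pos); apply: crosses_demazure.
exact: crosses_demazure_simple.
Qed.

(** A letter [i] forces some [x <= i] with [w x > i]. If [i] exceeded the support, [w] would fix
    [w x], hence [w x = x], which is absurd. *)
Lemma hecke_word_bounded w : exists N, forall s i, hecke_word w s -> i \in s -> (i <= N)%N.
Proof.
have [N wN] := sinf_bounded w; exists N => s i hs /(hecke_word_crosses hs)[x xi iw].
rewrite leqNgt; apply/negP => Ni.
by have /sinf_inj := wN (w x) ltac:(lia); lia.
Qed.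

End DemazureTheory.

(** * The 0-Hecke algebra, and the alternant identity for factorizations *)

Module HeckeAlgebra.

Import monalg.
Local Open Scope ring_scope.

(** A copy of [Sinf] that carries the Demazure product as monoid law, beside the group law of
    [Sinf]. Its monoid algebra is the 0-Hecke algebra with idempotent generators. *)
Definition hecke_monoid := Sinf.
HB.instance Definition _ := Choice.on hecke_monoid.
HB.instance Definition _ := Choice_isMonomialDef.Build hecke_monoid
  demazureA dem1ure demazure1 demazure_eq1.

Lemma malg_scaleAr (K : comNzRingType) (M : monomType) (c : K) (g h : {malg K[M]}) :
  c *: (g * h) = g * (c *: h).
Proof.
rewrite (malgMEw (fsubset_refl (msupp g)) (msuppZ_le c h)) malgME scaler_sumr.
apply: eq_bigr => k _; rewrite scaler_sumr; apply: eq_bigr => l _.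
apply/malgP => m; rewrite !(mcoeffZ, mcoeffU).
by case: (_ == m); rewrite ?mulr1n ?mulr0n ?mulr0 // mulrCA.
Qed.

Section HeckeGenerators.

Variables (A : nzRingType) (e : Sinf -> A) (N : nat).
Hypotheses (eM : forall u v, e u * e v = e (demazure u v)) (e1 : e 1%g = 1).

(* Reading the letters from [N] down turns decreasing words into increasing
   sets of indices. *)
Definition generator j := e (simple (N - j)).

Lemma generator_idem j : generator j * generator j = generator j.
Proof. by rewrite /generator eM demazure_idem. Qed.

Lemma generator_far i j : (i.+1 < j)%N -> generator i * generator j = generator j * generator i.
Proof.
move=> ij; rewrite /generator !eM; congr e.
(* From index [N] on, truncated subtraction yields [simple 0], the identity, so that the relations
   hold for all natural indices. *)
case: (leqP N j) => [Nj|jN]; last by rewrite -demazure_far //; lia.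
by have -> : (N - j = 0)%N by [lia]; rewrite simple0 demazure1 dem1ure.
Qed.

Lemma generator_braid j :
  generator j.+1 * generator j * generator j.+1 = generator j * generator j.+1 * generator j.
Proof.
rewrite /generator !eM; congr e; case: (leqP N j) => [Nj|jN].
  by have [-> ->] : (N - j = 0 /\ N - j.+1 = 0)%N by [lia].
by have -> : (N - j = (N - j.+1).+1)%N by [lia]; rewrite demazure_braid.
Qed.

Definition hecke_prod n (R : {ffun 'I_n -> {set 'I_N}}) : Sinf :=
  \big[demazure/1%g]_(r < n) \big[demazure/1%g]_(j < N | j \in R r) simple (N - j).

Lemma prod_generator n (R : {ffun 'I_n -> {set 'I_N}}) :
  \prod_(r < n) \prod_(j < N | j \in R r) generator j = e (hecke_prod R).
Proof.
rewrite /hecke_prod (big_morph e (fun u v => esym (eM u v)) e1).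
by apply: eq_bigr => r _; rewrite (big_morph e (fun u v => esym (eM u v)) e1).
Qed.

End HeckeGenerators.

Definition hecke_algebra (K : comNzRingType) := {malg K[hecke_monoid]}.
HB.instance Definition _ (K : comNzRingType) := GRing.Lalgebra.on (hecke_algebra K).
HB.instance Definition _ (K : comNzRingType) :=
  GRing.Lalgebra_isAlgebra.Build K (hecke_algebra K) (@malg_scaleAr K hecke_monoid).

Section HeckeBasis.

Variable K : comNzRingType.
Implicit Types (u v w : Sinf) (h : hecke_algebra K).

Definition hecke_elt u : hecke_algebra K := << (u : hecke_monoid) >>.
Definition hecke_coef w h : K := mcoeff (w : hecke_monoid) h.

Lemma hecke_eltM u v : hecke_elt u * hecke_elt v = hecke_elt (demazure u v).
Proof.
by rewrite -[LHS]/(fgmul (hecke_elt u) (hecke_elt v)) /hecke_elt fgmulUU mulr1.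
Qed.

Lemma hecke_coef_elt w u : hecke_coef w (hecke_elt u) = (u == w)%:R.
Proof. exact: mcoeffU1. Qed.

Lemma hecke_coefZ w c h : hecke_coef w (c *: h) = c * hecke_coef w h.
Proof. exact: mcoeffZ. Qed.

Lemma hecke_coefD w h h' : hecke_coef w (h + h') = hecke_coef w h + hecke_coef w h'.
Proof. exact: mcoeffD. Qed.

Lemma hecke_coef_sum w (I : Type) (r : seq I) (P : pred I) (F : I -> hecke_algebra K) :
  hecke_coef w (\sum_(j <- r | P j) F j) = \sum_(j <- r | P j) hecke_coef w (F j).
Proof. by apply: (big_morph (hecke_coef w)); [exact: hecke_coefD|exact: mcoeff0]. Qed.

Lemma hecke_coefP h h' : (forall w, hecke_coef w h = hecke_coef w h') -> h = h'.
Proof. by move=> e; apply/malgP. Qed.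

End HeckeBasis.

Section HeckeExpansion.

Variables (K : idomainType) (n N : nat) (x : 'I_n -> K).
Hypothesis x_reg : forall r, 1 + x r != 0.

Local Notation rows := {ffun 'I_n -> {set 'I_N}}.

Local Notation gen := (generator (@hecke_elt K) N).

Lemma row_wordE (R : rows) : row_word gen R = hecke_elt K (hecke_prod R).
Proof. exact: (prod_generator (@hecke_eltM K)). Qed.

Lemma hecke_algebra_reg (c : K) (h : hecke_algebra K) : c != 0 -> c *: h = 0 -> h = 0.
Proof.
move=> c0 ch; apply: hecke_coefP => w; have := congr1 (hecke_coef w) ch.
rewrite hecke_coefZ; have -> : hecke_coef w (0 : hecke_algebra K) = 0 by exact: mcoeff0.
by move/eqP; rewrite mulf_eq0 (negbTE c0) => /eqP.
Qed.

Lemma hecke_coef_rows (P : pred rows) y (w : Sinf) :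
  hecke_coef w (\sum_(R | P R) row_wt y R *: row_word gen R) =
  \sum_(R | P R && (hecke_prod R == w)) row_wt y R.
Proof.
rewrite hecke_coef_sum big_mkcondr; apply: eq_bigr => R _.
by rewrite hecke_coefZ row_wordE hecke_coef_elt; case: eqP => _; rewrite ?mulr1 ?mulr0.
Qed.

(** The identities live in the algebra, where the coefficient of [w] selects the families with
    product [w]. The hypothesis [x_reg] lets the scalars [1 + x r] act injectively there. *)
Lemma hecke_alternant (w : Sinf) :
  (\sum_(R : rows | hecke_prod R == w) row_wt x R) * alternant (fun=> 1) x =
  \sum_(R : rows | tableau_rows R && (hecke_prod R == w)) alternant (fun y => row_wt y R) x.
Proof.
pose g (y : 'I_n -> K) := \sum_(R : rows | hecke_prod R == w) row_wt y R.
have gE y : g y = hecke_coef w (\sum_(R : rows) row_wt y R *: row_word gen R).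
  by rewrite (hecke_coef_rows predT).
have reg i s (h : hecke_algebra K) : (1 + (x \o s) (ihi i)) *: h = 0 -> h = 0.
  by apply: hecke_algebra_reg; apply: x_reg.
rewrite -/(g x) -alternant_sym; last first.
  move=> i s; rewrite !gE; apply: (congr1 (hecke_coef w)).
  apply: sum_rows_swap; last exact: reg.
  - exact: (generator_idem N (@hecke_eltM K)).
  - exact: (generator_braid N (@hecke_eltM K)).
  - exact: (generator_far N (@hecke_eltM K)).
have -> : g = fun y => \sum_(R : rows | tableau_rows R && (hecke_prod R == w)) row_wt y R
    + \sum_(i < n.-1) \sum_(k < N)
        \sum_(R : rows | first_violation i k R && (hecke_prod R == w)) row_wt y R.
  apply: boolp.funext => y; rewrite gE sum_first_violation hecke_coefD hecke_coef_rows.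
  congr (_ + _); rewrite hecke_coef_sum; apply: eq_bigr => i _.
  by rewrite hecke_coef_sum; apply: eq_bigr => k _; rewrite hecke_coef_rows.
rewrite alternantD alternant_sum [X in _ + X](_ : _ = 0) ?addr0 //.
rewrite alternant_sum big1 // => i _; rewrite alternant_sum big1 // => k _.
apply: (alternant0 (i := i)) => s y.
rewrite -!hecke_coef_rows -!hecke_coefZ; apply: (congr1 (hecke_coef w)).
apply: class_sum_swap; last exact: reg.
- exact: (generator_idem N (@hecke_eltM K)).
- exact: (generator_braid N (@hecke_eltM K)).
- exact: (generator_far N (@hecke_eltM K)).
Qed.

End HeckeExpansion.

End HeckeAlgebra.

Import HeckeAlgebra.

(** * The crystal of words *)

Section Strings.

Import boolp classical_sets.

Variables (T : Type) (g : T -> option T) (len : T -> nat).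
Hypotheses (len0 : forall b, g b = None -> len b = 0)
  (lenS : forall b c, g b = Some c -> len b = (len c).+1).

(** A function that vanishes where [g] stops and drops by one along [g] counts the steps left.
    String lengths thus get closed formulas in place of suprema. *)
Lemma stepsE b : steps g b = [set k | (k <= len b)%N]%classic.
Proof.
apply/seteqP; split=> k /=; rewrite /steps /=.
  elim: k b => // k IH b; rewrite iterSr /=; case gb: (g b) => [c|] /=.
    by move/IH; rewrite (lenS gb).
  by have -> : iter k (obind g) None = None by elim: k {IH} => //= k ->.
elim: k b => // k IH b; rewrite iterSr /=; case gb: (g b) => [c|] /=.
  by rewrite (lenS gb); apply: IH.
by rewrite (len0 gb).
Qed.

Lemma steps_ubound b : has_ubound (steps g b).
Proof. by exists (len b) => k; rewrite stepsE. Qed.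

Lemma supremum_steps b : supremum 0%N (steps g b) = len b.
Proof.
have ub : supremums (steps g b) (len b).
  split; first by move=> k; rewrite stepsE.
  by move=> m; apply; rewrite stepsE /=.
rewrite /supremum; case: ifPn => [/eqP e0|_]; last first.
  case: xgetP => [m -> um|]; last by move=> /(_ (len b)).
  exact: (is_subset1_supremums um ub).
by have : steps g b (len b) by [rewrite stepsE /=]; rewrite e0.
Qed.

End Strings.

Section Letters.

Variables (n : nat) (i : 'I_n.-1).
Implicit Types (S T : SS_elt n).

(** Up to the other elements, the string of a letter is [{i}], [{i,i+1}], [{i+1}]; hence the values
    0, 1, 2. *)
Definition letter_eps S := if ihi i \in val S then if ilo i \in val S then 1 else 2 else 0.
Definition letter_phi S := if ilo i \in val S then if ihi i \in val S then 1 else 2 else 0.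

Lemma letter_cap S :
  ((val S :&: [set ilo i; ihi i] == [set ihi i]) = (ihi i \in val S) && (ilo i \notin val S)) *
  ((val S :&: [set ilo i; ihi i] == [set ilo i]) = (ilo i \in val S) && (ihi i \notin val S)) *
  ((val S :&: [set ilo i; ihi i] == [set ilo i; ihi i]) = (ilo i \in val S) && (ihi i \in val S)).
Proof.
have ne := negbTE (ilo_neq_ihi i); have ne' : (ihi i == ilo i) = false by rewrite eq_sym.
have E (B : {set 'I_n}) : B \subset [set ilo i; ihi i] ->
    (val S :&: [set ilo i; ihi i] == B) =
    ((ilo i \in val S) == (ilo i \in B)) && ((ihi i \in val S) == (ihi i \in B)).
  move=> /subsetP sB; apply/eqP/andP => [<-|[/eqP l /eqP h]].
    by rewrite !inE !eqxx ?orbT !andbT.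
  apply/setP => r; rewrite !inE; case: eqP => [->|rl]; first by rewrite andbT.
  case: eqP => [->|rh]; first by rewrite andbT.
  by rewrite andbF; apply/esym/negbTE/negP => /sB; rewrite !inE => /orP[] /eqP.
split; first split.
- rewrite E; last by rewrite sub1set !inE eqxx orbT.
  by rewrite !inE ne eqxx; case: (ilo i \in _); case: (ihi i \in _).
- rewrite E; last by rewrite sub1set !inE eqxx.
  by rewrite !inE ne' eqxx; case: (ilo i \in _); case: (ihi i \in _).
- rewrite E // !inE !eqxx orbT.
  by case: (ilo i \in _); case: (ihi i \in _).
Qed.

Lemma SS_e_spec S :
  if SS_e i S is Some T
  then (ihi i \in val S) && (val T == if ilo i \in val S then val S :\ ihi i else ilo i |: val S)
  else ihi i \notin val S.
Proof.
rewrite /SS_e !letter_cap; case: (boolP (ihi i \in val S)) => /= hS; last by rewrite andbF.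
rewrite andbT; case: (boolP (ilo i \in val S)) => /= lS.
  case: insubP => [T _ ->//|/negP[]]; apply/set0Pn; exists (ilo i).
  by rewrite !inE ilo_neq_ihi.
case: insubP => [T _ ->//|/negP[]]; apply/set0Pn; exists (ilo i).
by rewrite !inE eqxx.
Qed.

Lemma SS_f_spec S :
  if SS_f i S is Some T
  then (ilo i \in val S) && (val T == if ihi i \in val S then val S :\ ilo i else ihi i |: val S)
  else ilo i \notin val S.
Proof.
rewrite /SS_f !letter_cap; case: (boolP (ilo i \in val S)) => //= lS.
case: (boolP (ihi i \in val S)) => /= hS.
  case: insubP => [T _ ->//|/negP[]]; apply/set0Pn; exists (ihi i).
  by rewrite !inE eq_sym ilo_neq_ihi.
case: insubP => [T _ ->//|/negP[]]; apply/set0Pn; exists (ihi i).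
by rewrite !inE eqxx.
Qed.

Lemma SS_e_None S : SS_e i S = None <-> letter_eps S = 0.
Proof.
have := SS_e_spec S; rewrite /letter_eps; case: SS_e => [T /andP[-> _]|/negbTE->] //.
by case: ifP.
Qed.

Lemma SS_f_None S : SS_f i S = None <-> letter_phi S = 0.
Proof.
have := SS_f_spec S; rewrite /letter_phi; case: SS_f => [T /andP[-> _]|/negbTE->] //.
by case: ifP.
Qed.

Lemma SS_efP S T : SS_e i S = Some T <-> SS_f i T = Some S.
Proof.
have ne := negbTE (ilo_neq_ihi i); have ne' : (ihi i == ilo i) = false by rewrite eq_sym.
split=> E.
  have := SS_e_spec S; rewrite E => /andP[hS /eqP tE].
  have := SS_f_spec T; case: SS_f => [S' /andP[lT /eqP sE]|]; last first.
    by rewrite tE; case: ifP => lS; rewrite !inE ?lS ?ne ?eqxx.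
  congr Some; apply: val_inj; rewrite sE tE.
  case: (boolP (ilo i \in val S)) => lS; rewrite !inE ?eqxx /= ?ne' ?hS /=.
    by rewrite setD1K.
  by rewrite setU1K.
have := SS_f_spec T; rewrite E => /andP[lT /eqP sE].
have := SS_e_spec S; case: SS_e => [T' /andP[hS /eqP tE]|]; last first.
  by rewrite sE; case: ifP => hT; rewrite !inE ?hT ?ne' ?eqxx.
congr Some; apply: val_inj; rewrite tE sE.
case: (boolP (ihi i \in val T)) => hT; rewrite !inE ?eqxx /= ?ne ?lT /=.
  by rewrite setD1K.
by rewrite setU1K.
Qed.

Lemma SS_e_change S T : SS_e i S = Some T ->
  [/\ letter_eps S = (letter_eps T).+1, letter_phi T = (letter_phi S).+1 &
   forall r, ((r \in val T) + (odd (letter_eps S) && (r == ihi i)) =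
    (r \in val S) + (~~ odd (letter_eps S) && (r == ilo i)))%N].
Proof.
have ne := negbTE (ilo_neq_ihi i); have ne' : (ihi i == ilo i) = false by rewrite eq_sym.
have := SS_e_spec S => + E; rewrite E /letter_eps /letter_phi => /andP[hS /eqP ->].
rewrite hS; case: (boolP (ilo i \in val S)) => lS; rewrite !inE ?eqxx ?ne ?ne' ?hS ?lS /=.
  by split=> // r; rewrite !inE; case: eqP => [->|_]; rewrite ?hS ?addn0.
by split=> // r; rewrite !inE; case: eqP => [->|_]; rewrite ?(negbTE lS) ?addn0.
Qed.

Lemma letter_balance S :
  (letter_phi S + (ihi i \in val S).*2 = letter_eps S + (ilo i \in val S).*2)%N.
Proof. by rewrite /letter_eps /letter_phi; case: (ihi i \in _); case: (ilo i \in _). Qed.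

End Letters.

(* A word lists the factors of a tensor product from the last to the first. *)
Section Words.

Variables (n : nat) (i : 'I_n.-1).
Local Notation word := (seq (SS_elt n)).
Implicit Types (S T : SS_elt n) (s b c : word).

(** The word [A :: b] stands for the tensor product of [b] with last factor [A]; truncated
    subtraction expresses the maximum with 0 in the tensor rule. *)
Fixpoint word_eps s : nat :=
  if s is A :: b then (letter_eps i A + (word_eps b - letter_phi i A))%N else 0.
Fixpoint word_phi s : nat :=
  if s is A :: b then (word_phi b + (letter_phi i A - word_eps b))%N else 0.
Fixpoint word_e s : option word :=
  if s is A :: b then
    if (word_eps b <= letter_phi i A)%N then omap (cons^~ b) (SS_e i A) else omap (cons A) (word_e b)
  else None.
Fixpoint word_f s : option word :=
  if s is A :: b then
    if (word_eps b < letter_phi i A)%N then omap (cons^~ b) (SS_f i A) else omap (cons A) (word_f b)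
  else None.
Definition word_count s (r : 'I_n) : nat := count (fun S => r \in val S) s.

Lemma word_e_None s : word_e s = None <-> word_eps s = 0.
Proof.
elim: s => //= S b IH; have [h1 h2] := SS_e_None i S; case: leqP => cmp.
  case: SS_e h1 h2 => [T|] /= h1 h2.
    by split=> // e0; have := h2 ltac:(lia).
  by split=> // _; rewrite h1 //; lia.
case: IH; case: (word_e b) => [b'|] /= g1 g2; split=> // e0; first by have := g2 ltac:(lia).
by have := g1 erefl; lia.
Qed.

Lemma word_f_None s : word_f s = None <-> word_phi s = 0.
Proof.
elim: s => //= S b IH; have [h1 h2] := SS_f_None i S; case: ltnP => cmp.
  case: SS_f h1 h2 => [T|] /= h1 h2.
    by split=> // e0; have := h2 ltac:(lia).
  by split=> // _; have := h1 erefl; lia.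
case: IH; case: (word_f b) => [b'|] /= g1 g2; split=> // e0; first by have := g2 ltac:(lia).
by have := g1 erefl; lia.
Qed.

Lemma word_balance s :
  (word_phi s + (word_count s (ihi i)).*2 = word_eps s + (word_count s (ilo i)).*2)%N.
Proof.
rewrite /word_count; elim: s => //= S b IH; have := letter_balance i S.
by move: (ihi i \in _) (ilo i \in _) IH => [] []; lia.
Qed.

Lemma word_e_change s s' : word_e s = Some s' ->
  [/\ word_eps s = (word_eps s').+1, word_phi s' = (word_phi s).+1, size s' = size s &
   forall r, (word_count s' r + (odd (word_eps s) && (r == ihi i)) =
    word_count s r + (~~ odd (word_eps s) && (r == ilo i)))%N].
Proof.
elim: s s' => //= S b IH s'; case: leqP => cmp.
  case E: SS_e => [T|] //= [<-]; have [e1 p1 cnt] := SS_e_change E.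
  split=> /=; [lia|lia|by []|move=> r].
  rewrite /word_count /=; have -> : (word_eps b - letter_phi i S = 0)%N by lia.
  by rewrite addn0 addnAC cnt addnAC.
case E: (word_e b) => [b'|] //= [<-]; have [e1 p1 sz cnt] := IH _ E.
split=> /=; [lia|lia|by rewrite sz|move=> r].
rewrite /word_count /=.
(* [letter_eps] and [letter_phi] have the same parity, so the parity deciding between adding [i] and
   removing [i+1] is that of the part acted upon. *)
have -> : odd (letter_eps i S + (word_eps b - letter_phi i S)) = odd (word_eps b).
  have := letter_balance i S; rewrite oddD oddB ?(ltnW cmp) //.
  move/(congr1 odd); rewrite !oddD !odd_double !addbF => ->.
  by rewrite addbCA addbb addbF.
by rewrite -!addnA; congr (_ + _)%N; exact: cnt.
Qed.

Lemma word_efP s s' : word_e s = Some s' <-> word_f s' = Some s.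
Proof.
have ef : word_e s = Some s' -> word_f s' = Some s.
  elim: s s' => //= S b IH s'; case: leqP => cmp.
    case E: SS_e => [T|] //= [<-] /=; have [_ p1 _] := SS_e_change E.
    by rewrite p1 ltnS cmp (SS_efP i S T).1.
  case E: (word_e b) => [b'|] //= [<-] /=; have [e1 _ _ _] := word_e_change E.
  by rewrite ltnNge (_ : _ <= _)%N ?(IH _ E) //; lia.
split=> //; elim: s' s {ef} => //= S b IH s; case: ltnP => cmp.
  case E: SS_f => [T|] //= [<-] /=; have E' := (SS_efP i T S).2 E.
  have [_ p1 _] := SS_e_change E'.
  by rewrite (_ : _ <= _)%N ?E' //; lia.
case E: (word_f b) => [b'|] //= [<-] /=; have E' := IH _ E.
have [e1 _ _ _] := word_e_change E'.
by rewrite leqNgt (_ : _ < _)%N ?E' //; lia.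
Qed.

(** With the three statements that follow, this is the associativity of the tensor product: the
    tensor rule holds at any cut of a word. *)
Lemma word_eps_cat c b : word_eps (c ++ b) = (word_eps c + (word_eps b - word_phi c))%N.
Proof. by elim: c => [|S c IH] /=; lia. Qed.

Lemma word_phi_cat c b : word_phi (c ++ b) = (word_phi b + (word_phi c - word_eps b))%N.
Proof. by elim: c => [|S c IH] /=; rewrite ?word_eps_cat; lia. Qed.

Lemma word_e_cat c b : word_e (c ++ b) =
  if (word_eps b <= word_phi c)%N then omap (cat^~ b) (word_e c) else omap (cat c) (word_e b).
Proof.
elim: c => [|S c IH] /=.
  have [_ h2] := word_e_None b; case: leqP => // cmp; last by case: word_e.
  by rewrite h2 //; lia.
rewrite word_eps_cat IH; case: (leqP (word_eps b) (word_phi c)) => cmp.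
  have -> : (word_eps c + (word_eps b - word_phi c) = word_eps c)%N by lia.
  rewrite (leq_trans cmp (leq_addr _ _)).
  by case: leqP => _; [case: SS_e|case: word_e].
case: leqP => cmp'.
  rewrite (_ : _ <= _)%N; last by lia.
  by rewrite (_ : word_eps c <= letter_phi i S)%N; [case: SS_e|lia].
by rewrite leqNgt (_ : _ < _)%N /=; [case: word_e|lia].
Qed.

Lemma word_f_cat c b : word_f (c ++ b) =
  if (word_eps b < word_phi c)%N then omap (cat^~ b) (word_f c) else omap (cat c) (word_f b).
Proof.
elim: c => [|S c IH] /=; first by case: word_f.
rewrite word_eps_cat IH; case: (ltnP (word_eps b) (word_phi c)) => cmp.
  have -> : (word_eps c + (word_eps b - word_phi c) = word_eps c)%N by lia.
  rewrite (leq_trans cmp (leq_addr _ _)).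
  by case: ltnP => _; [case: SS_f|case: word_f].
case: ltnP => cmp'.
  rewrite (_ : _ < _)%N; last by lia.
  by rewrite (_ : word_eps c < letter_phi i S)%N; [case: SS_f|lia].
by rewrite ltnNge (_ : _ <= _)%N /=; [case: word_f|lia].
Qed.

End Words.

Section WordModels.

Variable n : nat.
Local Notation word := (seq (SS_elt n)).

Section Transport.

Variables (B : crystal_data n) (wd : B -> word).
Hypotheses (wd_e : forall i b, omap wd (cre i b) = word_e i (wd b))
  (wd_f : forall i b, omap wd (crf i b) = word_f i (wd b)).

Lemma cre_word_len i b : (cre i b = None -> word_eps i (wd b) = 0) /\
  (forall c, cre i b = Some c -> word_eps i (wd b) = (word_eps i (wd c)).+1).
Proof.
have E := wd_e i b; split=> [e0|c ec].
  by apply/word_e_None; rewrite -E e0.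
by rewrite ec /= in E; have [] := word_e_change (esym E).
Qed.

Lemma crf_word_len i b : (crf i b = None -> word_phi i (wd b) = 0) /\
  (forall c, crf i b = Some c -> word_phi i (wd b) = (word_phi i (wd c)).+1).
Proof.
have E := wd_f i b; split=> [e0|c ec].
  by apply/word_f_None; rewrite -E e0.
by rewrite ec /= in E; have [] := word_e_change ((word_efP i _ _).2 (esym E)).
Qed.

Lemma eps_word i b : eps i b = word_eps i (wd b).
Proof.
apply: (supremum_steps (len := fun b => word_eps i (wd b))) => [c|c d]; first exact: (cre_word_len i c).1.
exact: (cre_word_len i c).2.
Qed.

Lemma phi_word i b : phi i b = word_phi i (wd b).
Proof.
apply: (supremum_steps (len := fun b => word_phi i (wd b))) => [c|c d]; first exact: (crf_word_len i c).1.
exact: (crf_word_len i c).2.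
Qed.

Local Open Scope ring_scope.

(** String lengths and weights are those of the words. Distinct elements may carry the same word,
    whence the separate hypothesis that [cre] and [crf] are mutually inverse. *)
Lemma word_is_crystal :
  (forall i (b c : B), cre i b = Some c <-> crf i c = Some b) ->
  (forall (b : B) r, wt b 0 r = (word_count (wd b) r)%:Z) -> is_crystal B.
Proof.
move=> ef wtE; split=> //.
- move=> i b; split.
    by apply: (steps_ubound (len := fun b => word_eps i (wd b))) => [c|c d];
      [exact: (cre_word_len i c).1|exact: (cre_word_len i c).2].
  by apply: (steps_ubound (len := fun b => word_phi i (wd b))) => [c|c d];
    [exact: (crf_word_len i c).1|exact: (crf_word_len i c).2].
- move=> i b; rewrite eps_word phi_word !wtE.
  have /(congr1 (fun k : nat => k%:R : rat)) := word_balance i (wd b).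
  rewrite -!muln2 !(natrD, natrM) => E.
  rewrite rmorphB /= -!pmulrn (_ : (1 + 1)%:R = 2%:R :> rat) //.
  by move: E; lra.
move=> i b c ec; rewrite eps_word; apply/rowP => r; rewrite !mxE !wtE.
have E := wd_e i b; rewrite ec /= in E; have [_ _ _ /(_ r)] := word_e_change (esym E).
by case: odd; rewrite !mxE ?eqxx /=; lia.
Qed.

End Transport.

Lemma SS_phi i (A : SS n) : phi i A = letter_phi i A.
Proof.
apply: supremum_steps => [S|S T] /=; first by move/SS_f_None.
by move/SS_efP/SS_e_change => [].
Qed.

Fixpoint of_pow m : SS_pow n m -> word :=
  match m return SS_pow n m -> word with
  | 0 => fun=> [::]
  | m'.+1 => fun b => b.2 :: of_pow b.1
  end.

Fixpoint to_pow (A : SS_elt n) m (s : word) : SS_pow n m :=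
  match m return SS_pow n m with
  | 0 => tt
  | m'.+1 => (to_pow A m' (behead s), head A s)
  end.

Lemma to_powK A m s : size s = m -> of_pow (to_pow A m s) = s.
Proof. by elim: m s => [|m IH] [|T s] //= [/IH->]. Qed.

Lemma of_powK A m : cancel (@of_pow m) (to_pow A m).
Proof. by elim: m => [[]|m IH [b T]] //=; rewrite IH. Qed.

Lemma pow_ef m : (forall i (b : SS_pow n m), omap (@of_pow m) (cre i b) = word_e i (of_pow b)) /\
  (forall i (b : SS_pow n m), omap (@of_pow m) (crf i b) = word_f i (of_pow b)).
Proof.
elim: m => [//|m [IHe IHf]]; split=> i [b A] /=; rewrite SS_phi (eps_word IHe).
  by case: ifP => _; [case: SS_e|rewrite -IHe; case: cre].
by case: ifP => _; [case: SS_f|rewrite -IHf; case: crf].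
Qed.

Lemma pow_count m (b : SS_pow n m) r : (wt b 0 r = (word_count (of_pow b) r)%:Z)%R.
Proof.
elim: m b => [|m IH] /= b; first by rewrite mxE.
rewrite mxE IH addrC summxE PoszD; congr (_ + _)%R.
rewrite (eq_bigr (fun j => ((j == r)%:Z)%R)); last first.
  by move=> j _; rewrite mxE eqxx eq_sym /=; case: eqP.
case: (boolP (r \in val b.2)) => rb.
  by rewrite (bigD1 r) //= eqxx big1 ?addr0 // => j /andP[_ /negbTE->].
by rewrite big1 // => j jb; case: eqP => // jr; rewrite jr (negbTE rb) in jb.
Qed.

End WordModels.

(** * Reflections of truncated strings *)

Section Reflection.

Variables (n : nat) (i : 'I_n.-1).
Local Notation word := (seq (SS_elt n)).
Implicit Types (s t : word) (E : seq word).
Local Notation eps := (word_eps i).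
Local Notation phi := (word_phi i).
Local Notation lo s := (word_count s (ilo i)).
Local Notation hi s := (word_count s (ihi i)).

(* The second conjunct holds because the steps of a string alternately add
   [i+1] and remove [i]. *)
Definition string_related s t :=
  (eps s + phi s = eps t + phi t)%N /\
  (lo s + hi s + ~~ odd (eps s) = lo t + hi t + ~~ odd (eps t))%N /\
  forall r, r != ilo i -> r != ihi i -> word_count s r = word_count t r.

Lemma word_e_related s t : word_e i s = Some t -> string_related s t.
Proof.
move=> E; have [es pt _ cnt] := word_e_change E.
have ne := negbTE (ilo_neq_ihi i); have ne' : (ihi i == ilo i) = false by rewrite eq_sym.
split; [by rewrite es pt addSnnS|split].
  have := cnt (ilo i); have := cnt (ihi i); rewrite !eqxx ne ne' !andbT !andbF !addn0.
  by rewrite es /=; case: odd => /=; lia.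
by move=> r /negbTE rl /negbTE rh; have := cnt r; rewrite rl rh !andbF !addn0.
Qed.

Lemma string_related_sym s t : string_related s t -> string_related t s.
Proof. by case=> e [w o]; split; [|split=> // r rl rh; rewrite o]. Qed.

Lemma string_related_trans s t u : string_related s t -> string_related t u -> string_related s u.
Proof. by move=> [e [w o]] [e' [w' o']]; split; [lia|split=> [|r rl rh]; [lia|rewrite o ?o']]. Qed.

Variables (E : seq word) (c : nat).
Hypotheses (Ec : {in E, forall s, c <= eps s})
  (Ef : forall s t, s \in E -> word_f i s = Some t -> t \in E)
  (Ee : forall s t, s \in E -> word_e i s = Some t -> c <= eps t -> t \in E).

(** [E] is a union of strings deprived of their first [c] elements, so that moving down never leaves
    it. The values used later are [c = 0] and [c = 2]. *)
Lemma iter_word_f k s : s \in E -> k <= phi s -> exists t,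
  [/\ iter k (obind (word_f i)) (Some s) = Some t, t \in E, eps t = (eps s + k)%N,
      string_related s t & iter k (obind (word_e i)) (Some t) = Some s].
Proof.
move=> sE; elim: k => [|k IH] kp; first by exists s; split=> //; rewrite addn0.
have [t [ft tE et rt et']] := IH (ltnW kp).
have [pt _] := rt; case fu: (word_f i t) => [u|]; last by have := (word_f_None i t).1 fu; lia.
have eu := (word_efP i u t).2 fu; have [e1 _ _ _] := word_e_change eu.
exists u; split; [by rewrite iterS ft|exact: Ef fu|by rewrite e1 et addnS| |by rewrite iterSr /= eu].
exact: string_related_trans rt (string_related_sym (word_e_related eu)).
Qed.

Lemma iter_word_e k s : s \in E -> k + c <= eps s -> exists t,
  [/\ iter k (obind (word_e i)) (Some s) = Some t, t \in E, (eps t + k = eps s)%N,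
      string_related s t & iter k (obind (word_f i)) (Some t) = Some s].
Proof.
move=> sE; elim: k => [|k IH] kp; first by exists s; split=> //; rewrite addn0.
have [|t [ft tE et rt et']] := IH; first by lia.
case eu: (word_e i t) => [u|]; last by have := (word_e_None i t).1 eu; lia.
have fu := (word_efP i t u).1 eu; have [e1 _ _ _] := word_e_change eu.
exists u; split; [by rewrite iterS ft|apply: Ee tE eu _; lia|lia| |by rewrite iterSr /= fu].
exact: string_related_trans rt (word_e_related eu).
Qed.

(* The reflection of the [i]-string through [s], without its first [c] elements. *)
Definition reflect_word s : word := odflt s
  (if eps s <= phi s + c then iter (phi s + c - eps s) (obind (word_f i)) (Some s)
   else iter (eps s - c - phi s) (obind (word_e i)) (Some s)).

Lemma reflect_wordP s : s \in E -> [/\ reflect_word s \in E, eps (reflect_word s) = (phi s + c)%N,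
  string_related s (reflect_word s) & reflect_word (reflect_word s) = s].
Proof.
move=> sE; have cs := Ec sE; rewrite {1 2 3 5}/reflect_word; case: leqP => cmp.
  have [|t [ft tE et rt bt]] := @iter_word_f (phi s + c - eps s) s sE; first by lia.
  have [pt _] := rt; rewrite ft /=; split=> //; first by lia.
  rewrite /reflect_word; case: leqP => cmp'.
    by have -> : (phi t + c - eps t = 0)%N by [lia]; have k0 : (phi s + c - eps s = 0)%N by [lia];
      move: ft; rewrite k0 /= => -[].
  by have -> : (eps t - c - phi t = phi s + c - eps s)%N by [lia]; rewrite bt.
have [|t [ft tE et rt bt]] := @iter_word_e (eps s - c - phi s) s sE; first by lia.
have [pt _] := rt; rewrite ft /=; split=> //; first by lia.
rewrite /reflect_word (_ : eps t <= phi t + c); last by lia.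
by have -> : (phi t + c - eps t = eps s - c - phi s)%N by [lia]; rewrite bt.
Qed.

Lemma perm_reflect : uniq E -> perm_eq (map reflect_word E) E.
Proof.
move=> uE; have inj : {in E &, injective reflect_word}.
  by move=> s t /reflect_wordP[_ _ _ {2}<-] /reflect_wordP[_ _ _ {2}<-] ->.
apply: uniq_perm => //; first by rewrite map_inj_in_uniq.
move=> s; apply/mapP/idP => [[t tE ->]|sE]; first by have [] := reflect_wordP tE.
by have [rE _ _ rr] := reflect_wordP sE; exists (reflect_word s).
Qed.

(** The reflection exchanges [eps - c] with [phi]. For even [c] it keeps the parity of [eps], hence
    the total number of [i] and [i+1]; their difference then follows from [word_balance]. *)
Lemma reflect_count s : ~~ odd c -> s \in E ->
  [/\ odd (eps (reflect_word s)) = odd (eps s),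
      hi (reflect_word s) = (lo s + c./2)%N, (lo (reflect_word s) + c./2 = hi s)%N &
      forall r, r != ilo i -> r != ihi i -> word_count (reflect_word s) r = word_count s r].
Proof.
move=> oc sE; have [_ e' [p' [sum' o']] _] := reflect_wordP sE.
have b := word_balance i s; have b' := word_balance i (reflect_word s).
have cE : c = (c./2).*2 by rewrite -[LHS]odd_double_half (negbTE oc).
have par : odd (eps (reflect_word s)) = odd (eps s).
  rewrite e' oddD (negbTE oc) addbF; move/(congr1 odd): b.
  by rewrite !oddD !odd_double !addbF.
by rewrite par in sum'; split=> //; first [lia | by move=> r rl rh; rewrite o'].
Qed.

End Reflection.

(** * Generating functions of strings *)

Section StringSums.

Local Open Scope ring_scope.

Variables (n : nat) (K : comNzRingType).
Local Notation word := (seq (SS_elt n)).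
Implicit Types (s t : word) (E : seq word) (y : 'I_n -> K) (i : 'I_n.-1).

Definition word_wt y s : K := \prod_(r < n) y r ^+ word_count s r.

Lemma word_wt_split i y s : word_wt y s =
  y (ilo i) ^+ word_count s (ilo i) * y (ihi i) ^+ word_count s (ihi i)
    * \prod_(r | (r != ilo i) && (r != ihi i)) y r ^+ word_count s r.
Proof.
rewrite /word_wt (bigD1 (ilo i)) //= (bigD1 (ihi i)) ?mulrA //=.
by rewrite eq_sym ilo_neq_ihi.
Qed.

Lemma word_wt_swap i y s t (d : nat) :
  word_count t (ihi i) = (word_count s (ilo i) + d)%N ->
  (word_count t (ilo i) + d)%N = word_count s (ihi i) ->
  (forall r, r != ilo i -> r != ihi i -> word_count t r = word_count s r) ->
  y (ilo i) ^+ d * word_wt y t = y (ihi i) ^+ d * word_wt (swap_var i y) s.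
Proof.
move=> hE lE oE; rewrite !(word_wt_split i) !swap_varE hE -lE !exprD.
have -> : \prod_(r | (r != ilo i) && (r != ihi i)) swap_var i y r ^+ word_count s r =
    \prod_(r | (r != ilo i) && (r != ihi i)) y r ^+ word_count t r.
  by apply: eq_bigr => r /andP[rl rh]; rewrite swap_var_out // oE.
by ring.
Qed.

Lemma sum_word_swap i y D : uniq D ->
  (forall s t, s \in D -> word_f i s = Some t -> t \in D) ->
  (forall s t, s \in D -> word_e i s = Some t -> t \in D) ->
  \sum_(s <- D) word_wt (swap_var i y) s = \sum_(s <- D) word_wt y s.
Proof.
move=> uD Df De.
have De' s t : s \in D -> word_e i s = Some t -> (0 <= word_eps i t)%N -> t \in D.
  by move=> sD /(De _ _ sD).
have D0 : {in D, forall s, (0 <= word_eps i s)%N} by [].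
rewrite -[RHS](perm_big _ (perm_reflect D0 Df De' uD)) big_map.
apply: eq_big_seq => s sD.
have [_ h l o] := reflect_count D0 Df De' (isT : ~~ odd 0) sD.
by have := word_wt_swap y h l o; rewrite !expr0 !mul1r => ->.
Qed.

Lemma sum_string_interior i y E : uniq E ->
  {in E, forall s, (0 < word_eps i s)%N} ->
  (forall s t, s \in E -> word_f i s = Some t -> t \in E) ->
  (forall s t, s \in E -> word_e i s = Some t -> (0 < word_eps i t)%N -> t \in E) ->
  (y (ilo i) * (1 + y (ihi i))) * \sum_(s <- E) word_wt y s =
  (y (ihi i) * (1 + y (ilo i))) * \sum_(s <- E) word_wt (swap_var i y) s.
Proof.
move=> uE E0 Ef Ee.
pose Ev z := \sum_(s <- E | ~~ odd (word_eps i s)) word_wt z s.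
(* Each element with odd [eps] is paired with the next one down its string, which lacks the [i] that
   the former has. *)
have half z : \sum_(s <- E) word_wt z s = (1 + z (ilo i)) * Ev z.
  rewrite (bigID (fun s => odd (word_eps i s))) /= addrC mulrDl mul1r; congr (_ + _).
  pose nx s := odflt s (word_f i s).
  pose pv s := odflt s (word_e i s).
  have nxP s : s \in E -> odd (word_eps i s) ->
      [/\ nx s \in E, word_eps i (nx s) = (word_eps i s).+1, pv (nx s) = s & word_e i (nx s) = Some s].
    (* The string cannot end at an odd [eps]: with [phi] zero, [word_balance] makes [eps] even. *)
    move=> sE os; rewrite /nx; case fs: (word_f i s) => [t|] /=; last first.
      have := (word_f_None i s).1 fs; have := word_balance i s => + p0; rewrite p0.
      by move/(congr1 odd); rewrite !oddD os !odd_double.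
    have et := (word_efP i t s).2 fs; have [-> _ _ _] := word_e_change et.
    by split=> //; [exact: Ef fs|rewrite /pv et].
  have perm : perm_eq (map nx [seq s <- E | odd (word_eps i s)]) [seq s <- E | ~~ odd (word_eps i s)].
    apply: uniq_perm; [|exact: filter_uniq|].
      rewrite map_inj_in_uniq ?filter_uniq // => s t; rewrite !mem_filter.
      move=> /andP[os sE] /andP[ot tE] /(congr1 pv).
      by have [_ _ -> _] := nxP s sE os; have [_ _ -> _] := nxP t tE ot.
    move=> t; rewrite mem_filter; apply/mapP/andP => [[s]|[ot tE]].
      by rewrite mem_filter => /andP[os sE] ->; have [? -> _ _] := nxP s sE os; rewrite /= negbK.
    case es: (word_e i t) => [s|]; last by have := (word_e_None i t).1 es; have := E0 t tE; lia.
    have [e1 _ _ _] := word_e_change es; rewrite e1 /= negbK in ot.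
    exists s; last by rewrite /nx ((word_efP i t s).1 es).
    by rewrite mem_filter ot; apply: Ee tE es _; case: (word_eps i s) ot.
  rewrite /Ev -[X in _ = _ * X]big_filter -(perm_big _ perm) big_map mulr_sumr -big_filter.
  apply: eq_big_seq => s; rewrite mem_filter => /andP[os sE].
  have [_ e1 _ et] := nxP s sE os; have [_ _ _ cnt] := word_e_change et.
  rewrite /word_wt (bigD1 (ilo i)) //= [in RHS](bigD1 (ilo i)) //= mulrA -exprS.
  have := cnt (ilo i); rewrite e1 /= os eqxx (negbTE (ilo_neq_ihi i)) addn0 addn1 => ->.
  congr (_ * _); apply: eq_bigr => r /negbTE rl.
  by have := cnt r; rewrite e1 /= os rl /= !addn0 => ->.
suff sym : y (ilo i) * Ev y = y (ihi i) * Ev (swap_var i y).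
  rewrite !half !swap_varE.
  have -> : y (ilo i) * (1 + y (ihi i)) * ((1 + y (ilo i)) * Ev y) =
    (1 + y (ihi i)) * (1 + y (ilo i)) * (y (ilo i) * Ev y) by ring.
  by rewrite sym; ring.
(* Even and positive means at least 2, so the even part is reflected within strings truncated by
   [c = 2]; this exchanges the two counts up to one unit, absorbed by the factor [y (ilo i)]. *)
pose E2 := [seq s <- E | (2 <= word_eps i s)%N].
have memE2 s : (s \in E2) = (2 <= word_eps i s)%N && (s \in E) by rewrite mem_filter.
have EvE z : Ev z = \sum_(s <- E2 | ~~ odd (word_eps i s)) word_wt z s.
  rewrite /Ev big_filter_cond [LHS]big_seq_cond [RHS]big_seq_cond; apply: eq_bigl => s.
  by case: (boolP (s \in E)) => //= /E0; case: (word_eps i s) => [|[|k]].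
have uE2 : uniq E2 by apply: filter_uniq.
have E2c : {in E2, forall s, (2 <= word_eps i s)%N} by move=> s; rewrite memE2 => /andP[].
have E2f s t : s \in E2 -> word_f i s = Some t -> t \in E2.
  rewrite !memE2 => /andP[s2 sE] fs; rewrite (Ef s t sE fs) andbT.
  by have [e1 _ _ _] := word_e_change ((word_efP i t s).2 fs); lia.
have E2e s t : s \in E2 -> word_e i s = Some t -> (2 <= word_eps i t)%N -> t \in E2.
  by rewrite !memE2 => /andP[_ sE] es t2; rewrite t2; apply: Ee sE es _; lia.
rewrite !EvE -(perm_big _ (perm_reflect E2c E2f E2e uE2)) big_map !mulr_sumr.
rewrite [LHS]big_seq_cond [RHS]big_seq_cond.
have rc s sE := @reflect_count n i E2 2 E2c E2f E2e s isT sE.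
apply: eq_big => s; first by case: (boolP (s \in E2)) => //= sE; have [-> _ _ _] := rc s sE.
case/andP => sE _; have [_ h l o] := rc s sE.
by have := word_wt_swap y h l o; rewrite !expr1.
Qed.

End StringSums.

(** * Words below the top of a string, classified by their defect *)

Section HighestPrefix.

Variable n : nat.
Local Notation word := (seq (SS_elt n)).
Implicit Types (s t c b : word) (A : SS_elt n) (i : 'I_n.-1).

Definition hw_word s := [forall i, word_eps i s == 0].

(* A word that is not of highest weight has a longest highest weight prefix [c];
   the next factor [A] then contains some [i+1] although [phi i c = 0], and the
   defect is the largest such [i]. *)
Definition blocks c A i := (word_phi i c == 0) && (ihi i \in val A).

Definition last_block i c A :=
  [&& hw_word c, blocks c A i & [forall i' : 'I_n.-1, (i < i') ==> ~~ blocks c A i']].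

Definition defect i s :=
  has (fun k => if drop k s is A :: _ then last_block i (take k s) A else false) (iota 0 (size s)).

Lemma defectP i s : reflect (exists c A b, s = c ++ A :: b /\ last_block i c A) (defect i s).
Proof.
apply: (iffP hasP) => [[k _]|[c [A [b [-> lb]]]]].
  case ds: (drop k s) => [//|A b] lb; exists (take k s), A, b; split=> //.
  by rewrite -ds cat_take_drop.
exists (size c); first by rewrite mem_iota size_cat /=; lia.
by rewrite drop_size_cat // take_size_cat.
Qed.

Lemma hw_wordP s : reflect (forall i, word_eps i s = 0) (hw_word s).
Proof. by apply: (iffP forallP) => h i; apply/eqP. Qed.

Lemma letter_eps_gt0 i A : (0 < letter_eps i A) = (ihi i \in val A).
Proof. by rewrite /letter_eps; case: ifP => // _; case: ifP. Qed.

(** As [eps i c = 0], the number [phi i c] is even. A letter has [eps] at most 2, so it exceeds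
    [phi i c] only when the latter is 0. *)
Lemma hw_word_rcons c A : hw_word c -> hw_word (rcons c A) = [forall i, ~~ blocks c A i].
Proof.
move=> /hw_wordP hc; apply: eq_forallb => i.
rewrite -cats1 word_eps_cat hc add0n /= sub0n addn0 /blocks.
have := word_balance i c; rewrite hc add0n; have := letter_eps_gt0 i A.
have : letter_eps i A <= 2 by rewrite /letter_eps; case: ifP => // _; case: ifP.
move: (ihi i \in val A) => a le2 a0 bal.
have even : word_phi i c = 1 -> False by move=> p1; move: bal; rewrite p1; lia.
move: a a0 => [] a0.
  by rewrite andbT; case: (word_phi i c) even => [|[|k]] ev /=; [lia|case: (ev erefl)|lia].
by rewrite andbF; lia.
Qed.

Lemma defect_exists c b : hw_word c -> ~~ hw_word (c ++ b) -> exists i, defect i (c ++ b).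
Proof.
elim: b c => [|A b IH] c hc; first by rewrite cats0 hc.
move=> nh; case: (boolP (hw_word (rcons c A))) => [hcA|].
  by rewrite -cat_rcons in nh *; apply: IH.
rewrite hw_word_rcons // negb_forall => /existsP[i0]; rewrite negbK => bl0.
case: (@arg_maxnP _ i0 (blocks c A) val bl0) => i bl maxi; exists i.
apply/defectP; exists c, A, b; split=> //; rewrite /last_block hc bl.
by apply/forallP => i'; apply/implyP => ii'; apply/negP => /maxi /=; lia.
Qed.

Lemma defect_eps i s : defect i s -> 0 < word_eps i s.
Proof.
case/defectP => c [A [b [-> /and3P[_ /andP[/eqP p0 hA] _]]]].
by rewrite word_eps_cat p0 /=; move: hA; rewrite -letter_eps_gt0; lia.
Qed.

(** With two prefixes of different lengths, the factor that blocks the shorter one would make [eps]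
    positive on the longer one, against its highest weight. Equal lengths give the same prefix, and
    the index is its largest block. *)
Lemma defect_unique i j s : defect i s -> defect j s -> i = j.
Proof.
case/defectP => c [A [b [-> /and3P[/hw_wordP hc blc /forallP mc]]]].
case/defectP => d [B [e [eq /and3P[/hw_wordP hd bld /forallP md]]]].
have long (u v : word) k X Y (p q : word) : u ++ X :: p = v ++ Y :: q -> size u < size v ->
    word_phi k u = 0 -> ihi k \in val X -> word_eps k v = 0 -> False.
  move=> uv lt pu kX; have [r vE] : exists r, v = u ++ X :: r.
    exists (drop (size u).+1 v); have := congr1 (take (size v)) uv.
    rewrite (take_size_cat _ (erefl (size v))) take_cat ltnNge (ltnW lt) /= => <-.
    have -> : size v - size u = (size v - (size u).+1).+1 by lia.
    by rewrite /= drop_cat ltnNge leqnSn /= subSn // subnn /= drop0.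
  by rewrite vE word_eps_cat pu /=; move: kX; rewrite -letter_eps_gt0; lia.
case/andP: (blc) => /eqP pc hA; case/andP: (bld) => /eqP pd hB.
case: (ltngtP (size c) (size d)) => [lt|lt|sz].
- by case: (long _ _ i _ _ _ _ eq lt pc hA (hd i)).
- by case: (long _ _ j _ _ _ _ (esym eq) lt pd hB (hc j)).
have [cd [AB _]] : c = d /\ (A = B /\ b = e) by move/eqP: eq; rewrite eqseq_cat // => /andP[/eqP-> /eqP[-> ->]].
rewrite cd AB in blc mc *.
case: (ltngtP i j) => [lt|lt|/val_inj//].
  by have /implyP/(_ lt) := mc j; rewrite bld.
by have /implyP/(_ lt) := md i; rewrite blc.
Qed.

(** A change at [i] or [i+1] affects blocks at indices [i-1] and [i] only. Choosing the largest
    block in [last_block] makes the former harmless. *)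
Lemma last_block_congr i c A (B : SS_elt n) : last_block i c A -> ihi i \in val B ->
  (forall r, r != ilo i -> r != ihi i -> (r \in val B) = (r \in val A)) -> last_block i c B.
Proof.
case/and3P => hc /andP[p0 hA] /forallP mx hB same.
rewrite /last_block hc /blocks p0 hB; apply/forallP => i'; apply/implyP => ii'.
have := mx i'; rewrite ii' /blocks same // -val_eqE /=; lia.
Qed.

(** Since [phi i c = 0], the operator acts on [A] or later. On [A], which contains [i+1], it can
    only remove [i]. *)
Lemma defect_f i s t : defect i s -> word_f i s = Some t -> defect i t.
Proof.
case/defectP => c [A [b [-> lb]]].
have /and3P[_ /andP[/eqP p0 hA] _] := lb.
rewrite word_f_cat p0 ltn0 /=; case: ltnP => cmp; last first.
  by case: word_f => [b'|] //= [<-]; apply/defectP; exists c, A, b'.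
have := SS_f_spec i A; case: SS_f => [B|] //= + [<-].
rewrite hA => /andP[lA /eqP BE]; apply/defectP; exists c, B, b; split=> //.
apply: last_block_congr lb _ _ => [|r rl rh]; rewrite /= BE !inE ?rl //.
by rewrite hA eq_sym ilo_neq_ihi.
Qed.

(** The only danger is that [A] loses [i+1], going from [{i,i+1}] to [{i}]. The tensor rule then
    gives [eps i b <= 1], the new [A] has [phi] equal to 2, and [eps i t] would be 0. *)
Lemma defect_e i s t : defect i s -> word_e i s = Some t -> 0 < word_eps i t -> defect i t.
Proof.
case/defectP => c [A [b [-> lb]]].
have /and3P[/hw_wordP hc /andP[/eqP p0 hA] _] := lb.
rewrite word_e_cat p0 leqn0 /= addn_eq0.
rewrite -[letter_eps i A == 0]negbK -lt0n letter_eps_gt0 hA /=.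
case: (leqP (word_eps i b)) => cmp; last by case: (word_e i b) => [b'|] //= [<-] _; apply/defectP; exists c, A, b'.
have := SS_e_spec i A; case: SS_e => [B|] //= + [<-]; rewrite word_eps_cat hc p0 /= subn0 add0n.
case/andP => _ /eqP BE e0; apply/defectP; exists c, B, b; split=> //.
apply: last_block_congr lb _ _.
  move: e0 cmp; rewrite /letter_eps /letter_phi /= BE hA.
  case: (boolP (ilo i \in val A)) => lA; rewrite !inE ?eqxx ?hA ?orbT //=.
  by rewrite ilo_neq_ihi (lA : ilo i \in sval A) /=; lia.
by move=> r rl rh; rewrite /= BE; case: ifP => _; rewrite !inE ?rh // (negbTE rl).
Qed.

Local Open Scope ring_scope.

Lemma sum_defect (V : nmodType) (D : seq word) (G : word -> V) :
  \sum_(s <- D) G s = \sum_(s <- D | hw_word s) G s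
    + \sum_(i < n.-1) \sum_(s <- D | defect i s) G s.
Proof.
rewrite (bigID hw_word) /=; congr (_ + _).
rewrite (exchange_big_dep (fun s => ~~ hw_word s)) /=; last first.
  by move=> i s _ /defect_eps e0; apply/negP => /hw_wordP h; rewrite h in e0.
apply: eq_bigr => s nh; have [i di] := @defect_exists [::] s (introT (hw_wordP [::]) (fun=> erefl)) nh.
by rewrite (big_pred1 i) // => j; apply/idP/eqP => [/defect_unique/(_ di)|->].
Qed.

Lemma stable_alternant (K : comNzRingType) (D : seq word) (x : 'I_n -> K) : uniq D ->
  (forall i s t, s \in D -> word_f i s = Some t -> t \in D) ->
  (forall i s t, s \in D -> word_e i s = Some t -> t \in D) ->
  (\sum_(s <- D) word_wt x s) * alternant (fun=> 1) x =
  \sum_(s <- D | hw_word s) alternant (fun y => word_wt y s) x.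
Proof.
move=> uD Df De; pose g y := \sum_(s <- D) word_wt y s : K.
rewrite -/(g x) -alternant_sym; last first.
  by move=> i s; apply: sum_word_swap => //; [apply: Df|apply: De].
have -> : g = fun y => \sum_(s <- D | hw_word s) word_wt y s
    + \sum_(i < n.-1) \sum_(s <- D | defect i s) word_wt y s.
  by apply: boolp.funext => y; rewrite /g sum_defect.
rewrite alternantD alternant_sum alternant_sum [X in _ + X]big1 ?addr0 // => i _.
apply: (alternant0 (i := i)) => s y; rewrite -[in LHS]big_filter -[in RHS]big_filter.
apply: sum_string_interior; first exact: filter_uniq.
- by move=> u; rewrite mem_filter => /andP[/defect_eps].
- move=> u v; rewrite !mem_filter => /andP[du uE] fu.
  by rewrite (defect_f du fu) (Df i u v).
- move=> u v; rewrite !mem_filter => /andP[du uE] eu v0.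
  by rewrite (defect_e du eu v0) (De i u v).
Qed.

End HighestPrefix.

Lemma sorted_update (T : Type) (e : rel T) s1 x y s2 : sorted e (s1 ++ x :: s2) ->
  (forall s z, s1 = rcons s z -> e z x -> e z y) ->
  (forall z s, s2 = z :: s -> e x z -> e y z) -> sorted e (s1 ++ y :: s2).
Proof.
rewrite !sorted_cat_cons => /andP[s1x xs2] left right; apply/andP; split.
  case/lastP: s1 s1x left => // s z; rewrite -!cats1 -!catA !sorted_cat_cons /= !andbT.
  by move=> /andP[-> zx] left; apply: (left s z) => //; rewrite cats1.
by case: s2 xs2 right => //= z s /andP[xz ->] /(_ z s erefl xz) ->.
Qed.

Lemma nth_update (T : Type) (x0 x y : T) s1 s2 r :
  nth x0 (s1 ++ y :: s2) r = if r == size s1 then y else nth x0 (s1 ++ x :: s2) r.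
Proof.
rewrite !nth_cat; case: (ltngtP r (size s1)) => [|lt|->]; rewrite ?subnn //.
by case: (r - size s1) (subn_gt0 (size s1) r) => //; rewrite lt.
Qed.

Lemma sorted_adjacent (T : Type) (e : rel T) s1 x y s2 : sorted e (s1 ++ [:: x, y & s2]) -> e x y.
Proof. by rewrite sorted_cat_cons => /andP[_ /= /andP[]]. Qed.

(** * Set-valued tableaux *)

Section SetValuedTableaux.

Variable n : nat.
Local Notation word := (seq (SS_elt n)).
Implicit Types (s t c b d : word) (A B X Y : SS_elt n) (i : 'I_n.-1) (cols : seq word).

Definition set_lt A B := [forall x in val A, [forall y in val B, x < y]].
Definition set_le A B := [forall x in val A, [forall y in val B, x <= y]].

Lemma set_ltP A B : reflect {in val A & val B, forall x y : 'I_n, x < y} (set_lt A B).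
Proof.
apply: (iffP forall_inP) => [h x y xA yB|h x xA]; first by move/forall_inP: (h x xA); apply.
by apply/forall_inP => y yB; apply: h.
Qed.

Lemma set_leP A B : reflect {in val A & val B, forall x y : 'I_n, x <= y} (set_le A B).
Proof.
apply: (iffP forall_inP) => [h x y xA yB|h x xA]; first by move/forall_inP: (h x xA); apply.
by apply/forall_inP => y yB; apply: h.
Qed.

Lemma SS_nonempty A : exists x, x \in val A.
Proof. by apply/set0Pn; case: A. Qed.

Lemma set_lt_trans : transitive set_lt.
Proof.
move=> B A X /set_ltP AB /set_ltP BX; apply/set_ltP => x y xA yX.
by have [z zB] := SS_nonempty B; apply: ltn_trans (AB _ _ xA zB) (BX _ _ zB yX).
Qed.

(* Columns are listed from right to left, and each column from top to bottom. *)
Definition col_le (A0 : SS_elt n) : rel word := fun d d' =>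
  (size d <= size d') && all (fun r => set_le (nth A0 d' r) (nth A0 d r)) (iota 0 (size d)).

Definition set_tableau (A0 : SS_elt n) cols :=
  all (sorted set_lt) cols && sorted (col_le A0) cols.

(** The signature rule: one factor changes, and the two inequalities record why neither a later nor
    an earlier factor was selected. The tableau arguments rest on them. *)
Lemma word_f_split i s t : word_f i s = Some t -> exists c A b B,
  [/\ s = c ++ A :: b, t = c ++ B :: b, SS_f i A = Some B, word_eps i b < letter_phi i A &
      word_phi i c <= word_eps i (A :: b)].
Proof.
elim: s t => //= A b IH t; case: ltnP => cmp.
  by case E: SS_f => [B|] //= [<-]; exists [::], A, b, B.
case E: (word_f i b) => [b'|] //= [<-].
have [c [A' [b1 [B [bE b'E AB lt le]]]]] := IH _ E.
exists (A :: c), A', b1, B; rewrite bE b'E; split=> //=.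
by move: cmp le; rewrite bE word_eps_cat /=; lia.
Qed.

Lemma word_e_split i s t : word_e i s = Some t -> exists c A b B,
  [/\ s = c ++ A :: b, t = c ++ B :: b, SS_e i A = Some B, word_eps i b <= letter_phi i A &
      word_phi i c < word_eps i (A :: b)].
Proof.
elim: s t => //= A b IH t; case: leqP => cmp.
  case E: SS_e => [B|] //= [<-]; exists [::], A, b, B; split=> //=.
  by have [-> _ _] := SS_e_change E; rewrite addSn.
case E: (word_e i b) => [b'|] //= [<-].
have [c [A' [b1 [B [bE b'E AB lt le]]]]] := IH _ E.
exists (A :: c), A', b1, B; rewrite bE b'E; split=> //=.
by move: cmp le; rewrite bE word_eps_cat /=; lia.
Qed.

Lemma flatten_split cols c A b : flatten cols = c ++ A :: b -> exists C1 d1 d2 C2,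
  [/\ cols = C1 ++ (d1 ++ A :: d2) :: C2, c = flatten C1 ++ d1 & b = d2 ++ flatten C2].
Proof.
elim: cols c => [|d cols IH] c /=; first by case: c.
move=> E; case: (ltnP (size c) (size d)) => lt.
  exists [::], c, (drop (size c).+1 d), cols; split=> //=.
    rewrite -{1}(cat_take_drop (size c) d) (drop_nth A lt).
    have tE : take (size c) d = c.
      have := congr1 (take (size c)) E.
      by rewrite [RHS]take_size_cat // takel_cat // ltnW.
    have nE : nth A d (size c) = A.
      have := congr1 (fun s => nth A s (size c)) E.
      by rewrite !nth_cat lt ltnn subnn.
    by rewrite tE nE.
  have := congr1 (drop (size c).+1) E.
  rewrite -[in RHS]cat_rcons [RHS]drop_size_cat ?size_rcons // => <-.
  rewrite drop_cat; case: (ltngtP (size c).+1 (size d)) => // e; first by lia.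
  by rewrite e subnn drop0 drop_size.
have [c' cE] : exists c', c = d ++ c'.
  exists (drop (size d) c); have := congr1 (take (size d)) E.
  by rewrite [LHS]take_size_cat // takel_cat // => {1}->; rewrite cat_take_drop.
move: E; rewrite cE -catA => /eqP; rewrite eqseq_cat // eqxx /= => /eqP/IH.
move=> [C1 [d1 [d2 [C2 [-> -> ->]]]]]; exists (d :: C1), d1, d2, C2.
by split=> //=; rewrite catA.
Qed.

Lemma word_phi_no i s : (forall X, X \in s -> ilo i \notin val X) -> word_phi i s = 0.
Proof.
elim: s => //= A s IH h; rewrite IH; last by move=> X Xs; apply: h; rewrite inE Xs orbT.
by rewrite /letter_phi (negbTE (h A (mem_head _ _))).
Qed.

Lemma word_eps_no i s : (forall X, X \in s -> ihi i \notin val X) -> word_eps i s = 0.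
Proof.
elim: s => //= A s IH h; rewrite IH; last by move=> X Xs; apply: h; rewrite inE Xs orbT.
by rewrite /letter_eps (negbTE (h A (mem_head _ _))).
Qed.

Variable A0 : SS_elt n.

(** Only the four neighbours of a box matter. Columns run from right to left, so the right neighbour
    is in the last column of [C1] and the left one in the first of [C2]. *)
Lemma set_tableau_update C1 d1 A B d2 C2 :
  set_tableau A0 (C1 ++ (d1 ++ A :: d2) :: C2) ->
  (forall d X, d1 = rcons d X -> set_lt X A -> set_lt X B) ->
  (forall Y d, d2 = Y :: d -> set_lt A Y -> set_lt B Y) ->
  (forall C R, C1 = rcons C R -> size d1 < size R ->
     set_le A (nth A0 R (size d1)) -> set_le B (nth A0 R (size d1))) ->
  (forall L C, C2 = L :: C -> set_le (nth A0 L (size d1)) A -> set_le (nth A0 L (size d1)) B) ->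
  set_tableau A0 (C1 ++ (d1 ++ B :: d2) :: C2).
Proof.
move=> /andP[col row] above below right left; apply/andP; split.
  move: col; rewrite !all_cat /= => /and3P[-> col ->]; rewrite andbT.
  exact: sorted_update col above below.
apply: sorted_update row _ _ => [C R CE /andP[sz /allP le]|L C CE /andP[sz /allP le]].
  apply/andP; split; first by move: sz; rewrite !size_cat.
  apply/allP => r rR; rewrite (nth_update A0 A); have := le r rR.
  case: eqP rR => // ->; rewrite mem_iota => /= rR; rewrite nth_cat ltnn subnn /=.
  exact: right CE rR.
apply/andP; split; first by move: sz; rewrite !size_cat.
apply/allP => r rR; rewrite (nth_update A0 A).
have := le r; rewrite !mem_iota /= !size_cat /= in rR * => /(_ rR).
by case: eqP => // ->; rewrite nth_cat ltnn subnn /=; apply: left CE.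
Qed.

Lemma col_tail d1 A d2 B j : sorted set_lt (d1 ++ A :: d2) -> B \in d2 ->
  j \in val A -> forall y, y \in val B -> (j < y)%N.
Proof.
rewrite sorted_cat_cons => /andP[_]; rewrite (path_sortedE set_lt_trans) => /andP[/allP h _].
by move=> /h/set_ltP AB jA y yB; apply: AB.
Qed.

Lemma col_head d1 A d2 B j : sorted set_lt (d1 ++ A :: d2) -> B \in d1 ->
  j \in val A -> forall y, y \in val B -> (y < j)%N.
Proof.
rewrite sorted_cat_cons => /andP[+ _]; rewrite (sorted_pairwise set_lt_trans) pairwise_rcons.
by move=> /andP[/allP h _] /h/set_ltP BA jA y yB; apply: BA.
Qed.

Lemma letter_phi2 i A : ilo i \in val A -> ihi i \notin val A -> letter_phi i A = 2.
Proof. by rewrite /letter_phi => -> /negbTE->. Qed.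

Lemma letter_eps2 i A : ihi i \in val A -> ilo i \notin val A -> letter_eps i A = 2.
Proof. by rewrite /letter_eps => -> /negbTE->. Qed.

Lemma set_lt_sub A A' B B' : {subset val A' <= val A} -> {subset val B' <= val B} ->
  set_lt A B -> set_lt A' B'.
Proof. by move=> sA sB /set_ltP AB; apply/set_ltP => x y /sA xA /sB; apply: AB. Qed.

Lemma set_le_sub A A' B B' : {subset val A' <= val A} -> {subset val B' <= val B} ->
  set_le A B -> set_le A' B'.
Proof. by move=> sA sB /set_leP AB; apply/set_leP => x y /sA xA /sB; apply: AB. Qed.

Lemma set_tableau_shrink C1 d1 A B d2 C2 : {subset val B <= val A} ->
  set_tableau A0 (C1 ++ (d1 ++ A :: d2) :: C2) -> set_tableau A0 (C1 ++ (d1 ++ B :: d2) :: C2).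
Proof.
move=> sBA tab; apply: set_tableau_update tab _ _ _ _ => [d X _|Y d _|C R _ _|L C _].
- exact: set_lt_sub.
- exact: set_lt_sub.
- exact: set_le_sub.
- exact: set_le_sub.
Qed.

Lemma word_eps_gt0P i s : 0 < word_eps i s -> exists2 X, X \in s & ihi i \in val X.
Proof.
move=> e0; have [h|/hasPn no] := boolP (has (fun X => ihi i \in val X) s); first exact/hasP.
by rewrite word_eps_no in e0.
Qed.

Lemma word_phi_gt0P i s : 0 < word_phi i s -> exists2 X, X \in s & ilo i \in val X.
Proof.
move=> e0; have [h|/hasPn no] := boolP (has (fun X => ilo i \in val X) s); first exact/hasP.
by rewrite word_phi_no in e0.
Qed.

Lemma split_nth (s : word) q : q < size s -> s = take q s ++ nth A0 s q :: drop q.+1 s.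
Proof. by move=> qs; rewrite -drop_nth // cat_take_drop. Qed.

(* Adding [i+1] to a box that contains [i] could only conflict with the box
   below it or with the box to its right; in both cases the signature rule
   would select another factor. *)
Lemma set_tableau_f i cols t : set_tableau A0 cols -> word_f i (flatten cols) = Some t ->
  exists2 cols', set_tableau A0 cols' & t = flatten cols' /\ shape cols' = shape cols.
Proof.
move=> tab /word_f_split[c [A [b [B [/flatten_split[C1 [d1 [d2 [C2 [E cE bE]]]]] tE fA lt le]]]]].
exists (C1 ++ (d1 ++ B :: d2) :: C2); last first.
  by rewrite tE E cE bE !flatten_cat /= -!catA /= /shape !map_cat /= !size_cat.
rewrite {}E in tab; case/andP: (tab) => /allP cols_sorted row.
have scol : sorted set_lt (d1 ++ A :: d2) by apply: cols_sorted; rewrite mem_cat mem_head orbT.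
have := SS_f_spec i A; rewrite fA => /andP[lA /eqP BE].
have [hA|hA] := boolP (ihi i \in val A).
  by apply: set_tableau_shrink tab => x; rewrite /= BE hA !inE => /andP[].
rewrite (negbTE hA) in BE.
have memB x : x \in val B -> x = ihi i \/ x \in val A.
  by rewrite /= BE !inE => /orP[/eqP|]; auto.
have phiA := letter_phi2 lA hA.
have epsA : letter_eps i A = 0 by rewrite /letter_eps (negbTE hA).
rewrite /= epsA phiA in lt le; have phic : word_phi i c = 0 by lia.
have d1lt X : X \in d1 -> ihi i \notin val X.
  move=> Xd; apply/negP => hX; have := col_head scol Xd lA hX; rewrite /=; clear; lia.
have d2gt X : X \in d2 -> ilo i \notin val X.
  by move=> Xd; apply/negP => lX; have := col_tail scol Xd lA lX; rewrite /=; clear; lia.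
(* A box [{i+1}] below [A] gives [eps i b >= 2]. *)
have no_below q : q < size d2 -> ihi i \notin val (nth A0 d2 q).
  move=> qd; apply/negP => hq; have lq := d2gt _ (mem_nth A0 qd).
  have e2 := letter_eps2 hq lq; move: lt; rewrite bE (split_nth qd) -catA word_eps_cat /= e2.
  rewrite (@word_phi_no i (take q d2)); last by move=> X /mem_take; apply: d2gt.
  by clear; lia.
apply: set_tableau_update tab _ _ _ _ => [d X _|Y d d2E|C R C1E rR|L C _].
- move=> /set_ltP XA; apply/set_ltP => x y xX /memB[->|]; last exact: XA.
  by have := XA _ _ xX lA; rewrite /=; clear; lia.
- move=> /set_ltP AY; apply/set_ltP => x y /memB[->|] yY; last exact: AY.
  have := no_below 0; rewrite d2E /= => /(_ isT) hY.
  have := AY _ _ lA yY => /= ly; rewrite ltn_neqAle ly andbT.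
  by apply: contraNneq hY => yE; rewrite (_ : ihi i = y) //; apply: val_inj.
- move=> /set_leP AT; apply/set_leP => x y /memB[->|] yT; last exact: AT.
  have := AT _ _ lA yT => /= ly; rewrite ltn_neqAle ly andbT.
  apply/eqP => yE; have {y yE yT ly} lT : ilo i \in val (nth A0 R (size d1)).
    by rewrite (_ : ilo i = y) //; apply: val_inj.
  have cle : col_le A0 R (d1 ++ A :: d2).
    by have row1 := row; rewrite C1E cat_rcons in row1; apply: sorted_adjacent row1.
  (* [T], right of [A], contains [i]. Since [phi i c = 0], this [i] is cancelled by an [i+1] read
     later, necessarily in column [R] below [T]. The box to the left of that one is below [A], with
     entries above [i] and at most [i+1]: excluded by [no_below]. *)
  set T := nth A0 R (size d1) in AT lT.
  set M := drop (size d1).+1 R ++ d1.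
  have phiM : word_phi i (T :: M) = 0.
    move: phic; rewrite cE C1E -cats1 flatten_cat /= cats0 {1}(split_nth rR) -!catA.
    rewrite cat_cons -/T -/M => /eqP; rewrite word_phi_cat addn_eq0 => /andP[+ _].
    by rewrite word_phi_cat addn_eq0 => /andP[/eqP h _]; exact: h.
  have /word_eps_gt0P[X XM hX] : 0 < word_eps i M.
    by move: phiM; rewrite /= /letter_phi lT; case: ifP => _; clear; lia.
  have {XM} XR : X \in drop (size d1).+1 R.
    by move: XM; rewrite mem_cat => /orP[//|/d1lt]; rewrite hX.
  pose q := index X (drop (size d1).+1 R).
  have qlt : q < size (drop (size d1).+1 R) by rewrite index_mem.
  have Xq : nth A0 R ((size d1).+1 + q) = X by rewrite -nth_drop nth_index.
  case/andP: cle => szR /allP leR; rewrite size_drop in qlt.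
  have := leR ((size d1).+1 + q); rewrite mem_iota Xq /= => /(_ ltac:(clear -qlt; lia))/set_leP leX.
  have qd2 : q < size d2 by move: szR qlt; rewrite size_cat /=; clear; lia.
  have colq : nth A0 (d1 ++ A :: d2) ((size d1).+1 + q) = nth A0 d2 q.
    by rewrite nth_cat ltnNge leqW ?leq_addr //= addSnnS addKn.
  rewrite colq in leX; have [a aq] := SS_nonempty (nth A0 d2 q).
  have := no_below q qd2; apply/negP; rewrite negbK (_ : ihi i = a) //.
  have := leX _ _ aq hX; have := col_tail scol (mem_nth A0 qd2) lA aq => /=.
  by move=> la ah; apply: val_inj => /=; move: la ah; clear; lia.
- move=> /set_leP LA; apply/set_leP => x y xL /memB[->|]; last exact: LA.
  by have := LA _ _ xL lA; rewrite /=; clear; lia.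
Qed.

(* Dually, adding [i] to a box that contains [i+1] could only conflict with the
   box above it or with the box to its left. *)
Lemma set_tableau_e i cols t : set_tableau A0 cols -> word_e i (flatten cols) = Some t ->
  exists2 cols', set_tableau A0 cols' & t = flatten cols' /\ shape cols' = shape cols.
Proof.
move=> tab /word_e_split[c [A [b [B [/flatten_split[C1 [d1 [d2 [C2 [E cE bE]]]]] tE eA le lt]]]]].
exists (C1 ++ (d1 ++ B :: d2) :: C2); last first.
  by rewrite tE E cE bE !flatten_cat /= -!catA /= /shape !map_cat /= !size_cat.
rewrite {}E in tab; case/andP: (tab) => /allP cols_sorted row.
have scol : sorted set_lt (d1 ++ A :: d2) by apply: cols_sorted; rewrite mem_cat mem_head orbT.
have := SS_e_spec i A; rewrite eA => /andP[hA /eqP BE].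
have [lA|lA] := boolP (ilo i \in val A).
  by apply: set_tableau_shrink tab => x; rewrite /= BE lA !inE => /andP[].
rewrite (negbTE lA) in BE.
have memB x : x \in val B -> x = ilo i \/ x \in val A.
  by rewrite /= BE !inE => /orP[/eqP|]; auto.
have epsA := letter_eps2 hA lA.
have phiA : letter_phi i A = 0 by rewrite /letter_phi (negbTE lA).
rewrite /= epsA phiA in lt le; have epsb : word_eps i b = 0 by lia.
have phic : word_phi i c <= 1 by lia.
have d1lt X : X \in d1 -> ihi i \notin val X.
  by move=> Xd; apply/negP => hX; have := col_head scol Xd hA hX; rewrite /=; clear; lia.
have d2gt X : X \in d2 -> ilo i \notin val X.
  by move=> Xd; apply/negP => lX; have := col_tail scol Xd hA lX; rewrite /=; clear; lia.
(* A box [{i}] above [A] gives [phi i c >= 2]. *)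
have no_above q : q < size d1 -> ilo i \notin val (nth A0 d1 q).
  move=> qd; apply/negP => lq; have hq := d1lt _ (mem_nth A0 qd).
  have p2 := letter_phi2 lq hq; move: phic; rewrite cE (split_nth qd) !word_phi_cat /= p2.
  rewrite (@word_eps_no i (drop q.+1 d1)); last by move=> X /mem_drop; apply: d1lt.
  by clear; lia.
apply: set_tableau_update tab _ _ _ _ => [d X d1E|Y d _|C R _ _|L C C2E].
- move=> /set_ltP XA; apply/set_ltP => x y xX /memB[->|]; last exact: XA.
  have := no_above (size d); rewrite d1E size_rcons nth_rcons ltnn eqxx => /(_ (ltnSn _)) hX.
  have := XA _ _ xX hA => /=; rewrite ltnS => xl; rewrite ltn_neqAle xl andbT.
  by apply: contraNneq hX => xE; rewrite (_ : ilo i = x) //; apply: val_inj.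
- move=> /set_ltP AY; apply/set_ltP => x y /memB[->|] yY; last exact: AY.
  by have := AY _ _ hA yY; rewrite /=; clear; lia.
- move=> /set_leP AT; apply/set_leP => x y /memB[->|] yT; last exact: AT.
  by have := AT _ _ hA yT; rewrite /=; clear; lia.
move=> /set_leP LA; apply/set_leP => x y xL /memB[->|]; last exact: LA.
have := LA _ _ xL hA => /=; rewrite leq_eqVlt ltnS => /orP[/eqP xE|//]; exfalso.
have cle : col_le A0 (d1 ++ A :: d2) L by have row1 := row; rewrite C2E in row1; apply: sorted_adjacent row1.
case/andP: cle => szL /allP leL; rewrite size_cat /= in szL leL.
have rL : size d1 < size L by move: szL; clear; lia.
set T := nth A0 L (size d1) in LA xL *.
have hT : ihi i \in val T by rewrite (_ : ihi i = x) //; apply: val_inj.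
(* [T], left of [A], contains [i+1]. Since [eps i b = 0], it is cancelled by an [i] read earlier,
   necessarily in column [L] above [T]. The box to the right of that one is above [A] and consists
   of [i]: excluded by [no_above]. *)
set M := d2 ++ take (size d1) L.
have epsM : word_eps i (M ++ T :: drop (size d1).+1 L) = 0.
  move: epsb; rewrite bE C2E /= {1}(split_nth rL) -/T -catA cat_cons catA -/M.
  by rewrite -cat_cons catA => /eqP; rewrite word_eps_cat addn_eq0 => /andP[/eqP h _]; exact: h.
have /word_phi_gt0P[X XM lX] : 0 < word_phi i M.
  by move: epsM; rewrite word_eps_cat /= /letter_eps hT; case: ifP => _; clear; lia.
have {XM} XL : X \in take (size d1) L.
  by move: XM; rewrite mem_cat => /orP[/d2gt|//]; rewrite lX.
pose q := index X (take (size d1) L).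
have qlt : q < size d1 by rewrite -(size_takel (ltnW rL)) index_mem.
have Xq : nth A0 L q = X by rewrite -(nth_take _ qlt) nth_index.
have := leL q; rewrite mem_iota Xq /= nth_cat qlt => /(_ ltac:(clear -qlt; lia))/set_leP leX.
have [a aq] := SS_nonempty (nth A0 d1 q).
have := no_above q qlt; apply/negP; rewrite negbK (_ : ilo i = a) //.
have := leX _ _ lX aq; have := col_head scol (mem_nth A0 qlt) hA aq => /=.
by move=> la ah; apply: val_inj => /=; move: la ah; clear; lia.
Qed.

End SetValuedTableaux.

(** * The unique highest weight tableau of a shape *)

Section HighestTableau.

Variables (n : nat) (r0 : 'I_n).
Local Notation word := (seq (SS_elt n)).
Implicit Types (s t c b d : word) (A B X Y : SS_elt n) (i : 'I_n.-1) (cols : seq word) (h : nat) (hs : seq nat).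

Lemma singleton_subproof (r : 'I_n) : [set r] != set0.
Proof. by apply/set0Pn; exists r; rewrite inE. Qed.
Definition singleton r : SS_elt n := exist _ [set r] (singleton_subproof r).

(** For [q >= n] the value falls back on [r0]; columns of height at most [n] never reach this
    case. *)
Definition hw_box (q : nat) := singleton (insubd r0 q).
Definition hw_column h := [seq hw_box q | q <- iota 0 h].

Local Notation A0 := (hw_box 0).

Lemma in_hw_box q (j : 'I_n) : q < n -> (j \in val (hw_box q)) = (j == q :> nat).
Proof. by move=> qn; rewrite /= inE -val_eqE insubdK. Qed.

Lemma size_hw_column h : size (hw_column h) = h.
Proof. by rewrite size_map size_iota. Qed.

Lemma hw_columnS h : hw_column h.+1 = hw_column h ++ [:: hw_box h].
Proof. by rewrite /hw_column -addn1 iotaD map_cat. Qed.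

(** Induction along the reading word; row [q] must consist of boxes [{q}]. Column strictness bounds
    an entry from below. An entry [a] that is too large has no box to its right, as that box would
    bound it; all entries read before are then smaller than [a-1], so [phi] vanishes there at index
    [a-1] and the word is not of highest weight. *)
Lemma hw_entries cols : set_tableau A0 cols -> hw_word (flatten cols) ->
  sorted leq (shape cols) -> forall C1 d1 A d2 C2, cols = C1 ++ (d1 ++ A :: d2) :: C2 ->
  forall j : 'I_n, (j \in val A) = (j == size d1 :> nat).
Proof.
move=> tab hw heights; suff main k : forall C1 d1 A d2 C2, size (flatten C1 ++ d1) = k ->
    cols = C1 ++ (d1 ++ A :: d2) :: C2 -> forall j : 'I_n, (j \in val A) = (j == size d1 :> nat).
  by move=> C1 d1 A d2 C2; apply: main.
elim/ltn_ind: k => k IH C1 d1 A d2 C2 kE colsE.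
have col_entry q X : q < size d1 -> nth A0 d1 q = X -> forall j : 'I_n, (j \in val X) = (j == q :> nat).
  move=> qd Xq j; rewrite -[X in _ == X](size_takel (ltnW qd)).
  apply: (IH (size (flatten C1 ++ take q d1)) _ C1 (take q d1) X (drop q.+1 d1 ++ A :: d2) C2) => //.
    by rewrite -kE !size_cat size_takel ?(ltnW qd) // ltn_add2l.
  by rewrite colsE {1}(split_nth A0 qd) Xq -catA.
have right_entry C1a R C1b q X : C1 = C1a ++ R :: C1b -> q < size R -> nth A0 R q = X ->
    forall j : 'I_n, (j \in val X) = (j == q :> nat).
  move=> C1E qR Xq j; rewrite -[X in _ == X](size_takel (ltnW qR)).
  apply: (IH (size (flatten C1a ++ take q R)) _ C1a (take q R) X (drop q.+1 R) (C1b ++ (d1 ++ A :: d2) :: C2)) => //.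
    rewrite -kE C1E flatten_cat /= !size_cat size_takel ?(ltnW qR) //.
    by move: qR; clear; lia.
  by rewrite colsE C1E {1}(split_nth A0 qR) Xq -!catA.
have /andP[/allP cols_sorted row] := tab.
have scol : sorted (@set_lt n) (d1 ++ A :: d2).
  by apply: cols_sorted; rewrite colsE mem_cat mem_head orbT.
have lower (a : 'I_n) : a \in val A -> size d1 <= a.
  case: (posnP (size d1)) => [->//|pos] aA.
  have pr : (size d1).-1 < size d1 by rewrite prednK.
  have [x xX] := SS_nonempty (nth A0 d1 (size d1).-1).
  have := col_entry _ _ pr erefl x; rewrite xX => /esym/eqP xE.
  by have := col_head scol (mem_nth A0 pr) aA xX; rewrite xE prednK.
have upper (a : 'I_n) : a \in val A -> a <= size d1.
  move=> aA; rewrite leqNgt; apply/negP => lt.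
  have heights_le R : R \in C1 -> size R <= size d1.
    move=> RC1; rewrite leqNgt; apply/negP => ltR.
    case/lastP: C1 RC1 colsE {kE col_entry} right_entry => // C R' RC colsE right_entry.
    have leR : size R <= size R'.
      move: RC; rewrite mem_rcons inE => /orP[/eqP->//|RC].
      move: heights; rewrite colsE /shape map_cat map_rcons (sorted_pairwise leq_trans).
      rewrite pairwise_cat pairwise_rcons => /and3P[_ /andP[/allP h _] _].
      by apply: h; apply: map_f.
    have rR' : size d1 < size R' := leq_trans ltR leR.
    have [x xX] := SS_nonempty (nth A0 R' (size d1)).
    have xE : x = size d1 :> nat.
      have := right_entry C R' [::] (size d1) _ _ rR' erefl x.
      by rewrite xX => /(_ _)/esym/eqP; apply; rewrite cats1.
    have /andP[_ /allP le] : col_le A0 R' (d1 ++ A :: d2).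
      by have row1 := row; rewrite colsE cat_rcons in row1; apply: sorted_adjacent row1.
    have := le (size d1); rewrite mem_iota /= nth_cat ltnn subnn => /(_ rR')/set_leP/(_ a x aA xX).
    by rewrite xE leqNgt lt.
  have rows_lt X (j : 'I_n) : X \in flatten C1 ++ d1 -> j \in val X -> j < size d1.
    rewrite mem_cat => /orP[/flattenP[R RC1 XR]|Xd] jX.
      have /(nthP A0)[q qR Xq] := XR; case/splitPr: RC1 (heights_le R RC1) right_entry => C1a C1b szR right_entry.
      by have := right_entry _ _ _ _ _ erefl qR Xq j; rewrite jX => /esym/eqP->; apply: leq_trans szR.
    have /(nthP A0)[q qd Xq] := Xd.
    by have := col_entry _ _ qd Xq j; rewrite jX => /esym/eqP->.
  have ai : a.-1 < n.-1 by have := ltn_ord a; move: lt; clear; lia.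
  pose i := Ordinal ai.
  have hiE : ihi i = a by apply: val_inj => /=; rewrite prednK //; apply: leq_ltn_trans lt.
  have phi0 : word_phi i (flatten C1 ++ d1) = 0.
    apply: word_phi_no => X Xc; apply/negP => /(rows_lt _ _ Xc) /=.
    by move: lt; clear; lia.
  move/hw_wordP/(_ i): hw; rewrite colsE flatten_cat /= -catA catA word_eps_cat phi0 /=.
  by have := letter_eps_gt0 i A; rewrite hiE aA; clear; lia.
move=> j; apply/idP/eqP => [jA|jE].
  by apply/eqP; rewrite eqn_leq lower // upper.
have [x xA] := SS_nonempty A; rewrite (_ : j = x) //; apply: val_inj => /=.
by apply/eqP; rewrite jE eqn_leq lower // upper.
Qed.

Lemma hw_tableau_unique cols : set_tableau A0 cols -> hw_word (flatten cols) ->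
  sorted leq (shape cols) -> cols = [seq hw_column h | h <- shape cols].
Proof.
move=> tab hw heights; rewrite -map_comp -[LHS]map_id; apply/eq_in_map => d dC /=.
have := hw_entries tab hw heights; case/splitPr: dC => C1 C2 entry.
apply: (@eq_from_nth _ A0) => [|q qd]; first by rewrite size_hw_column.
rewrite (nth_map 0) ?size_iota // nth_iota // add0n.
have e (j : 'I_n) : (j \in val (nth A0 d q)) = (j == q :> nat).
  rewrite (entry C1 (take q d) _ (drop q.+1 d) C2) ?size_takel ?(ltnW qd) //.
  by rewrite -(split_nth A0 qd).
have [x xX] := SS_nonempty (nth A0 d q).
have qn : q < n by have := ltn_ord x; have := e x; rewrite xX => /esym/eqP->.
by apply: val_inj; apply/setP => j; rewrite in_hw_box // e.
Qed.

Lemma hw_column_tableau hs : sorted leq hs -> all (fun h => h <= n) hs ->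
  set_tableau A0 [seq hw_column h | h <- hs].
Proof.
move=> shs /allP hn; apply/andP; split.
  apply/allP => d /mapP[h /hn hln ->]; rewrite sorted_map.
  apply: (@sub_in_sorted _ (fun q => q < n) ltn); last exact: iota_ltn_sorted.
    move=> p q pn qn pq; apply/set_ltP => x y.
    by rewrite !in_hw_box // => /eqP-> /eqP->.
  by apply/allP => q; rewrite mem_iota /= => /leq_trans; apply.
apply: homo_sorted shs => h h' hh'; rewrite /col_le !size_hw_column hh' /=.
apply/allP => q; rewrite mem_iota /= => qh.
rewrite /hw_column !(nth_map 0) ?size_iota // ?nth_iota //; try exact: leq_trans hh'.
by apply/set_leP => x y; rewrite /= !inE => /eqP-> /eqP->.
Qed.

Lemma hw_column_eps i h : h <= n ->
  word_eps i (hw_column h) = 0 /\ word_phi i (hw_column h) = if h == i.+1 then 2 else 0.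
Proof.
elim: h => [//|h IH] hn; have [e p] := IH (ltnW hn).
rewrite hw_columnS word_eps_cat word_phi_cat e p /= /letter_eps /letter_phi.
rewrite !in_hw_box //= eqSS (eq_sym h) (eq_sym h).
by case: (ltngtP i.+1 h) => //; case: (ltngtP (i : nat) h) => //=; lia.
Qed.

Lemma hw_columns_hw hs : all (fun h => h <= n) hs -> hw_word (flatten [seq hw_column h | h <- hs]).
Proof.
move=> hn; apply/hw_wordP => i; elim: hs hn => //= h hs IH /andP[hn /IH e].
by rewrite word_eps_cat e (hw_column_eps i hn).1.
Qed.

Lemma hw_column_count h (j : 'I_n) : h <= n -> word_count (hw_column h) j = (j < h).
Proof.
move=> hn; rewrite /word_count count_map (eq_in_count (a2 := pred1 (j : nat))); last first.
  by move=> q; rewrite mem_iota /= => qh; rewrite in_hw_box ?(leq_trans qh) // eq_sym.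
by rewrite count_uniq_mem ?iota_uniq // mem_iota.
Qed.

Lemma hw_columns_count hs (j : 'I_n) : all (fun h => h <= n) hs ->
  word_count (flatten [seq hw_column h | h <- hs]) j = count (fun h => j < h) hs.
Proof.
rewrite /word_count; elim: hs => //= h hs IH /andP[hn /IH e].
by rewrite count_cat e; congr (_ + _); apply: hw_column_count.
Qed.

Definition tableau_words hs : seq word :=
  [seq s <- [seq tval z | z <- enum {: (sumn hs).-tuple (SS_elt n)}] | set_tableau A0 (reshape hs s)].

Lemma mem_tableau_words hs s : (s \in tableau_words hs) =
  (size s == sumn hs) && set_tableau A0 (reshape hs s).
Proof.
rewrite mem_filter andbC; congr (_ && _); apply/mapP/eqP => [[t _ ->]|sz]; first exact: size_tuple.
by exists (Tuple (introT eqP sz)); rewrite ?mem_enum.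
Qed.

Lemma tableau_words_uniq hs : uniq (tableau_words hs).
Proof. by apply: filter_uniq; rewrite map_inj_uniq ?enum_uniq //; apply: val_inj. Qed.

Lemma mem_flatten_tableau hs cols : set_tableau A0 cols -> shape cols = hs ->
  flatten cols \in tableau_words hs.
Proof. by move=> tab <-; rewrite mem_tableau_words size_flatten eqxx flattenK. Qed.

Lemma tableau_wordsP hs s : s \in tableau_words hs ->
  exists2 cols, set_tableau A0 cols & s = flatten cols /\ shape cols = hs.
Proof.
rewrite mem_tableau_words => /andP[/eqP sz tab]; exists (reshape hs s) => //.
by rewrite reshapeKr ?reshapeKl ?sz.
Qed.

Theorem tableau_crystal (la : 'I_n -> nat) : (forall r r' : 'I_n, r <= r' -> la r' <= la r) ->
  exists (D : seq word) m s0, [/\ uniq D, all (fun s => size s == m) D,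
    (forall i s t, s \in D -> word_f i s = Some t -> t \in D) /\
    (forall i s t, s \in D -> word_e i s = Some t -> t \in D),
    [seq s <- D | hw_word s] = [:: s0] & forall j, word_count s0 j = la j].
Proof.
move=> la_mono; have n0 : 0 < n := leq_ltn_trans (leq0n r0) (ltn_ord r0).
pose o : 'I_n := Ordinal n0.
(* [ht c] is the height of column [c] of the shape [la], a part of the conjugate partition; the
   reversal lists the columns from right to left. *)
pose ht (c : nat) := #|[set r : 'I_n | c < la r]|.
pose hs := [seq ht c | c : nat <- rev (iota 0 (la o))].
have htn (c : nat) : ht c <= n by rewrite -[X in _ <= X]card_ord max_card.
have hsn : all (fun h => h <= n) hs by apply/allP => h /mapP[c _ ->].
have shs : sorted leq hs.
  rewrite sorted_map rev_sorted; apply: (@sub_sorted _ ltn); last exact: iota_ltn_sorted.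
  move=> a b ab; apply: subset_leq_card; apply/subsetP => r; rewrite !inE.
  exact: ltn_trans.
pose s0 := flatten [seq hw_column h | h <- hs].
have shape_hs : shape [seq hw_column h | h <- hs] = hs.
  by rewrite /shape -map_comp -[RHS]map_id; apply: eq_map => h /=; rewrite size_hw_column.
exists (tableau_words hs), (sumn hs), s0; split.
- exact: tableau_words_uniq.
- by apply/allP => s; rewrite mem_tableau_words => /andP[].
- split=> i s t /tableau_wordsP[cols tab [-> shE]].
    by case/(set_tableau_f tab) => cols' tab' [-> shE']; apply: mem_flatten_tableau; rewrite ?shE'.
  by case/(set_tableau_e tab) => cols' tab' [-> shE']; apply: mem_flatten_tableau; rewrite ?shE'.
- apply: perm_small_eq => //; apply: uniq_perm => [||s]; [exact: filter_uniq (tableau_words_uniq hs)|by []|].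
  rewrite mem_filter inE; apply/andP/eqP => [[hw /tableau_wordsP[cols tab [sE shE]]]|->].
    by rewrite sE in hw *; rewrite (hw_tableau_unique tab hw) shE.
  split; first exact: hw_columns_hw.
  by apply: mem_flatten_tableau shape_hs; apply: hw_column_tableau.
move=> j; rewrite hw_columns_count // count_map count_rev.
have card_lt m : m <= n -> #|[set r : 'I_n | r < m]| = m.
  by move=> mn; rewrite -sum1dep_card -(big_ord_widen n (fun=> 1) mn) sum1_card card_ord.
(* Conjugation: column [c] reaches row [j] exactly when [c < la j]. *)
rewrite (eq_in_count (a2 := fun c : nat => c < la j)); last first.
  move=> c _ /=; apply/idP/idP => [lt|cj].
    rewrite ltnNge; apply/negP => le; move: lt; rewrite ltnNge -[X in _ <= X](card_lt j (ltnW (ltn_ord j))).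
    move/negP; apply; apply: subset_leq_card; apply/subsetP => r; rewrite !inE.
    by move=> cr; rewrite ltnNge; apply: contraTN cr => /la_mono jr; rewrite -leqNgt (leq_trans jr).
  rewrite -[X in X <= _](card_lt j.+1 (ltn_ord j)); apply: subset_leq_card.
  by apply/subsetP => r; rewrite !inE ltnS => /la_mono; apply: leq_trans.
rewrite -(subnKC (la_mono o j (leq0n j))) iotaD count_cat add0n.
rewrite (eq_in_count (a2 := predT)) => [|c]; last by rewrite mem_iota.
rewrite count_predT size_iota (eq_in_count (a2 := pred0)) ?count_pred0 ?addn0 // => c.
by rewrite mem_iota /= => /andP[le _]; rewrite ltnNge le.
Qed.

End HighestTableau.

(** * Factorizations as families of sets *)

Section RowsAndWords.

Variables (n N : nat).
Implicit Types (X Y : {set 'I_N}) (R : {ffun 'I_n -> {set 'I_N}}) (s t : seq nat).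

Definition set_letters X : seq nat := [seq N - j | j : 'I_N <- enum X].

Lemma size_set_letters X : size (set_letters X) = #|X|.
Proof. by rewrite size_map cardE. Qed.

Lemma set_letters_sorted X : sorted gtn (set_letters X).
Proof.
rewrite /set_letters; have -> : enum X = [seq j <- enum 'I_N | j \in X].
  by rewrite -!deprecated_filter_index_enum filter_predT.
rewrite sorted_map; apply: sorted_filter; first by move=> a b c /=; lia.
apply: (@sub_sorted _ (relpre val ltn)).
  by move=> a b /=; have := ltn_ord a; have := ltn_ord b; lia.
by rewrite -sorted_map val_enum_ord iota_ltn_sorted.
Qed.

Lemma mem_set_letters X (j : 'I_N) : (N - j \in set_letters X) = (j \in X).
Proof.
rewrite -(mem_enum (mem X)); apply/mapP/idP => [[i iX e]|jX]; last by exists j.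
by rewrite (_ : j = i) //; apply: val_inj => /=; have := ltn_ord i; have := ltn_ord j; lia.
Qed.

Lemma set_letters_bound X x : x \in set_letters X -> 0 < x <= N.
Proof. by case/mapP => j _ ->; rewrite subn_gt0 ltn_ord leq_subr. Qed.

Definition letters_set s : {set 'I_N} := [set j : 'I_N | N - j \in s].

Lemma set_lettersK X : letters_set (set_letters X) = X.
Proof. by apply/setP => j; rewrite inE mem_set_letters. Qed.

Lemma letters_setK s : sorted gtn s -> {in s, forall x, 0 < x <= N} ->
  set_letters (letters_set s) = s.
Proof.
move=> ss sb; apply: (@irr_sorted_eq _ gtn); [by move=> a b c /=; lia|by move=> a /=; lia| | |].
- exact: set_letters_sorted.
- exact: ss.
move=> x; apply/mapP/idP => [[j]|xs]; first by rewrite mem_enum inE => ? ->.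
have xN : N - x < N by have := sb x xs; lia.
exists (Ordinal xN); rewrite ?mem_enum ?inE /= subKn //; by have /andP[] := sb x xs.
Qed.

Definition row_lt s t := (size t <= size s) && all (fun c => nth 0 s c < nth 0 t c) (iota 0 (size t)).

Lemma row_lt_trans : transitive row_lt.
Proof.
move=> t s u /andP[ts /allP st] /andP[ut /allP tu]; apply/andP; split; first exact: leq_trans ts.
apply/allP => c cu; have ct : c \in iota 0 (size t) by move: cu; rewrite !mem_iota; lia.
exact: ltn_trans (st _ ct) (tu _ cu).
Qed.

Lemma sorted_count_lt s v c : sorted ltn s ->
  (c < count (fun x => x < v) s) = (c < size s) && (nth 0 s c < v).
Proof.
elim: s c => [|x s IH] c //= xs; have ss := path_sorted xs.
have xle y : y \in s -> x < y by move: xs; rewrite (path_sortedE ltn_trans) => /andP[/allP h _] /h.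
case: (ltnP x v) => xv /=; first by case: c => [|c] /=; rewrite ?xv // add1n ltnS IH.
rewrite add0n; have c0 : count (fun y => y < v) s = 0.
  by apply/eqP; rewrite -leqn0 leqNgt -has_count; apply/hasPn => y /xle; lia.
rewrite c0 ltn0; case: c => [|c] /=; first by lia.
rewrite ltnS; case: (ltnP c (size s)) => //= cs.
by rewrite ltnNge (ltnW (leq_ltn_trans xv (xle _ (mem_nth 0 cs)))).
Qed.

(** In an increasing row, the number of entries smaller than [v] is the column of [v]. The left side
    thus asks [s] for an entry smaller than [v] in that very column, which links [violation] to
    tableaux. *)
Lemma row_ltP s t : sorted ltn s -> sorted ltn t ->
  (forall v, v \in t -> count (fun x => x < v) t < count (fun x => x < v) s) <-> row_lt s t.
Proof.
move=> ss st.
have ct c : c < size t -> count (fun x => x < nth 0 t c) t = c.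
  move=> ct; apply/eqP; rewrite eqn_leq; apply/andP; split.
    by rewrite leqNgt sorted_count_lt // ltnn andbF.
  case: c ct => // c ct; rewrite sorted_count_lt // (ltnW ct) /=.
  exact: (sorted_ltn_nth ltn_trans 0 st) (ltnW ct) ct (ltnSn c).
split=> [h|/andP[sz /allP h] v /(nthP 0)[c cs <-]]; last first.
  by rewrite ct // sorted_count_lt // (leq_trans cs sz) h // mem_iota.
have key c : c < size t -> (c < size s) && (nth 0 s c < nth 0 t c).
  by move=> cs; rewrite -sorted_count_lt // -{1}(ct c cs); apply/h/mem_nth.
apply/andP; split; last by apply/allP => c; rewrite mem_iota /= => /key/andP[].
by case: (posnP (size t)) => [->//|t0]; have := key (size t).-1; rewrite prednK // => /(_ (leqnn _))/andP[].
Qed.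

Definition rows_tab R : seq (seq nat) := [seq rev (set_letters (R r)) | r : 'I_n <- enum 'I_n].

Lemma rows_tab_sorted X : sorted ltn (rev (set_letters X)).
Proof. by rewrite rev_sorted; apply: set_letters_sorted. Qed.

Lemma count_set_letters X (k : 'I_N) :
  count (fun x => x < N - k) (rev (set_letters X)) = count_above X k.
Proof.
rewrite count_rev count_map -sum1_count big_enum_cond sum1_card.
by apply: eq_card => j; rewrite !inE unfold_in /=; have := ltn_ord j; case: (j \in X) => //=; lia.
Qed.

Lemma tableau_rowsE R : tableau_rows R = sorted row_lt (rows_tab R).
Proof.
have sz : size (rows_tab R) = n by rewrite size_map size_enum_ord.
have rowE (r : 'I_n) : nth [::] (rows_tab R) r = rev (set_letters (R r)).
  by rewrite (nth_map r) ?size_enum_ord // nth_ord_enum.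
apply/forallP/(sortedP [::]) => [good i|good i].
  rewrite sz => iN; have ip : i < n.-1 by lia.
  pose j := Ordinal ip; rewrite -[i]/(ilo j : nat) -[(ilo j).+1]/(ihi j : nat) !rowE.
  apply/row_ltP; try exact: rows_tab_sorted.
  move=> v; rewrite mem_rev => /mapP[k kR ->]; rewrite !count_set_letters ltnNge.
  by have /forallP/(_ k) := good j; rewrite /violation -(mem_enum (mem (R (ihi j)))) kR.
apply/forallP => k; apply/negP => /andP[kR le].
have := good i; rewrite sz -[i.+1]/(ihi i : nat) => /(_ (ltn_ord (ihi i))).
rewrite -[X in nth _ _ X]/(ilo i : nat) !rowE.
move/(row_ltP (rows_tab_sorted _) (rows_tab_sorted _))/(_ (N - k)).
rewrite mem_rev mem_set_letters kR !count_set_letters => /(_ isT); lia.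
Qed.

Lemma tableau_rows_increasing R : tableau_rows R <-> increasing_tableau (rows_tab R).
Proof.
rewrite tableau_rowsE; split=> [sor|[sh _ _ inc]].
  split.
  - by rewrite /shape sorted_map; apply: sub_sorted sor => s t /andP[].
  - apply/allP => s /mapP[r _ ->]; apply/allP => x; rewrite mem_rev.
    by case/set_letters_bound/andP.
  - by apply/allP => s /mapP[r _ ->]; apply: rows_tab_sorted.
  move=> i1 i2 j i12 ji2; have i2n : i2 < size (rows_tab R).
    by rewrite ltnNge; apply/negP => le; rewrite nth_default in ji2.
  have /andP[_ /allP] := sorted_ltn_nth row_lt_trans [::] sor i1 i2 (ltn_trans i12 i2n) i2n i12.
  by apply; rewrite mem_iota.
apply/(sortedP [::]) => i iN; apply/andP; split.
  have := (sortedP 0 sh) i; rewrite size_map => /(_ iN).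
  by rewrite !(nth_map [::]) // ltnW.
by apply/allP => c; rewrite mem_iota /= => cs; apply: inc.
Qed.

Lemma tableau_rows_mono R : tableau_rows R -> forall r r' : 'I_n, r <= r' -> #|R r'| <= #|R r|.
Proof.
rewrite tableau_rowsE => sor r r'; rewrite leq_eqVlt => /orP[/eqP/val_inj->//|lt].
have sz : size (rows_tab R) = n by rewrite size_map size_enum_ord.
have rowE (q : 'I_n) : nth [::] (rows_tab R) q = rev (set_letters (R q)).
  by rewrite (nth_map q) ?size_enum_ord // nth_ord_enum.
have := sorted_ltn_nth row_lt_trans [::] sor; rewrite sz.
move=> /(_ r r' (ltn_ord r) (ltn_ord r') lt)/andP[+ _].
by rewrite !rowE !size_rev !size_set_letters.
Qed.

End RowsAndWords.

(** * Matching the two sides *)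

(** Equal multisets of keys give a key-preserving bijection, by transporting positions along the
    permutation. *)
Lemma perm_map_matching (A B C : eqType) (kA : A -> C) (kB : B -> C) (s : seq A) (t : seq B) (b0 : B) :
  uniq s -> uniq t -> perm_eq (map kA s) (map kB t) ->
  exists g : A -> B, [/\ {in s &, injective g}, {in s, forall a, g a \in t},
    {in t, forall b, exists2 a, a \in s & g a = b} & {in s, forall a, kB (g a) = kA a}].
Proof.
move=> us ut pst; have /(perm_iotaP (kB b0))[Is pI sE] := pst.
have szI : size Is = size s by rewrite -[RHS](size_map kA) sE size_map.
have szt : size s = size t by rewrite -(size_map kA) (perm_size pst) size_map.
have memI k : (k \in Is) = (k < size t) by rewrite (perm_mem pI) mem_iota size_map.
have uI : uniq Is by rewrite (perm_uniq pI) iota_uniq.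
pose g a := nth b0 t (nth 0 Is (index a s)).
have idx a : a \in s -> nth 0 Is (index a s) < size t.
  by move=> sa; rewrite -memI mem_nth // szI index_mem.
have ginj : {in s &, injective g}.
  move=> a a' sa sa' /eqP; rewrite nth_uniq ?idx // nth_uniq ?szI ?index_mem //.
  by move=> /eqP /(congr1 (nth a s)); rewrite !nth_index.
have gt : {in s, forall a, g a \in t} by move=> a sa; rewrite mem_nth // idx.
exists g; split=> //.
  move=> b tb; have sub : {subset map g s <= t} by move=> _ /mapP[a sa ->]; apply: gt.
  have ug : uniq (map g s) by rewrite map_inj_in_uniq.
  have [_ mE] := uniq_min_size ug sub (eq_leq (esym (etrans (size_map g s) szt))).
  by move: tb; rewrite -mE => /mapP[a sa ->]; exists a.
move=> a sa; rewrite /g -(nth_map b0 (kB b0)) ?idx // -(nth_map 0 (kB b0) (nth (kB b0) (map kB t))).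
  by rewrite -sE (nth_map a) ?index_mem // nth_index.
by rewrite szI index_mem.
Qed.

Section Matching.

Variables (n N : nat) (w : Sinf).
Local Notation rows := {ffun 'I_n -> {set 'I_N}}.
Local Notation word := (seq (SS_elt n)).

Variable D : rows -> seq word.
Variable s0 : rows -> word.
Hypotheses (D_uniq : forall R, tableau_rows R -> uniq (D R))
  (D_f : forall R, tableau_rows R -> forall i s t, s \in D R -> word_f i s = Some t -> t \in D R)
  (D_e : forall R, tableau_rows R -> forall i s t, s \in D R -> word_e i s = Some t -> t \in D R)
  (D_hw : forall R, tableau_rows R -> [seq s <- D R | hw_word s] = [:: s0 R])
  (s0_count : forall R, tableau_rows R -> forall j, word_count (s0 R) j = #|R j|).

Definition hecke_rows : seq rows := [seq R <- enum {: rows} | hecke_prod R == w].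
Definition hecke_tableaux : seq rows := [seq R <- hecke_rows | tableau_rows R].
Definition labelled_words : seq (rows * word) := [seq (R, s) | R <- hecke_tableaux, s <- D R].

Local Open Scope ring_scope.

Definition row_mnm (R : rows) : 'X_{1..n} := [multinom #|R r| | r < n].
Definition word_mnm (s : word) : 'X_{1..n} := [multinom word_count s r | r < n].

Local Notation xs := (fun r : 'I_n => 'X_r : {mpoly rat[n]}).

Lemma row_wtX R : row_wt xs R = 'X_[row_mnm R].
Proof. by rewrite mpolyXE_id; apply: eq_bigr => r _; rewrite mnmE. Qed.

Lemma word_wtX s : word_wt xs s = 'X_[word_mnm s].
Proof. by rewrite mpolyXE_id; apply: eq_bigr => r _; rewrite mnmE. Qed.

Lemma sum_hecke_rows :
  \sum_(R <- hecke_rows) row_wt xs R = \sum_(p <- labelled_words) word_wt xs p.2.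
Proof.
apply: (mulIf (alternant1_neq0 n)).
rewrite big_filter big_enum_cond /= hecke_alternant; last first.
  move=> r; apply/eqP => /(congr1 (mcoeff 0%MM)); rewrite mcoeffD mcoeff1 mcoeff0 mcoeffX.
  by rewrite eqxx -mdeg_eq0 mdeg1 addr0 => /eqP; rewrite oner_eq0.
rewrite big_allpairs_dep mulr_suml /hecke_tableaux /hecke_rows big_filter big_filter_cond big_enum_cond /=.
rewrite (eq_bigl (fun R => (hecke_prod R == w) && tableau_rows R)); last by move=> R; rewrite andbC.
apply: eq_bigr => R /andP[_ tR].
rewrite (stable_alternant _ (D_uniq tR) (D_f tR) (D_e tR)) -big_filter D_hw // big_seq1.
apply: (congr1 (fun g => alternant g xs)); apply: boolp.funext => y.
by apply: eq_bigr => j _; rewrite s0_count.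
Qed.

Lemma count_hecke_rows m :
  count (fun R => row_mnm R == m) hecke_rows = count (fun p => word_mnm p.2 == m) labelled_words.
Proof.
have cnt (I : Type) (r : seq I) (F : I -> 'X_{1..n}) :
    (\sum_(j <- r) ('X_[F j] : {mpoly rat[n]}))@_m = (count (fun j => F j == m) r)%:R.
  rewrite raddf_sum /= -sum1_count natr_sum [RHS]big_mkcond; apply: eq_bigr => j _.
  by rewrite mcoeffX; case: eqP.
apply/eqP; rewrite -(eqr_nat rat) -!cnt; apply/eqP; congr mcoeff.
have := sum_hecke_rows; rewrite (eq_bigr (fun R => 'X_[row_mnm R])) => [|R _]; last exact: row_wtX.
by move=> ->; apply: eq_bigr => p _; apply: word_wtX.
Qed.

(** Each tableau [R] labels exactly one highest weight word, of weight [row_mnm R], which settles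
    the keys with [true]. Those with [false] follow by subtraction from [count_hecke_rows]. *)
Lemma matching_keys :
  perm_eq [seq (row_mnm R, tableau_rows R) | R <- hecke_rows]
          [seq (word_mnm p.2, hw_word p.2) | p <- labelled_words].
Proof.
apply/allP => -[m b] _ /=; rewrite !count_map; apply/eqP.
have ct : count (fun R => (row_mnm R == m) && tableau_rows R) hecke_rows =
    count (fun p => (word_mnm p.2 == m) && hw_word p.2) labelled_words.
  rewrite -[RHS]sum1_count [RHS]big_mkcond big_allpairs_dep /=.
  transitivity (\sum_(R <- hecke_tableaux) (row_mnm R == m) : nat).
    rewrite big_filter -sum1_count -big_mkcondr /=.
    by apply: eq_bigl => R; rewrite andbC.
  apply: eq_big_seq => R; rewrite mem_filter => /andP[tR _].
  rewrite -big_mkcond (eq_bigl (fun s => hw_word s && (word_mnm s == m))) => [|s]; last by rewrite andbC.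
  rewrite -big_filter_cond D_hw // big_mkcond big_seq1.
  have -> : word_mnm (s0 R) = row_mnm R by apply/mnmP => j; rewrite !mnmE s0_count.
  by case: eqP.
have splitc (T : Type) (r : seq T) (u v : pred T) :
    count u r = (count (fun x => u x && v x) r + count (fun x => u x && ~~ v x) r)%N.
  by elim: r => //= x r ->; case: (u x); case: (v x) => /=; rewrite ?addnA ?addnS ?add0n ?addn0 // addSn.
have tot := count_hecke_rows m.
rewrite (splitc _ _ _ (@tableau_rows n N)) in tot.
rewrite [in RHS](splitc _ _ _ (fun p => hw_word p.2)) ct in tot; move/addnI: tot => cf.
transitivity (count (fun R => (row_mnm R == m) && (tableau_rows R == b)) hecke_rows).
  by apply: eq_count => R; rewrite /= xpair_eqE.
transitivity (count (fun p => (word_mnm p.2 == m) && (hw_word p.2 == b)) labelled_words); last first.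
  by apply: eq_count => p; rewrite /= xpair_eqE.
case: b.
  by move: ct; congr (_ = _); apply: eq_count => ?; rewrite eqb_id.
by move: cf; congr (_ = _); apply: eq_count => ?; rewrite eqbF_neg.
Qed.

End Matching.

(** * Factorizations of [w] as the families with product [w] *)

Section DecrRows.

Variables (n N : nat) (w : Sinf).
Hypothesis N_bound : forall s i, hecke_word w s -> i \in s -> i <= N.
Local Notation rows := {ffun 'I_n -> {set 'I_N}}.

Definition decr_rows (a : Decr n w) : rows := [ffun r => letters_set N (tnth (val a) r)].

Lemma decr_rowsK (a : Decr n w) r : set_letters (decr_rows a r) = tnth (val a) r.
Proof.
rewrite ffunE; have /andP[/allP dec hw] := valP a.
rewrite letters_setK //; first by apply/dec/mem_tnth.
move=> x xr; have xf : x \in flatten (val a) by apply/flattenP; exists (tnth (val a) r); rewrite ?mem_tnth.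
by rewrite (N_bound hw xf) andbT; have /andP[/allP pos _] := hw; apply: pos.
Qed.

Lemma decr_rows_val (a : Decr n w) :
  tval (val a) = [seq set_letters (decr_rows a r) | r : 'I_n <- enum 'I_n].
Proof.
by rewrite -[LHS](map_tnth_enum (val a)); apply: eq_map => r; rewrite decr_rowsK.
Qed.

Lemma big_demazure_rows (R : rows) :
  \big[demazure/1%g]_(i <- flatten [seq set_letters (R r) | r : 'I_n <- enum 'I_n]) simple i =
  hecke_prod R.
Proof.
rewrite big_flatten big_map -deprecated_filter_index_enum big_filter.
by apply: eq_bigr => r _; rewrite big_map -deprecated_filter_index_enum big_filter.
Qed.

Lemma decr_rows_prod a : hecke_prod (decr_rows a) = w.
Proof.
by rewrite -big_demazure_rows -decr_rows_val; have /andP[_ /andP[_ /eqP]] := valP a.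
Qed.

Lemma decr_rows_inj : injective decr_rows.
Proof. by move=> a b ab; apply/val_inj/val_inj; rewrite /= !decr_rows_val ab. Qed.

Lemma decr_rows_surj (R : rows) : hecke_prod R = w -> exists a, decr_rows a = R.
Proof.
move=> Rw; pose t := [tuple set_letters (R r) | r < n].
have dt : decr_factorization w t.
  apply/andP; split.
    by apply/allP => s /mapP[r _ ->]; apply: set_letters_sorted.
  apply/andP; split; last by rewrite big_demazure_rows Rw.
  by apply/allP => x /flattenP[s /mapP[r _ ->] /set_letters_bound/andP[]].
exists (exist _ t dt); apply/ffunP => r; rewrite ffunE /= tnth_mktuple.
exact: set_lettersK.
Qed.

Lemma tab_rows (a : Decr n w) : tab a = rows_tab (decr_rows a).
Proof. by rewrite /tab decr_rows_val -map_comp. Qed.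

End DecrRows.

Lemma hw_word_None n (s : seq (SS_elt n)) : hw_word s <-> forall i, word_e i s = None.
Proof.
split=> [/hw_wordP h i|h]; first by apply/word_e_None.
by apply/hw_wordP => i; apply/word_e_None.
Qed.

(** * Normality of a crystal labelled by words *)

Section Normality.

Import boolp classical_sets functions.

Variables (n : nat) (A0 : SS_elt n) (B : crystal_data n) (L : Type).
Variables (label : B -> L) (wd : B -> seq (SS_elt n)) (len : L -> nat).
Hypotheses (wd_e : forall i (b : B), omap wd (cre i b) = word_e i (wd b))
  (wd_f : forall i (b : B), omap wd (crf i b) = word_f i (wd b))
  (wd_inj : forall b c, label b = label c -> wd b = wd c -> b = c)
  (label_f : forall i (b c : B), crf i b = Some c -> label c = label b)
  (ef : forall i (b c : B), cre i b = Some c <-> crf i c = Some b)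
  (wt_wd : forall (b : B) r, (wt b 0 r = (word_count (wd b) r)%:Z)%R)
  (size_wd : forall b, size (wd b) = len (label b)).

(** Labels separate elements that carry equal words. They are constant on components, and so is the
    word length, which fixes the tensor power; a component is then the copy of that of its word. *)
Lemma label_normal : is_normal B.
Proof.
move=> X [b0 ->]; set m := len (label b0).
pose h (b : B) : SS_pow n m := to_pow A0 m (wd b).
have of_h b : label b = label b0 -> of_pow (h b) = wd b.
  by move=> lb; rewrite to_powK // size_wd lb.
have [pe pf] := pow_ef n m.
have h_e i b : label b = label b0 -> cre i (h b) = omap h (cre i b).
  move=> lb; have := congr1 (omap (to_pow A0 m)) (pe i (h b)).
  rewrite of_h // -wd_e; case: (cre i (h b)) (cre i b) => [x|] [y|] //=.
  by rewrite of_powK.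
have h_f i b : label b = label b0 -> crf i (h b) = omap h (crf i b).
  move=> lb; have := congr1 (omap (to_pow A0 m)) (pf i (h b)).
  rewrite of_h // -wd_f; case: (crf i (h b)) (crf i b) => [x|] [y|] //=.
  by rewrite of_powK.
have pow_fe i (x y : SS_pow n m) : crf i x = Some y -> cre i y = Some x.
  move=> xy; have := pf i x; rewrite xy /= => /esym/word_efP; rewrite -pe.
  by case: cre => //= z [/(congr1 (to_pow A0 m))]; rewrite !of_powK => ->.
pose RB := clos_refl_sym_trans B (fun x y => exists i, crf i x = Some y).
pose RP := clos_refl_sym_trans (SS_pow n m) (fun x y => exists i, crf i x = Some y).
have fwd b c : RB b c -> label b = label c /\ (label b = label b0 -> RP (h b) (h c)).
  elim=> {b c} [b c [i bc]|b|b c _ [lbc r]|b c d _ [lbc r] _ [lcd r']].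
  - split=> [|lb]; first by rewrite (label_f bc).
    by apply: rst_step; exists i; rewrite h_f // bc.
  - by split=> // _; apply: rst_refl.
  - by split=> // lc; apply/rst_sym/r; rewrite lbc.
  by split=> [|lb]; [rewrite lbc|apply: rst_trans (r lb) (r' _); rewrite -lbc].
(* Paths lift from the tensor power back to [B], since [h] commutes with the operators: its image of
   a component is a whole component. *)
have bwd x y : RP x y ->
    (forall b, label b = label b0 -> h b = x -> exists2 c, RB b c & h c = y) /\
    (forall c, label c = label b0 -> h c = y -> exists2 b, RB c b & h b = x).
  elim=> {x y} [x y [i xy]|x|x y _ [r r']|x y z _ [r1 r1'] _ [r2 r2']].
  - split=> b lb hb.
      move: (h_f i b lb); rewrite hb xy; case bc: (crf i b) => [c|] //= [->].
      by exists c => //; apply: rst_step; exists i.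
    move: (h_e i b lb); rewrite hb (pow_fe _ _ _ xy); case bc: (cre i b) => [c|] //= [->].
    by exists c => //; apply/rst_sym/rst_step; exists i; apply/ef.
  - by split=> b _ hb; exists b => //; apply: rst_refl.
  - by split.
  split=> b lb hb.
    have [c bc hc] := r1 b lb hb; have [lbc _] := fwd _ _ bc.
    by have [|d cd hd] := r2 c _ hc; [rewrite -lbc|exists d => //; apply: rst_trans bc cd].
  have [c bc hc] := r2' b lb hb; have [lbc _] := fwd _ _ bc.
  by have [|d cd hd] := r1' c _ hc; [rewrite -lbc|exists d => //; apply: rst_trans bc cd].
exists m, [set y | RP (h b0) y]%classic; split; first by exists (h b0).
exists h; last first.
  move=> b /= /fwd[/esym lb _]; split; last by move=> i; rewrite h_e ?h_f.
  by apply/rowP => r; rewrite pow_count of_h // wt_wd.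
split.
- by move=> b /= /fwd[_]; apply.
- move=> b c; rewrite !inE /= => /fwd[lb _] /fwd[lc _] hbc.
  by apply: wd_inj; rewrite -?lb ?lc // -!of_h ?hbc.
by move=> y /= /bwd[r _]; have [c] := r b0 erefl erefl; exists c.
Qed.

End Normality.

(** * Transport of the operators to factorizations *)

Section Transported.

Import boolp classical_sets.

Variables (n N : nat) (w : Sinf) (A0 : SS_elt n).
Hypothesis N_bound : forall s i, hecke_word w s -> i \in s -> i <= N.
Local Notation rows := {ffun 'I_n -> {set 'I_N}}.
Local Notation word := (seq (SS_elt n)).

Variables (D : rows -> seq word) (len : rows -> nat) (s0 : rows -> word).
Hypotheses (D_uniq : forall R, tableau_rows R -> uniq (D R))
  (D_size : forall R, tableau_rows R -> all (fun s => size s == len R) (D R))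
  (D_f : forall R, tableau_rows R -> forall i s t, s \in D R -> word_f i s = Some t -> t \in D R)
  (D_e : forall R, tableau_rows R -> forall i s t, s \in D R -> word_e i s = Some t -> t \in D R)
  (D_hw : forall R, tableau_rows R -> [seq s <- D R | hw_word s] = [:: s0 R])
  (s0_count : forall R, tableau_rows R -> forall j, word_count (s0 R) j = #|R j|).

Lemma mem_labelled_words p : (p \in labelled_words w D) =
  [&& tableau_rows p.1, hecke_prod p.1 == w & p.2 \in D p.1].
Proof.
case: p => R s /=; apply/allpairsPdep/and3P => [[R' [s' [R'T s'D [-> ->]]]]|[tR pR sD]].
  by move: R'T; rewrite !mem_filter => /and3P[-> -> _].
exists R, s; split=> //; rewrite /hecke_tableaux mem_filter tR /=.
by rewrite /hecke_rows mem_filter pR /= mem_enum.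
Qed.

Lemma labelled_words_uniq : uniq (labelled_words w D).
Proof.
apply: allpairs_uniq_dep => [|R|[R s] [R' s'] _ _ [-> ->] //].
  exact/filter_uniq/filter_uniq/enum_uniq.
by rewrite /hecke_tableaux mem_filter => /andP[/D_uniq].
Qed.

Lemma transported_crystal : exists e f : 'I_n.-1 -> Decr n w -> option (Decr n w),
  let B := @CrystalData n (Decr n w) (@decr_wt n w) e f in
  [/\ is_crystal B, is_normal B &
      forall a : B, highest_weight a <-> increasing_tableau (tab a)].
Proof.
have uH : uniq (hecke_rows n N w) by exact/filter_uniq/enum_uniq.
have [g [g_inj g_mem g_surj g_key]] := perm_map_matching ([ffun=> finset.set0], [::]) uH labelled_words_uniq
  (matching_keys w D_uniq D_f D_e D_hw s0_count).
have memH (a : Decr n w) : decr_rows N a \in hecke_rows n N w.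
  by rewrite /hecke_rows mem_filter decr_rows_prod // eqxx mem_enum.
pose G (a : Decr n w) := g (decr_rows N a).
have G_inj : injective G.
  by move=> a b /g_inj ab; apply: (decr_rows_inj N_bound); apply: ab; apply: memH.
have G_mem a : G a \in labelled_words w D := g_mem _ (memH a).
have G_surj p : p \in labelled_words w D -> exists a, G a = p.
  move=> /g_surj[R RH <-]; move: RH; rewrite /hecke_rows mem_filter => /andP[/eqP/decr_rows_surj[a aR] _].
  by exists a; rewrite /G aR.
have G_key a : (word_mnm (G a).2, hw_word (G a).2) = (row_mnm (decr_rows N a), tableau_rows (decr_rows N a)).
  exact: g_key (memH a).
have count_wd a r : word_count (G a).2 r = size (tnth (val a) r).
  have /(congr1 (fun p : 'X_{1..n} * bool => p.1 r)) := G_key a; rewrite /= !mnmE => ->.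
  by rewrite -(decr_rowsK N_bound) size_set_letters.
have tabG a : tableau_rows (G a).1 by have := G_mem a; rewrite mem_labelled_words => /and3P[].
have DG a : (G a).2 \in D (G a).1 by have := G_mem a; rewrite mem_labelled_words => /and3P[].
(* A partial inverse of [G], defined on all of [labelled_words]; that set is stable under the word
   operators with the label kept fixed, so pulling back never loses a value. *)
pose inv p : option (Decr n w) :=
  if pselect (exists a, G a = p) is left ex then Some (sval (cid ex)) else None.
have invP p : p \in labelled_words w D -> exists2 a, inv p = Some a & G a = p.
  move=> pL; rewrite /inv; case: pselect => [ex|[]]; last exact: G_surj.
  by exists (sval (cid ex)) => //; case: cid.
pose lift (o : 'I_n.-1 -> word -> option word) i a := obind (fun s => inv ((G a).1, s)) (o i (G a).2).
have liftP (o : 'I_n.-1 -> word -> option word) :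
    (forall R, tableau_rows R -> forall i s t, s \in D R -> o i s = Some t -> t \in D R) ->
    forall i a, (o i (G a).2 = None -> lift o i a = None) /\
      (forall t, o i (G a).2 = Some t -> exists2 b, lift o i a = Some b & G b = ((G a).1, t)).
  move=> Do i a; rewrite /lift; split=> [->//|t ot]; rewrite ot /=; apply: invP.
  rewrite mem_labelled_words /= tabG (Do _ (tabG a) i _ _ (DG a) ot) andbT.
  by have := G_mem a; rewrite mem_labelled_words => /and3P[].
have lift_wd (o : 'I_n.-1 -> word -> option word) :
    (forall R, tableau_rows R -> forall i s t, s \in D R -> o i s = Some t -> t \in D R) ->
    forall i a, omap (fun b => (G b).2) (lift o i a) = o i (G a).2.
  move=> Do i a; have [h0 h1] := liftP o Do i a; case ot: (o i (G a).2) h0 h1 => [t|] h0 h1.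
    by have [b -> bE] := h1 t erefl; rewrite /= bE.
  by rewrite h0.
have lift_label (o : 'I_n.-1 -> word -> option word) :
    (forall R, tableau_rows R -> forall i s t, s \in D R -> o i s = Some t -> t \in D R) ->
    forall i a b, lift o i a = Some b -> (G b).1 = (G a).1.
  move=> Do i a b; have [h0 h1] := liftP o Do i a; case ot: (o i (G a).2) h0 h1 => [t|] h0 h1.
    by have [c -> cE] := h1 t erefl => -[<-]; rewrite cE.
  by rewrite h0.
exists (lift (@word_e n)), (lift (@word_f n)) => B.
have wdinj (b c : B) : (G b).1 = (G c).1 -> (G b).2 = (G c).2 -> b = c.
  by move=> h1 h2; apply: G_inj; rewrite [LHS]surjective_pairing h1 h2 -surjective_pairing.
have ef i (b c : B) : cre i b = Some c <-> crf i c = Some b.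
  split=> bc.
    have := lift_wd _ D_e i b; rewrite [lift _ _ _]bc /= => /esym/word_efP fE.
    have [_ /(_ _ fE)[d dE Gd]] := liftP _ D_f i c; rewrite [LHS]dE; congr Some.
    by apply: wdinj; rewrite Gd //=; apply: lift_label bc.
  have := lift_wd _ D_f i c; rewrite [lift _ _ _]bc /= => /esym/word_efP eE.
  have [_ /(_ _ eE)[d dE Gd]] := liftP _ D_e i b; rewrite [LHS]dE; congr Some.
  by apply: wdinj; rewrite Gd //=; apply: lift_label bc.
have wtE (b : B) r : (wt b 0 r = (word_count (G b).2 r)%:Z)%R by rewrite mxE count_wd.
split.
- exact: (word_is_crystal (wd := fun a : B => (G a).2) (lift_wd _ D_e) (lift_wd _ D_f)).
- apply: (@label_normal n A0 B rows (fun a : B => (G a).1) (fun a : B => (G a).2) len) => //.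
  + exact: (lift_wd _ D_e).
  + exact: (lift_wd _ D_f).
  + by move=> i b c /(lift_label _ D_f).
  + by move=> b; have /allP/(_ _ (DG b))/eqP := D_size (tabG b).
move=> a; rewrite (tab_rows N_bound) -tableau_rows_increasing.
have /(congr1 snd) /= <- := G_key a; rewrite hw_word_None; split=> h i; have := h i.
  by move=> e0; have := lift_wd _ D_e i a; rewrite [lift _ _ _]e0.
by move=> e0; have [/(_ e0) ] := liftP _ D_e i a.
Qed.

End Transported.

Theorem theorem1p10 (n : nat) (n_gt0 : (0 < n)%N) (w : Sinf) :
  exists e f : 'I_n.-1 -> Decr n w -> option (Decr n w),
    let B := @CrystalData n (Decr n w) (@decr_wt n w) e f in
    [/\ is_crystal B,
        is_normal B &
        forall a : B, highest_weight a <-> increasing_tableau (tab a)].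
Proof.
have [N N_bound] := hecke_word_bounded w; pose r0 := Ordinal n_gt0.
(* Stated as an implication so that one choice function covers all families of sets; those that are
   not tableaux receive a dummy value. *)
pose spec (R : {ffun 'I_n -> {set 'I_N}}) (d : seq (seq (SS_elt n)) * nat * seq (SS_elt n)) :=
  tableau_rows R ->
  [/\ uniq d.1.1, all (fun s => size s == d.1.2) d.1.1,
    (forall i s t, s \in d.1.1 -> word_f i s = Some t -> t \in d.1.1) /\
    (forall i s t, s \in d.1.1 -> word_e i s = Some t -> t \in d.1.1),
    [seq s <- d.1.1 | hw_word s] = [:: d.2] & forall j, word_count d.2 j = #|R j|].
have [d dP] : {d & forall R, spec R (d R)}.
  apply: boolp.choice => R; case: (boolP (tableau_rows R)) => [tR|/negP ntR]; last by exists ([::], 0, [::]).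
  have [D [m [s0 h]]] := tableau_crystal r0 (tableau_rows_mono tR).
  by exists (D, m, s0).
apply: (transported_crystal (singleton r0) N_bound (D := fun R => (d R).1.1) (len := fun R => (d R).1.2)
  (s0 := fun R => (d R).2)) => R tR; by have [? ? [? ?] ? ?] := dP R tR.
Qed.
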